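(* In each statement below let $I$ be a perfect matching of the complete graph in question. For every odd prime $p$, $$\chi'_{\mathrm P}(K_{p+1}-I)=\chi'_{\ell}(K_{p+1}-I)=p-1$$ and $$\chi'_{\mathrm P}(K_{2p}-I)=\chi'_{\ell}(K_{2p}-I)=2p-2.$$ For every odd prime $p\ge5$, $$\chi'_{\mathrm P}(K_{p-1}-I)=\chi'_{\ell}(K_{p-1}-I)=p-3.$$ Moreover, for every odd prime $p$ and every perfect matching $I$ of $K_{2p}$, $$\varepsilon(I)\,S(K_{2p}-I)\equiv-1\pmod p.$$ The quantities $\varepsilon$, $S(\cdot)$, $\chi'_\ell$, $\chi'_{\mathrm P}$ are as defined in the context.
   Context: Signs. The vertices of $K_n$ ($n$ even) are ordered $0<1<\dots<n-1$. For a perfect matching $M$, let $\operatorname{cr}(M)$ be the number of unordered pairs of edges $\{a,c\},\{b,d\}\in M$ with $a<b<c<d$, and put $\varepsilon(M)=(-1)^{\operatorname{cr}(M)}$. A one-factorization of a graph is a partition of its edge set into perfect matchings (an unordered collection). For a one-factorization $\mathcal F$ put $\varepsilon(\mathcal F)=\prod_{M\in\mathcal F}\varepsilon(M)$. For a regular graph $G$ on an ordered vertex set, $S(G)=\sum_{\mathcal F}\varepsilon(\mathcal F)$, the sum over all one-factorizations of $G$ ($S(G)=0$ if none exist). $K_n-I$ is $K_n$ with the edges of $I$ removed, on the same ordered vertex set. Coloring indices of a graph $G$. $\chi'_\ell(G)$ is the least integer $k$ such that whenever each edge is assigned a list of $k$ colors, the edges can be properly colored from their lists. The edge-paintability index $\chi'_{\mathrm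 P}(G)$ is the least $k$ for which Painter has a winning strategy in the following game: each edge starts with $k$ tokens; in each round Lister marks a nonempty set of uncolored edges and removes one token from each of them; Painter then colors a matching consisting of marked edges (these edges are then colored permanently). After Painter's move, Lister wins if some uncolored edge has no token left. Painter wins if every edge is eventually colored. *)

(* Defs.v *)
From HB Require Import structures.
From mathcomp Require Import all_boot all_order all_algebra.
From mathcomp Require Import finmap.
Set Implicit Arguments.
Unset Strict Implicit.
Unset Printing Implicit Defensive.
Import GRing.Theory.

(* A graph with vertex type T is given by its set of edges, each edge being
   the set of its two endpoints. *)
Definition complete (T : finType) : {set {set T}} := [set e : {set T} | #|e| == 2].

Definition perfect_matching (T : finType) (E M : {set {set T}}) : bool :=
  (M \subset E) && partition M [set: T].

Definition one_factorization (T : finType) (E : {set {set T}})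
    (F : {set {set {set T}}}) : bool :=
  partition F E && [forall M in F, perfect_matching E M].

Definition crossings (n : nat) (M : {set {set 'I_n}}) : nat :=
  #|[set P : {set {set 'I_n}} | (P \subset M) &&
      [exists a : 'I_n, exists b : 'I_n, exists c : 'I_n, exists d : 'I_n,
        [&& a < b, b < c, c < d & P == [set [set a; c]; [set b; d]]]]]|.

Definition matching_sign (n : nat) (M : {set {set 'I_n}}) : int :=
  ((-1) ^+ crossings M)%R.

Definition factorization_sign (n : nat) (F : {set {set {set 'I_n}}}) : int :=
  (\prod_(M in F) matching_sign M)%R.

Definition signed_factorizations (n : nat) (E : {set {set 'I_n}}) : int :=
  (\sum_(F | one_factorization E F) factorization_sign F)%R.

Definition proper_edge_coloring (T : finType) (E : {set {set T}})
    (c : {set T} -> nat) : Prop :=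
  forall e f : {set T}, e \in E -> f \in E -> e != f ->
    ~~ [disjoint e & f] -> c e != c f.

Definition edge_choosable (T : finType) (E : {set {set T}}) (k : nat) : Prop :=
  forall L : {set T} -> {fset nat},
    (forall e, e \in E -> #|` L e| = k) ->
    exists c : {set T} -> nat,
      (forall e, e \in E -> c e \in L e) /\ proper_edge_coloring E c.

(* The subtraction never truncates in a play: uncolored edges always have a
   token left when Lister moves. *)
Definition remove_tokens (T : finType) (A : {set {set T}})
    (t : {ffun {set T} -> nat}) : {ffun {set T} -> nat} :=
  [ffun e => t e - (e \in A)].

(* painter_wins U t: Painter has a winning strategy when Lister is to move,
   U is the set of uncolored edges and t gives the remaining tokens.  The
   position is lost for Painter if an edge of U has no token; this includes the
   start with zero tokens.  It is won if U is empty, since Lister then has no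
   move.  The predicate being inductive, Painter wins in finitely many rounds. *)
Inductive painter_wins (T : finType) (U : {set {set T}})
    (t : {ffun {set T} -> nat}) : Prop :=
| PainterWins :
    (forall e, e \in U -> 0 < t e) ->
    (forall A : {set {set T}}, A \subset U -> A != set0 ->
       exists B : {set {set T}},
         [/\ B \subset A, trivIset B & painter_wins (U :\: B) (remove_tokens A t)]) ->
    painter_wins U t.

Definition edge_paintable (T : finType) (E : {set {set T}}) (k : nat) : Prop :=
  painter_wins E [ffun=> k].

Definition is_least (P : nat -> Prop) (k : nat) : Prop :=
  P k /\ forall j, P j -> k <= j.

Definition is_list_edge_index (T : finType) (E : {set {set T}}) (k : nat) : Prop :=
  is_least (edge_choosable E) k.

Definition is_edge_paintability_index (T : finType) (E : {set {set T}})
    (k : nat) : Prop :=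
  is_least (edge_paintable E) k.

(* Main.v *)
(** If [S(G)] is nonzero for a [d]-regular graph [G], then the line graph
    polynomial [\prod (X_e - X_f)] over adjacent edges has a monomial of degree
    less than [d] in every variable, because its values at the proper colourings
    by [d]-th roots of unity add up, with suitable weights, to a nonzero multiple
    of [S(G)]; such a monomial is an invariant that Painter can maintain.

    Relabelling the vertices shows that [eps(I) S(K_n - I)] depends neither on
    [I] nor on the order of the vertices, and summing over [I] gives
    [(n - 1) S(K_n)]. So for [n = p - 1] and [n = p + 1] it suffices that [S(K_n)]
    is nonzero modulo [p].

    For [n = p + 1] and [n = 2 p], let [Z/pZ] act by translations with one fixed
    point, respectively on two copies of itself. Modulo [p] only the invariant
    factorizations count; they are generated by one, respectively two, starters of
    [Z/pZ], so everything is expressed by the signed sum [T] over the starters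
    whose pairs have differences [1, ..., (p - 1)/2]. A starter is a word with
    distinct letters, its sign is a quotient of Vandermonde determinants, and the
    evaluation by power sums and Wilson's theorem gives [T^2 = 1].

    For [n = p - 1] there are [n - 1 = p - 2], that is [-2] modulo [p], colours.
    Splitting the vertices into pairs turns the signed count of colourings into a
    sum over permutations of [(-2)^cycles], which counts signed orientations; these
    are tournaments on [n] vertices, and Vandermonde's identity leaves a sum of
    equal terms indexed by a group whose order divides [n!]. *)

Require Import Defs.
From HB Require Import structures.
From mathcomp Require Import all_boot all_order all_algebra.
From mathcomp Require Import all_fingroup all_solvable all_field.
From mathcomp Require Import finmap ssrcomplements mpoly ring zify.
Set Implicit Arguments.
Unset Strict Implicit.
Unset Printing Implicit Defensive.
Import GRing.Theory.
Local Open Scope ring_scope.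

(** * Products over unordered pairs and crossing signs *)

(** Every sign below is a product over unordered pairs. For disjoint edges [chi] multiplies the
    order signs of the four pairs of endpoints; it is -1 exactly when the edges cross, and it is
    symmetric because edges have even size. The sign of a bijection is the same kind of product over
    pairs of vertices. Splitting these pairs by the blocks of a matching separates the pairs across
    blocks, which the matching sign sees, from those inside blocks; relabellings, translations and
    starters are all compared through this identity.

    The line graph polynomial orders the colours around each vertex, whereas crossing signs order
    the vertices within each colour. Both are inversion signs of one bijection from incident pairs
    (vertex, edge) to pairs (vertex, colour), so they differ by a global sign.

    Only the square of [T] is needed: [T] enters linearly for [p + 1] vertices, where being nonzero
    suffices, and quadratically for [2 p] vertices, where the difference between the two copies can
    still be any of [p - 1] nonzero residues. This is where the -1 of the congruence comes from. *)

Definition rk (X : finType) : rel X := fun x y => (enum_rank x < enum_rank y)%N.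

Definition tournament (X : finType) (D : {set X}) (r : rel X) :=
  {in D &, forall x y, r x y = (x != y) && ~~ r y x}.

(** A product over unordered pairs: a relation [r] that is a tournament on [D] selects one ordered
    representative of each pair, and for symmetric [f] any tournament gives the same value. *)
Definition pairprod (R : comNzRingType) (X : finType) (r : rel X) (D : {set X})
    (f : X -> X -> R) : R :=
  \prod_(u : X * X | [&& u.1 \in D, u.2 \in D & r u.1 u.2]) f u.1 u.2.

Notation pp := (pairprod (@rk _)).

Lemma rk_tournament (X : finType) (D : {set X}) : tournament D (@rk X).
Proof.
move=> x y _ _; rewrite /rk -leqNgt ltn_neqAle.
by rewrite (inj_eq val_inj) (inj_eq enum_rank_inj).
Qed.

Lemma key_tournament (X : finType) (kap : X -> nat) (D : {set X}) :
  injective kap -> tournament D (fun x y => (kap x < kap y)%N).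
Proof. by move=> kI x y _ _; rewrite -leqNgt ltn_neqAle (inj_eq kI). Qed.

Section PairProducts.
Variables (R : comNzRingType) (X : finType).
Implicit Types (D : {set X}) (f g : X -> X -> R) (r : rel X).

(** The pairs oriented alike by both relations occur on both sides; the others are matched by
    reversing the pair, which [f] does not notice. *)
Lemma pairprod_tour r1 r2 D f :
  tournament D r1 -> tournament D r2 -> {in D &, forall x y, f x y = f y x} ->
  pairprod r1 D f = pairprod r2 D f.
Proof.
move=> t1 t2 fC; rewrite /pairprod.
rewrite (bigID (fun u => r2 u.1 u.2)) [in RHS](bigID (fun u => r1 u.1 u.2)) /=.
congr (_ * _).
  by apply: eq_bigl => u; rewrite -!andbA; do !bool_congr; rewrite andbC.
rewrite (reindex_inj (h := fun u : X * X => (u.2, u.1))) /=; last first.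
  by move=> [a b] [c d] /= [-> ->].
apply: eq_big => [[x y]|[x y]] /=; last by case/andP=> /and3P[yD xD _] _; exact: fC.
case xD: (x \in D); case yD: (y \in D) => //=.
rewrite (t1 y x) // (t2 x y) // eq_sym.
by case: (x == y) => //=; rewrite ?andbF //= andbC; case: (r1 x y) (t1 x y xD yD).
Qed.

Lemma eq_pairprod r D f g : tournament D r ->
  {in D &, forall x y, x != y -> f x y = g x y} -> pairprod r D f = pairprod r D g.
Proof.
move=> t fg; apply: eq_bigr => -[x y] /= /and3P[xD yD]; rewrite t // => /andP[xy _].
exact: fg.
Qed.

Lemma pairprodM r D f g :
  pairprod r D (fun x y => f x y * g x y) = pairprod r D f * pairprod r D g.
Proof. by rewrite /pairprod big_split. Qed.

Lemma pairprod1 r D f : tournament D r -> {in D &, forall x y, x != y -> f x y = 1} ->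
  pairprod r D f = 1.
Proof. by move=> t f1; rewrite (eq_pairprod t f1) /pairprod big1. Qed.

Lemma pairprod_sqr1 r D f : tournament D r ->
  {in D &, forall x y, x != y -> f x y * f x y = 1} ->
  pairprod r D f * pairprod r D f = 1.
Proof. by move=> t f1; rewrite -pairprodM; apply: pairprod1. Qed.

Lemma pp_set2 x y f : x != y -> f x y = f y x -> pp [set x; y] f = f x y.
Proof.
move=> xy fC; pose r a b := (a == x) && (b == y).
have rt : tournament [set x; y] r.
  move=> a b; rewrite !inE /r => /orP[]/eqP-> /orP[]/eqP->; rewrite ?eqxx ?(negPf xy) //=.
  - by rewrite andbF.
  - by rewrite !andbF.
  - by rewrite eq_sym (negPf xy).
rewrite (pairprod_tour (@rk_tournament _ _) rt); last first.
  by move=> a b; rewrite !inE => /orP[]/eqP-> /orP[]/eqP->.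
rewrite /pairprod (big_pred1 (x, y)) // => -[a b] /=.
rewrite !inE /r xpair_eqE; case: (a == x); rewrite ?andbF //=.
by case: (b == y); rewrite ?orbT ?andbF.
Qed.

(** The order may be replaced by the one comparing images under [g] first: pairs inside a fibre keep
    their order, pairs across fibres are oriented like their images. *)
Lemma pp_fib (Y : finType) (g : X -> Y) D f :
  {in D &, forall x y, f x y = f y x} ->
  pp D f = (\prod_y pp [set x in D | g x == y] f) *
    pp [set: Y] (fun y y' => \prod_(x in D | g x == y) \prod_(x' in D | g x' == y') f x x').
Proof.
move=> fC.
pose r2 x x' := if g x == g x' then rk x x' else rk (g x) (g x').
have r2t : tournament D r2.
  move=> x y xD yD; rewrite /r2 [g y == _]eq_sym; case: eqP => [_|/eqP gxy].
    exact: (rk_tournament xD yD).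
  rewrite (@rk_tournament Y setT) ?inE // gxy /=.
  by have -> : x != y by apply: contra gxy => /eqP->.
rewrite (pairprod_tour (@rk_tournament _ _) r2t) //.
rewrite /pairprod (bigID (fun u => g u.1 == g u.2)) /=; congr (_ * _).
  rewrite (partition_big (fun u : X * X => g u.1) xpredT) //=.
  apply: eq_bigr => y _; apply: eq_bigl => -[a b] /=; rewrite !inE /r2.
  case: (a \in D); case: (b \in D); rewrite //= ?andbF //=.
  case: eqP => [<-|ne]; rewrite ?eqxx ?andbT ?andbF /=.
    by case: eqP; rewrite ?andbT ?andbF.
  by apply/esym/negbTE; apply/negP => /and3P[/eqP ay /eqP yb _]; rewrite ay yb in ne.
rewrite (partition_big (fun u : X * X => (g u.1, g u.2))
          (fun w => [&& w.1 \in setT, w.2 \in setT & rk w.1 w.2])) /=; last first.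
  by move=> [a b] /= /andP[/and3P[_ _ rab] /negPf gab]; rewrite !inE; rewrite /r2 gab in rab.
apply: eq_bigr => -[y y'] /=; rewrite !inE /= => yy'.
rewrite pair_big /=; apply: eq_bigl => -[a b] /=; rewrite xpair_eqE /r2.
case: (a \in D); case: (b \in D); rewrite //= ?andbF //=.
case: (g a =P y) => [->|]; rewrite ?andbF //=; case: (g b =P y') => [->|]; rewrite ?andbF //=.
have ne : (y == y') = false.
  by apply/negbTE; move: yy'; rewrite (@rk_tournament Y setT) ?inE // => /andP[].
by rewrite ne yy'.
Qed.

(** These are the fibres of [pblock P]; a set that is not a block has an empty fibre and contributes
    1. *)
Lemma pp_part (P : {set {set X}}) D f : partition P D ->
  {in D &, forall x y, f x y = f y x} ->
  pp D f = (\prod_(B in P) pp B f) *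
    pp P (fun B C => \prod_(x in B) \prod_(y in C) f x y).
Proof.
move=> partP fC; have [/eqP covP tP nP] := and3P partP.
rewrite (pp_fib (pblock P)) //.
have fibE B : B \in P -> [set x in D | pblock P x == B] = B.
  move=> BP; apply/setP=> x; rewrite inE; apply/andP/idP => [[xD /eqP <-]|xB].
    by rewrite mem_pblock covP.
  split; last by rewrite (def_pblock tP BP xB).
  by rewrite -covP; apply/bigcupP; exists B.
have fibE' B x : B \in P -> (x \in D) && (pblock P x == B) = (x \in B).
  by move=> BP; rewrite -[in RHS](fibE _ BP) inE.
have fib0 B x : B \notin P -> (x \in D) && (pblock P x == B) = false.
  move=> BP; apply/negP => /andP[xD /eqP eB]; case/negP: BP.
  by rewrite -eB pblock_mem // covP.
congr (_ * _).
  rewrite [LHS](bigID (mem P)) /= [X in _ * X]big1 ?mulr1; last first.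
    move=> B BP; rewrite /pairprod big_pred0 // => u.
    by rewrite !inE fib0.
  by apply: eq_bigr => B BP; rewrite fibE.
rewrite /pairprod [LHS](bigID (fun w => (w.1 \in P) && (w.2 \in P))) /=.
rewrite [X in _ * X]big1 ?mulr1; last first.
  move=> [B C] /= /andP[_]; rewrite negb_and => /orP[] h.
    by rewrite big_pred0 // => x; rewrite fib0.
  by apply: big1 => x _; rewrite big_pred0 // => y; rewrite fib0.
apply: eq_big => [[B C]|[B C]] /=; first by rewrite !inE /= andbC andbA.
case/andP=> _ /andP[BP CP].
by apply: eq_big => [x|x _]; [exact: fibE' | apply: eq_bigl => y; exact: fibE'].
Qed.

End PairProducts.

Lemma pp_imset (R : comNzRingType) (X Y : finType) (b : X -> Y) (D : {set X})
    (f : Y -> Y -> R) : {in D &, injective b} ->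
  {in D &, forall x y, f (b x) (b y) = f (b y) (b x)} ->
  pp (b @: D) f = pp D (fun x y => f (b x) (b y)).
Proof.
move=> bI fC.
have rt : tournament D (fun x y => rk (b x) (b y)).
  move=> x y xD yD; rewrite (@rk_tournament Y setT) ?inE //.
  by rewrite (inj_in_eq bI).
rewrite (pairprod_tour (@rk_tournament _ _) rt) //.
pose h (u : X * X) := (b u.1, b u.2).
pose A := [set u | [&& u.1 \in D, u.2 \in D & rk (b u.1) (b u.2)]].
rewrite /pairprod (eq_bigl (mem (h @: A))); last first.
  move=> [y y'] /=; apply/and3P/imsetP => [[/imsetP[x xD ->] /imsetP[x' x'D ->] rr]|].
    by exists (x, x') => //; rewrite inE /= xD x'D.
  by case=> -[x x']; rewrite inE /= => /and3P[xD x'D rr] [-> ->]; rewrite !imset_f.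
rewrite big_imset /=; last first.
  move=> [x x'] [z z']; rewrite !inE /= => /and3P[xD x'D _] /and3P[zD z'D _] [e1 e2].
  by congr (_, _); apply: bI.
by apply: eq_bigl => u; rewrite inE.
Qed.

Definition sg (V : finType) (kap : V -> nat) (x y : V) : int :=
  if (kap x < kap y)%N then 1 else -1.

Definition chi (V : finType) (kap : V -> nat) (e f : {set V}) : int :=
  \prod_(x in e) \prod_(y in f) sg kap x y.

Definition msign (V : finType) (kap : V -> nat) (M : {set {set V}}) : int :=
  pp M (chi kap).

Definition flip (V V' : finType) (kap : V -> nat) (kap' : V' -> nat) (b : V -> V')
    (x y : V) : int :=
  sg kap x y * sg kap' (b x) (b y).

(** The inversion sign of a bijection between two sets with unrelated orders; for a permutation and
    equal keys it is the signature ([bsign_perm]). *)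
Definition bsign (V V' : finType) (kap : V -> nat) (kap' : V' -> nat) (b : V -> V') : int :=
  pp [set: V] (flip kap kap' b).

(** This is what makes [chi] symmetric on the blocks. The condition bears on products of sizes so
    that one block of odd size is allowed, as in the pairing of residues by negation, where 0 is
    alone. *)
Definition even_pairs (V : finType) (M : {set {set V}}) :=
  {in M &, forall e f : {set V}, e != f -> ~~ odd (#|e| * #|f|)}.

Section Signs.
Variables (V : finType) (kap : V -> nat).
Hypothesis kI : injective kap.

Lemma sg_sqr x y : sg kap x y * sg kap x y = 1.
Proof. by rewrite /sg; case: ifP. Qed.

Lemma sgN x y : x != y -> sg kap y x = - sg kap x y.
Proof.
move=> xy; have := key_tournament kI (in_setT x) (in_setT y).
by rewrite xy /= /sg => ->; case: (kap y < kap x)%N.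
Qed.

Lemma chi_sqr e f : chi kap e f * chi kap e f = 1.
Proof.
rewrite /chi -big_split big1 // => x _; rewrite -big_split big1 // => y _.
exact: sg_sqr.
Qed.

Lemma chiC (e f : {set V}) : [disjoint e & f] -> ~~ odd (#|e| * #|f|) -> chi kap e f = chi kap f e.
Proof.
move=> dis /negPf ev; rewrite /chi exchange_big /= .
under eq_bigr => y yf. 
  under eq_bigr => x xe.
    rewrite (@sgN y x); last by apply: contraTneq xe => <-; rewrite (disjointFl dis).
    rewrite -mulN1r; over.
  rewrite big_split /= prodr_const; over.
by rewrite big_split /= prodr_const -exprM -signr_odd ev mul1r.
Qed.

Lemma msign_sqr M : msign kap M * msign kap M = 1.
Proof. by apply: pairprod_sqr1 => [|e f _ _ _]; [exact: rk_tournament | exact: chi_sqr]. Qed.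

End Signs.

Lemma chiC_part (V : finType) (kap : V -> nat) (M : {set {set V}}) : injective kap ->
  trivIset M -> even_pairs M -> {in M &, forall e f : {set V}, chi kap e f = chi kap f e}.
Proof.
move=> kI /trivIsetP tM evM e f eM fM; case: (eqVneq e f) => [->//|ef].
by apply: chiC => //; [exact: tM | exact: evM].
Qed.

Lemma trivIset_imset2 (V V' : finType) (b : V -> V') (M : {set {set V}}) :
  injective b -> trivIset M -> trivIset [set b @: (e : {set V}) | e in M].
Proof.
move=> bI /trivIsetP tM; apply/trivIsetP => _ _ /imsetP[e eM ->] /imsetP[f fM ->] ne.
by rewrite imset_disjoint //; apply: tM => //; apply: contraNneq ne => ->.
Qed.

Section Flips.
Variables (V V' : finType) (kap : V -> nat) (kap' : V' -> nat) (b : V -> V').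
Hypotheses (kI : injective kap) (kI' : injective kap') (bI : injective b).

Lemma flip_sqr x y : flip kap kap' b x y * flip kap kap' b x y = 1.
Proof. by rewrite /flip mulrACA !sg_sqr. Qed.

Lemma flipC x y : flip kap kap' b x y = flip kap kap' b y x.
Proof.
case: (eqVneq x y) => [->//|xy]; rewrite /flip (sgN kI xy) (@sgN _ _ kI' (b x)) ?mulrNN //.
by rewrite (inj_eq bI).
Qed.

Lemma bsign_sqr : bsign kap kap' b * bsign kap kap' b = 1.
Proof. by apply: pairprod_sqr1 => [|e f _ _ _]; [exact: rk_tournament | exact: flip_sqr]. Qed.

Lemma flip_sqr_prod e : pp e (flip kap kap' b) * pp e (flip kap kap' b) = 1.
Proof. by apply: pairprod_sqr1 => [|x f _ _ _]; [exact: rk_tournament | exact: flip_sqr]. Qed.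

(* [bsign] also counts the pairs of vertices inside a block, which [msign] does
   not see; the last factor removes them. *)
Lemma msign_relabel M : partition M [set: V] -> even_pairs M ->
  msign kap' [set b @: (e : {set V}) | e in M] =
  msign kap M * bsign kap kap' b * \prod_(e in M) pp e (flip kap kap' b).
Proof.
move=> partM evM; have tM : trivIset M by case/and3P: partM.
have bbI := imset_inj bI.
have evM' : even_pairs [set b @: (e : {set V}) | e in M].
  move=> _ _ /imsetP[e eM ->] /imsetP[f fM ->] ne; rewrite !card_imset //.
  by apply: evM => //; apply: contraNneq ne => ->.
have tM' := trivIset_imset2 bI tM.
have -> : msign kap' [set b @: (e : {set V}) | e in M] =
          pp M (fun e f => chi kap' (b @: e) (b @: f)).
  rewrite /msign pp_imset //; first by move=> e f _ _; exact: bbI.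
  by move=> e f eM fM; apply: chiC_part tM' evM' _ _ _ _ => //; rewrite imset_f.
rewrite /bsign (pp_part partM); last by move=> x y _ _; exact: flipC.
have -> : pp M (fun B C : {set V} => \prod_(x in B) \prod_(y in C) flip kap kap' b x y) =
    msign kap M * pp M (fun e f : {set V} => chi kap' (b @: e) (b @: f)).
  rewrite /msign -pairprodM; apply: eq_pairprod; first exact: rk_tournament.
  move=> e f _ _ _; rewrite /chi big_imset /=; last by move=> x y _ _; exact: bI.
  rewrite -big_split; apply: eq_bigr => x _; rewrite big_split big_imset //=.
  by move=> y z _ _; exact: bI.
set A := msign _ _; set X := pp M _; set E := \prod_(e in M) _.
have AA : A * A = 1 by exact: msign_sqr.
have EE : E * E = 1.
  by rewrite /E -big_split big1 // => e _; exact: flip_sqr_prod.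
transitivity ((A * A) * (E * E) * X); first by rewrite AA EE !mul1r.
by ring.
Qed.

End Flips.

Lemma bsign_comp (V V' V'' : finType) (kap : V -> nat) (kap' : V' -> nat)
    (kap'' : V'' -> nat) (b : V -> V') (c : V' -> V'') :
  injective kap' -> injective kap'' -> bijective b -> injective c ->
  bsign kap kap'' (c \o b) = bsign kap kap' b * bsign kap' kap'' c.
Proof.
move=> kI' kI'' bB cI; have bI := bij_inj bB.
rewrite /bsign; have <- : b @: [set: V] = [set: V'].
  have [a ba ab] := bB.
  by apply/setP => x; rewrite inE; apply/imsetP; exists (a x).
rewrite pp_imset; first last.
- by move=> x y _ _; exact: flipC.
- by move=> x y _ _; exact: bI.
rewrite -pairprodM; apply: eq_pairprod => [|x y _ _ _]; first exact: rk_tournament.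
rewrite /flip /= -mulrA; congr (_ * _).
by rewrite mulrA sg_sqr mul1r.
Qed.

Section PermSigns.
Variables (V : finType) (kap : V -> nat).
Hypothesis kI : injective kap.
Local Notation psign s := (bsign kap kap (fun_of_perm s)).

(** The pair [{x, y}] itself is inverted, pairs avoiding both points are not, and for each other
    point [t] the pairs [{x, t}] and [{y, t}] together contribute a square. *)
Lemma bsign_tperm x y : x != y -> psign (tperm x y) = -1.
Proof.
move=> xy; have tI : injective (tperm x y) by exact: perm_inj.
rewrite /bsign (pp_fib (fun z => z \in [set x; y])); last first.
  by move=> u v _ _; exact: flipC.
rewrite big_bool /=.
have -> : [set z in [set: V] | (z \in [set x; y]) == true] = [set x; y].
  by apply/setP=> z; rewrite !inE eqb_id.
rewrite pp_set2 //; last exact: flipC.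
rewrite {1}/flip tpermL tpermR (sgN kI xy) mulrN sg_sqr.
rewrite pairprod1; first last.
- move=> u v; rewrite !inE => /eqP /norP[ux uy] /eqP /norP[vx vy] _.
  by rewrite /flip !tpermD ?sg_sqr // eq_sym.
- exact: rk_tournament.
rewrite pairprod1 ?mulr1 //; first exact: rk_tournament.
pose c b b' := \prod_(z in setT | (z \in [set x; y]) == b)
   \prod_(t in setT | (t \in [set x; y]) == b') flip kap kap (tperm x y) z t.
suff cT : c true false = 1.
  move=> [] [] _ _ //= _; rewrite -/(c _ _) //.
  rewrite -[RHS]cT /c exchange_big /=; apply: eq_bigr => u _; apply: eq_bigr => v _.
  exact: flipC.
rewrite /c exchange_big big1 //= => t; rewrite !inE => /eqP /norP[tx ty].
rewrite (eq_bigl (mem [set x; y])); last by move=> z; rewrite !inE eqb_id.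
rewrite big_setU1 ?inE //= big_set1 /flip tpermL tpermR !tpermD ?[_ == t]eq_sym //.
by rewrite mulrACA [sg kap y t * _]mulrC mulrACA !sg_sqr.
Qed.

Lemma bsign1 : psign (1%g : {perm V}) = 1.
Proof.
rewrite /bsign pairprod1 //; first exact: rk_tournament.
by move=> x y _ _ _; rewrite /flip !perm1 sg_sqr.
Qed.

Lemma bsignM (s t : {perm V}) : psign (s * t)%g = psign s * psign t.
Proof.
rewrite -(bsign_comp kap kI kI (injF_bij (@perm_inj _ s)) (@perm_inj _ t)).
by apply: eq_pairprod => [|x y _ _ _]; [exact: rk_tournament | rewrite /flip !permM].
Qed.

Lemma bsign_perm (s : {perm V}) : psign s = (-1) ^+ s.
Proof.
have [ts -> ne] := prod_tpermP s.
elim: ts ne => [_|t ts IH /=]; first by rewrite big_nil bsign1 odd_perm1.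
case/andP=> t1 /IH {}IH; rewrite big_cons bsignM IH bsign_tperm // odd_permM odd_tperm t1.
by rewrite signr_addb.
Qed.

End PermSigns.

Section Crossings.
Variable n : nat.
Local Notation key := (@nat_of_ord n).

Lemma chi2 (V : finType) (kap : V -> nat) (a b c d : V) : a != c -> b != d ->
  chi kap [set a; c] [set b; d] =
  sg kap a b * sg kap a d * (sg kap c b * sg kap c d).
Proof. by move=> ac bd; rewrite /chi !big_setU1 ?inE //= !big_set1 !big_setU1 ?inE //= !big_set1. Qed.

Definition crossing (P : {set {set 'I_n}}) : bool :=
  [exists a : 'I_n, exists b : 'I_n, exists c : 'I_n, exists d : 'I_n,
        [&& (a < b)%N, (b < c)%N, (c < d)%N & P == [set [set a; c]; [set b; d]]]].

Lemma set2_eq (X : finType) (x y z t : X) : [set x; y] = [set z; t] ->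
  (x = z /\ y = t) \/ (x = t /\ y = z).
Proof.
move=> E; have hx : x \in [set z; t] by rewrite -E set21.
have hy : y \in [set z; t] by rewrite -E set22.
have hz : z \in [set x; y] by rewrite E set21.
have ht : t \in [set x; y] by rewrite E set22.
move: hx hy hz ht; rewrite !inE => /orP[]/eqP-> /orP[]/eqP->; rewrite ?orbb; auto.
  by move=> _ /eqP; auto.
by move=> /eqP; auto.
Qed.

Lemma sg_product (a b c d : nat) : (a < c)%N -> (b < d)%N -> a <> b -> a <> d ->
  c <> b -> c <> d ->
  (if (a < b)%N then 1 else -1) * (if (a < d)%N then 1 else -1) *
  ((if (c < b)%N then 1 else -1) * (if (c < d)%N then 1 else -1)) =
  if [|| [&& a < b, b < c & c < d] | [&& b < a, a < d & d < c]]%N then -1 else 1 :> int.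
Proof.
move=> ac bd ab ad cb cd.
case: (ltngtP a b) => //= hab.
  case: (ltngtP c b) => //= hcb.
    by rewrite (ltn_trans ac (ltn_trans hcb bd)) (ltn_trans hcb bd).
  by rewrite (ltn_trans hab bd); case: ltnP.
case: (ltngtP a d) => //= had.
  rewrite (ltnNge c b) ltnW ?(ltn_trans hab) //=; case: ltngtP cd => //.
have -> : (c < b)%N = false by lia.
by have -> : (c < d)%N = false by lia.
Qed.

Lemma chi_crossing (e f : {set 'I_n}) : #|e| = 2 -> #|f| = 2 -> [disjoint e & f] ->
  chi key e f = if crossing [set e; f] then -1 else 1.
Proof.
move=> e2 f2 dis.
have sorted2 (g : {set 'I_n}) : #|g| = 2 -> exists x y : 'I_n, (x < y)%N /\ g = [set x; y].
  move/eqP/cards2P => [x [y [xy ->]]].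
  case: (ltngtP x y) => h; first by exists x, y.
    by exists y, x; rewrite setUC.
  by rewrite (ord_inj h) eqxx in xy.
have [a [c [ac ea]]] := sorted2 e e2; have [b [d [bd fb]]] := sorted2 f f2.
have neq x y : x \in e -> y \in f -> nat_of_ord x <> y.
  by move=> xe yf /ord_inj xy; move: (disjointFl dis yf); rewrite -xy xe.
have nab : nat_of_ord a <> b by apply: neq; rewrite ?ea ?fb !inE eqxx ?orbT.
have nad : nat_of_ord a <> d by apply: neq; rewrite ?ea ?fb !inE eqxx ?orbT.
have ncb : nat_of_ord c <> b by apply: neq; rewrite ?ea ?fb !inE eqxx ?orbT.
have ncd : nat_of_ord c <> d by apply: neq; rewrite ?ea ?fb !inE eqxx ?orbT.
have -> : chi key e f = sg key a b * sg key a d * (sg key c b * sg key c d).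
  by rewrite ea fb chi2 // -(inj_eq val_inj) /= ltn_eqF.
rewrite /sg sg_product //; congr (if _ then _ else _).
rewrite ea fb; apply/idP/idP => [/orP[] /and3P[h1 h2 h3]|].
- apply/existsP; exists a; apply/existsP; exists b; apply/existsP; exists c.
  by apply/existsP; exists d; rewrite h1 h2 h3 /=.
- apply/existsP; exists b; apply/existsP; exists a; apply/existsP; exists d.
  by apply/existsP; exists c; rewrite h1 h2 h3 setUC /=.
case/existsP=> a' /existsP[b' /existsP[c' /existsP[d' /and4P[ab' bc' cd' /eqP E]]]].
have ac' := ltn_trans ab' bc'; have bd' := ltn_trans bc' cd'.
case/set2_eq: E => -[/set2_eq h1 /set2_eq h2].
  case: h1 => -[? ?]; subst; last by rewrite ltnNge (ltnW ac') in ac.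
  case: h2 => -[? ?]; subst; last by rewrite ltnNge (ltnW bd') in bd.
  by rewrite ab' bc' cd'.
case: h1 => -[? ?]; subst; last by rewrite ltnNge (ltnW bd') in ac.
case: h2 => -[? ?]; subst; last by rewrite ltnNge (ltnW ac') in bd.
by rewrite ab' bc' cd' orbT.
Qed.

(** Each crossing set [P] comes from exactly one pair of edges ordered by [rk], so the factors -1
    are as many as the crossings. *)
Lemma matching_sign_msign (M : {set {set 'I_n}}) :
  perfect_matching (complete 'I_n) M -> matching_sign M = msign key M.
Proof.
case/andP=> /subsetP Mc /and3P[_ /trivIsetP tM _].
rewrite /msign /pairprod.
rewrite (eq_bigr (fun u => if crossing [set u.1; u.2] then -1 else 1)); last first.
  move=> [e f] /= /and3P[eM fM]; rewrite (@rk_tournament _ setT) ?inE // => /andP[ef _].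
  have := Mc _ eM; have := Mc _ fM; rewrite !inE => /eqP f2 /eqP e2.
  by apply: chi_crossing => //; exact: tM.
pose B := [set u : {set 'I_n} * {set 'I_n} |
  [&& u.1 \in M, u.2 \in M & rk u.1 u.2] && crossing [set u.1; u.2]].
rewrite -big_mkcondr /= (eq_bigl (fun u => u \in B)) => [|u]; last by rewrite [RHS]inE.
rewrite prodr_const /matching_sign /crossings; congr (_ ^+ _).
pose h (u : {set 'I_n} * {set 'I_n}) := [set u.1; u.2].
set A := [set P | _].
have -> : A = h @: B.
  apply/setP=> P; rewrite inE; apply/andP/imsetP => [[PM cr]|].
    have /existsP[a /existsP[b /existsP[c /existsP[d /and4P[ab bc cd /eqP E]]]]] := cr.
    have h1 : [set a; c] \in M by apply: (subsetP PM); rewrite E !inE eqxx.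
    have h2 : [set b; d] \in M by apply: (subsetP PM); rewrite E !inE eqxx orbT.
    have ne : [set a; c] != [set b; d].
      apply/eqP => E'; have := set21 a c; rewrite E' !inE => /orP[]/eqP ea.
        by rewrite ea ltnn in ab.
      by have := ltn_trans ab (ltn_trans bc cd); rewrite ea ltnn.
    have := @rk_tournament _ setT [set a; c] [set b; d] (in_setT _) (in_setT _).
    rewrite ne /=; case: (boolP (rk [set b; d] [set a; c])) => rr rr'.
      exists ([set b; d], [set a; c]); last by rewrite E /h /= setUC.
      by rewrite inE /= h1 h2 rr -/(crossing _) setUC -E.
    exists ([set a; c], [set b; d]); last by rewrite E.
    by rewrite inE /= h1 h2 rr' -E.
  case=> -[e f] /[swap] ->; rewrite inE /= => /andP[/and3P[eM fM _] cr].
  by split=> //; apply/subsetP => x; rewrite !inE => /orP[]/eqP->.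
rewrite card_in_imset // => -[e f] [e' f']; rewrite !inE /h /=.
move=> /andP[/and3P[_ _ r1] _] /andP[/and3P[_ _ r2] _] /set2_eq [] [E1 E2]; subst=> //.
move: r1; rewrite (@rk_tournament _ setT) ?inE //; by rewrite r2 andbF.
Qed.

End Crossings.

(** * Signed sums under relabelling *)

Definition fsign (V : finType) (kap : V -> nat) (F : {set {set {set V}}}) : int :=
  \prod_(M in F) msign kap M.

Definition Ssum (V : finType) (kap : V -> nat) (E : {set {set V}}) : int :=
  \sum_(F | one_factorization E F) fsign kap F.

Definition regular (V : finType) (E : {set {set V}}) (d : nat) :=
  forall v : V, #|[set e in E | v \in e]| = d.

Definition im2 (V W : finType) (b : V -> W) (M : {set {set V}}) : {set {set W}} :=
  [set b @: (e : {set V}) | e in M].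

Definition im3 (V W : finType) (b : V -> W) (F : {set {set {set V}}}) :
  {set {set {set W}}} := [set im2 b M | M in F].

Lemma perfect_matchingE (V : finType) (E M : {set {set V}}) :
  perfect_matching E M = (M \subset E) && partition M [set: V].
Proof. by []. Qed.

Lemma one_factorizationP (V : finType) (E : {set {set V}}) F :
  reflect (partition F E /\ {in F, forall M : {set {set V}}, partition M [set: V]})
          (one_factorization E F).
Proof.
apply: (iffP andP) => [[pF /forall_inP h]|[pF h]]; split=> //.
  by move=> M /h /andP[].
apply/forall_inP => M MF; rewrite perfect_matchingE h // andbT.
by case/and3P: pF => /eqP <- _ _; apply: bigcup_sup.
Qed.

Section Basics.
Variable V : finType.
Implicit Types (E M I : {set {set V}}) (F : {set {set {set V}}}).

Lemma complete_even_pairs E M : E \subset complete V -> M \subset E -> even_pairs M.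
Proof.
move=> EK ME e f eM fM _.
have := subsetP EK _ (subsetP ME _ eM); have := subsetP EK _ (subsetP ME _ fM).
by rewrite !inE => /eqP -> /eqP ->.
Qed.

Lemma card_edges_at (P : {set {set V}}) v : partition P [set: V] ->
  #|[set e in P | v \in e]| = 1%N.
Proof.
move=> partP; have [/eqP covP tP _] := and3P partP.
have vc : v \in cover P by rewrite covP.
have -> : [set e in P | v \in e] = [set pblock P v]; last exact: cards1.
apply/setP => e; rewrite !inE; apply/andP/eqP => [[eP ve]|->].
  by rewrite (def_pblock tP eP ve).
by rewrite mem_pblock vc pblock_mem.
Qed.

Lemma regular_complete : regular (complete V) #|V|.-1.
Proof.
move=> v; have -> : [set e in complete V | v \in e] = [set [set v; w] | w in [set~ v]].
  apply/setP=> e; rewrite !inE; apply/andP/imsetP => [[/cards2P[x [y [xy ->]]]]|].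
    rewrite !inE => /orP[]/eqP ->; first by exists y; rewrite // !inE eq_sym.
    by exists x; rewrite ?inE // setUC.
  by case=> w; rewrite !inE => wv ->; rewrite cards2 [v == w]eq_sym wv set21.
rewrite card_in_imset ?cardsC1 // => w w'; rewrite !inE => wv w'v /set2_eq[[]|[]] //.
by move=> -> ->.
Qed.

Lemma regularD E M d : M \subset E -> partition M [set: V] -> regular E d ->
  regular (E :\: M) d.-1.
Proof.
move=> ME pM regE v; rewrite -(regE v).
have -> : [set e in E :\: M | v \in e] =
          [set e in E | v \in e] :\: [set e in M | v \in e].
  by apply/setP=> e; rewrite !inE; case: (v \in e); rewrite ?andbT ?andbF.
rewrite cardsD (setIidPr _) ?(card_edges_at v pM) ?subn1 //.
by apply/subsetP=> e; rewrite !inE => /andP[/(subsetP ME) -> ->].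
Qed.

(** Count the edges at [v]: every matching contains exactly one of them. *)
Lemma card_factorization E F d (v : V) : regular E d -> one_factorization E F -> #|F| = d.
Proof.
move=> regE /one_factorizationP[pF pM].
have : (\sum_(M in F) \sum_(e in M) (v \in e) = \sum_(e in E) (v \in e))%N.
  by rewrite -(set_partition_big _ pF).
rewrite -big_mkcondr /= sum1dep_card regE => <-.
rewrite -sum1_card; apply: eq_bigr => M MF.
by rewrite -big_mkcondr /= sum1dep_card (card_edges_at v (pM _ MF)).
Qed.

Lemma card_perfect_matching M : M \subset complete V -> partition M [set: V] ->
  #|V| = (#|M| * 2)%N.
Proof.
move=> MK pM; rewrite -cardsT; apply: card_uniform_partition pM => e eM.
by have := subsetP MK _ eM; rewrite inE => /eqP.
Qed.

End Basics.

Section Relabel.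
Variables (V W : finType) (b : V -> W).
Hypothesis bB : bijective b.
Let bI := bij_inj bB.
Implicit Types (E M I : {set {set V}}) (F : {set {set {set V}}}).

Lemma imsetT_bij : b @: [set: V] = [set: W].
Proof.
have [a ba ab] := bB.
by apply/setP => x; rewrite inE; apply/imsetP; exists (a x).
Qed.

Lemma im2_inj : injective (im2 b).
Proof. exact: imset_inj (imset_inj bI). Qed.

Lemma im3_inj : injective (im3 b).
Proof. exact: imset_inj im2_inj. Qed.

Lemma partition_im2 M : partition (im2 b M) [set: W] = partition M [set: V].
Proof. by rewrite -imsetT_bij /im2 imset_partition. Qed.

Lemma one_factorization_im E F :
  one_factorization (im2 b E) (im3 b F) = one_factorization E F.
Proof.
apply/one_factorizationP/one_factorizationP; rewrite [partition (im3 b F) _]imset_partition.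
all: try exact: (imset_inj bI).
  move=> [pF pM]; split=> // M MF; rewrite -partition_im2; apply: pM.
  exact: imset_f.
by move=> [pF pM]; split=> // _ /imsetP[M MF ->]; rewrite partition_im2 pM.
Qed.

Lemma im2_complete : im2 b (complete V) = complete W.
Proof.
apply/setP=> e; rewrite inE; apply/imsetP/idP => [[f + ->]|e2].
  by rewrite inE card_imset.
have [a ba ab] := bB; exists (a @: e); last by rewrite -imset_comp (eq_imset _ ab) imset_id.
by rewrite inE card_imset //; apply: can_inj ab.
Qed.

Lemma im2D E M : im2 b (E :\: M) = im2 b E :\: im2 b M.
Proof.
rewrite /im2; apply/setP=> e; apply/imsetP/setDP => [[f /setDP[fE fM] ->]|[/imsetP[f fE ->] fM]].
  by rewrite imset_f // mem_imset //; exact: imset_inj.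
by exists f => //; rewrite inE fE andbT; apply: contra fM => fM; rewrite imset_f.
Qed.

Variables (kap : V -> nat) (kap' : W -> nat).
Hypotheses (kI : injective kap) (kI' : injective kap').
Local Notation N := (bsign kap kap' b).
Local Notation eflip e := (pp e (flip kap kap' b)).

(** [msign_relabel] gives each of the [d] matchings a factor [N] and the flips of its own edges. As
    the matchings partition [E], the total factor is the same for every [F]. *)
Lemma fsign_relabel E d (v : V) F : E \subset complete V -> regular E d ->
  one_factorization E F ->
  fsign kap' (im3 b F) = N ^+ d * (\prod_(e in E) eflip e) * fsign kap F.
Proof.
move=> EK regE Ff; have /one_factorizationP[pF pM] := Ff.
rewrite /fsign /im3 big_imset /=; last by move=> M M' _ _; exact: im2_inj.
have MK M : M \in F -> M \subset complete V.
  move=> MF; apply: subset_trans EK.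
  by case/and3P: pF => /eqP <- _ _; apply: bigcup_sup.
under eq_bigr => M MF do
  rewrite (msign_relabel kI kI' bI (pM _ MF) (complete_even_pairs (subxx _) (MK _ MF))).
rewrite !big_split /= prodr_const (card_factorization v regE Ff).
by rewrite (set_partition_big _ pF) /=; ring.
Qed.

Lemma Ssum_relabel E d (v : V) : E \subset complete V -> regular E d ->
  Ssum kap' (im2 b E) = N ^+ d * (\prod_(e in E) eflip e) * Ssum kap E.
Proof.
move=> EK regE; have [a ba ab] := bB.
have abI : injective a by exact: can_inj ab.
have c3 : cancel (im3 a) (im3 b).
  have c1 : cancel (fun e : {set W} => a @: e) (fun e : {set V} => b @: e).
    by move=> e; rewrite -imset_comp (eq_imset _ ab) imset_id.
  have c2 : cancel (im2 a) (im2 b).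
    by move=> e; rewrite /im2 -imset_comp (eq_imset _ c1) imset_id.
  by move=> e; rewrite /im3 -imset_comp (eq_imset _ c2) imset_id.
rewrite /Ssum (reindex (im3 b)) /=; last first.
  exists (im3 a) => F _; last exact: c3.
  by apply: im3_inj; rewrite c3.
rewrite big_distrr /=; apply: eq_big => F; first exact: one_factorization_im.
by rewrite one_factorization_im; exact: fsign_relabel.
Qed.

(** Pairs of vertices are the same thing as edges of the complete graph. This is what absorbs the
    edge flips in the next two results. *)
Lemma bsign_complete : N = \prod_(e in complete V) eflip e.
Proof.
rewrite /bsign /pairprod.
rewrite (partition_big (fun u : V * V => [set u.1; u.2]) (mem (complete V))) /=; last first.
  move=> [x y]; rewrite !inE (@rk_tournament _ setT) ?inE //= => /andP[xy _].
  by rewrite cards2 xy.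
apply: eq_bigr => e; rewrite inE => /cards2P[x [y [xy ->]]].
apply: eq_bigl => -[z t]; rewrite !in_setT /=.
case: (boolP (rk z t)); rewrite ?andbF //= (@rk_tournament _ setT) ?in_setT // => /andP[zt _] /=.
rewrite andbT; apply/eqP/andP => [<-|]; first by rewrite set21 set22.
by move: zt => /[swap] -[] /set2P[] -> /set2P[] ->; rewrite ?eqxx // setUC.
Qed.

Lemma bsign_exp_even m : ~~ odd m -> N ^+ m = 1.
Proof.
move=> om; rewrite -(odd_double_half m) (negPf om) add0n -mul2n exprM expr2.
by rewrite bsign_sqr ?expr1n.
Qed.

(** [Ssum_relabel] produces [N] to the power [#|V|.-1], and the flips of all edges give one more
    [N]; the exponent [#|V|] is even. *)
Lemma Ssum_complete : ~~ odd #|V| -> (0 < #|V|)%N ->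
  Ssum kap' (complete W) = Ssum kap (complete V).
Proof.
move=> oV V0; have [v _] := card_gt0P V0.
rewrite -im2_complete (Ssum_relabel v (subxx _) (@regular_complete V)).
by rewrite -bsign_complete -exprSr prednK // bsign_exp_even ?mul1r.
Qed.

(** The sign of [I] brings one [N] and the flips in [I], the sum brings the flips outside [I]. All
    flips together make a second [N], and the remaining exponent [#|V| - 2] is even since a perfect
    matching exists. *)
Lemma msign_Ssum_relabel I : I \subset complete V -> partition I [set: V] ->
  (0 < #|V|)%N ->
  msign kap' (im2 b I) * Ssum kap' (complete W :\: im2 b I) =
  msign kap I * Ssum kap (complete V :\: I).
Proof.
move=> IK pI V0; have [v _] := card_gt0P V0.
have regE := regularD IK pI (@regular_complete V).
rewrite -im2_complete -im2D (Ssum_relabel v (subsetDl _ _) regE).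
rewrite (msign_relabel kI kI' bI pI (complete_even_pairs (subxx _) IK)).
have : N = (\prod_(e in I) eflip e) * \prod_(e in complete V :\: I) eflip e.
  by rewrite bsign_complete [LHS](big_setID I) /= (setIidPr IK).
set A := \prod_(e in I) _; set B := \prod_(e in _ :\: _) _ => NAB.
have cV := card_perfect_matching IK pI.
have -> : #|V|.-1.-1 = (#|I|.-1 * 2)%N by rewrite cV; lia.
rewrite bsign_exp_even ?oddM ?andbF // mul1r.
transitivity (msign kap I * (N * (A * B)) * Ssum kap (complete V :\: I)); first by ring.
by rewrite -NAB bsign_sqr // mulr1.
Qed.

End Relabel.

(** * Transport between perfect matchings, and expansion of the signed sum along one matching *)

Section StandardMatching.

Definition std (K : finType) : {set {set K * bool}} :=
  [set [set (i, false); (i, true)] | i : K].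

Lemma perfect_matching_std (V : finType) (I : {set {set V}}) (K : finType) :
  I \subset complete V -> partition I [set: V] -> #|K| = #|I| ->
  exists2 c : K * bool -> V, bijective c & im2 c (std K) = I.
Proof.
move=> IK pI cK.
have [f [fB fE]] : exists f : K -> {set V}, injective f /\ f @: [set: K] = I.
  pose f k := enum_val (cast_ord cK (enum_rank k)).
  have fI : injective f by move=> x y /enum_val_inj /cast_ord_inj /enum_rank_inj.
  exists f; split=> //; apply/eqP; rewrite eqEcard card_imset // cardsT cK leqnn andbT.
  by apply/subsetP => _ /imsetP[k _ ->]; exact: enum_valP.
have fI k : f k \in I by rewrite -fE imset_f.
have ex k : exists xy : V * V, (xy.1 != xy.2) && (f k == [set xy.1; xy.2]).
  have := subsetP IK _ (fI k); rewrite inE => /cards2P[x [y [xy ->]]].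
  by exists (x, y); rewrite xy /=.
pose g k := xchoose (ex k).
have gP k : (g k).1 != (g k).2 /\ f k = [set (g k).1; (g k).2].
  by have /andP[? /eqP ?] := xchooseP (ex k).
pose c (kb : K * bool) := if kb.2 then (g kb.1).2 else (g kb.1).1.
have cf k : c @: [set (k, false); (k, true)] = f k.
  by rewrite imsetU1 imset_set1 (gP k).2.
have cm kb : c kb \in f kb.1.
  by rewrite (gP kb.1).2 /c; case: kb.2; rewrite ?set21 ?set22.
have tI : trivIset I by case/and3P: pI.
have cI : injective c.
  move=> [k x] [l y] E; have kl : k = l.
    apply: fB; apply/eqP; apply/negPn/negP => ne.
    have := trivIsetP tI _ _ (fI k) (fI l) ne.
    by move/disjoint_setI0/setP/(_ (c (k, x))); rewrite !inE cm E (cm (l, y)).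
  move: E; rewrite -kl /c /=; have [/eqP ne _] := gP k.
  by case: x; case: y => //= E; case: ne.
have cc : #|V| = #|{: K * bool}|.
  by rewrite (card_perfect_matching IK pI) card_prod card_bool cK.
exists c; first by apply: inj_card_bij; rewrite // cc.
rewrite /im2 /std -imset_comp -fE; apply/setP => e.
by apply/imsetP/imsetP => -[k _ ->]; exists k; rewrite //= cf.
Qed.

Lemma perfect_matching_transport (V W : finType) (I : {set {set V}}) (J : {set {set W}}) :
  I \subset complete V -> partition I [set: V] ->
  J \subset complete W -> partition J [set: W] -> #|V| = #|W| ->
  exists2 b : V -> W, bijective b & im2 b I = J.
Proof.
move=> IK pI JK pJ VW.
have cIJ : #|I| = #|J|.
  by have := VW; rewrite (card_perfect_matching IK pI) (card_perfect_matching JK pJ); lia.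
have [|c cB cE] := perfect_matching_std (K := 'I_#|I|) IK pI; first by rewrite card_ord.
have [|d dB dE] := perfect_matching_std (K := 'I_#|I|) JK pJ; first by rewrite card_ord.
have [c' cc' c'c] := cB; exists (d \o c'); first by apply: bij_comp => //; exists c.
rewrite -dE; transitivity (im2 (d \o c') (im2 c (std 'I_#|I|))); first by rewrite cE.
rewrite /im2 -imset_comp; apply: eq_imset => e /=.
by rewrite -imset_comp; apply: eq_imset => x /=; rewrite cc'.
Qed.

Lemma msign_Ssum_const (V W : finType) (kap : V -> nat) (kap' : W -> nat)
   (I : {set {set V}}) (J : {set {set W}}) :
  injective kap -> injective kap' ->
  I \subset complete V -> partition I [set: V] ->
  J \subset complete W -> partition J [set: W] -> #|V| = #|W| -> (0 < #|V|)%N ->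
  msign kap' J * Ssum kap' (complete W :\: J) = msign kap I * Ssum kap (complete V :\: I).
Proof.
move=> kI kI' IK pI JK pJ VW V0.
have [b bB <-] := perfect_matching_transport IK pI JK pJ VW.
exact: msign_Ssum_relabel.
Qed.

End StandardMatching.

Lemma one_factorizationD1 (V : finType) (E M : {set {set V}}) F :
  one_factorization E F -> M \in F -> one_factorization (E :\: M) (F :\ M).
Proof.
move=> /one_factorizationP[pF pM] MF; apply/one_factorizationP; split.
  exact: partitionD1.
by move=> M' /setD1P[_ /pM].
Qed.

Lemma one_factorizationU1 (V : finType) (E M : {set {set V}}) F : (0 < #|V|)%N ->
  M \subset E -> partition M [set: V] -> one_factorization (E :\: M) F ->
  M \notin F /\ one_factorization E (M |: F).
Proof.
move=> V0 ME pM /one_factorizationP[pF pMF]; have [v _] := card_gt0P V0.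
have eM : pblock M v \in M.
  by apply: pblock_mem; case/and3P: pM => /eqP -> _ _; rewrite inE.
have MF : M \notin F.
  apply/negP => MF; case/and3P: pF => /eqP covF _ _.
  have : pblock M v \in E :\: M by rewrite -covF; apply/bigcupP; exists M.
  by rewrite inE eM.
split=> //; apply/one_factorizationP; split; last first.
  by move=> M' /setU1P[->|/pMF].
have -> : E = M :|: (E :\: M).
  by apply/setP=> e; rewrite !inE; case: (boolP (e \in M)) => // /(subsetP ME) ->.
apply: partitionU1 => //; first by apply/set0Pn; exists (pblock M v).
by rewrite disjoint_sym disjoints_subset; apply/subsetP => e; rewrite !inE => /andP[].
Qed.

(** Double counting of the pairs formed by a factorization and one of its [#|V|.-1] matchings;
    deleting the matching leaves a factorization of the remaining edges. *)
Lemma Ssum_complete_expand (V : finType) (kap : V -> nat) : (0 < #|V|)%N ->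
  #|V|.-1%:R * Ssum kap (complete V) =
  \sum_(M | perfect_matching (complete V) M) msign kap M * Ssum kap (complete V :\: M).
Proof.
move=> V0; have [v _] := card_gt0P V0.
rewrite mulr_sumr.
transitivity (\sum_(F | one_factorization (complete V) F) \sum_(M in F) fsign kap F).
  apply: eq_bigr => F Ff; rewrite sumr_const.
  by rewrite (card_factorization v (@regular_complete V) Ff) mulr_natl.
rewrite (exchange_big_dep (perfect_matching (complete V))) /=; last first.
  by move=> F M /andP[_ /forall_inP]; apply.
apply: eq_bigr => M /andP[MK pM]; rewrite mulr_sumr.
rewrite (reindex_onto (fun F => M |: F) (fun F => F :\ M)) /=; last first.
  by move=> F /andP[_ MF]; rewrite setD1K.
apply: eq_big => [F|F /andP[_ /eqP MF]].
  rewrite setU11 andbT; apply/andP/idP => [[/one_factorizationD1/(_ (setU11 _ _))]|Ff].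
    by move=> + /eqP E; rewrite E.
  have [MF ->] := one_factorizationU1 V0 MK pM Ff.
  by rewrite setU1K.
by rewrite /fsign big_setU1 // -MF setD11.
Qed.

Lemma Ssum_complete_neq0 (V : finType) (kap : V -> nat) (I : {set {set V}}) :
  injective kap -> (1 < #|V|)%N -> I \subset complete V -> partition I [set: V] ->
  Ssum kap (complete V) != 0 -> Ssum kap (complete V :\: I) != 0.
Proof.
move=> kI V1 IK pI; have V0 := ltnW V1; apply: contraNneq => S0.
have : #|V|.-1%:R * Ssum kap (complete V) = 0.
  rewrite Ssum_complete_expand // big1 // => M /andP[MK pM].
  by rewrite (@msign_Ssum_const _ _ kap kap I) // S0 mulr0.
by move/eqP; rewrite mulf_eq0 Num.Theory.pnatr_eq0 -[_ == 0%N]negbK -lt0n ltn_predRL V1 /=.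
Qed.

Lemma signed_factorizationsE n (E : {set {set 'I_n}}) : E \subset complete 'I_n ->
  signed_factorizations E = Ssum (@nat_of_ord n) E.
Proof.
move=> EK; apply: eq_bigr => F /one_factorizationP[pF pM]; apply: eq_bigr => M MF.
apply: matching_sign_msign; rewrite perfect_matchingE pM // andbT.
by apply: subset_trans EK; case/and3P: pF => /eqP <- _ _; apply: bigcup_sup.
Qed.

(** * The edge painting game *)

Section Game.
Variable T : finType.
Implicit Types (U A B E : {set {set T}}) (t : {ffun {set T} -> nat}).

Lemma proper_edge_coloring_extend U B (k : nat) (c : {set T} -> nat) :
  trivIset B -> proper_edge_coloring (U :\: B) c ->
  {in U :\: B, forall e : {set T}, c e != k} ->
  proper_edge_coloring U (fun e => if e \in B then k else c e).
Proof.
move=> /trivIsetP tB pc ck e f eU fU ef nd.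
case: (boolP (e \in B)) (boolP (f \in B)) => [eB|eB] [fB|fB].
- by rewrite (tB _ _ eB fB ef) in nd.
- by rewrite eq_sym ck // inE fB.
- by rewrite ck // inE eB.
- by apply: pc; rewrite ?inE ?eB ?fB.
Qed.

(** Lister marks all uncoloured edges whose list contains a chosen colour [k], and the edges that
    Painter selects receive [k]. Dropping [k] from the lists keeps list sizes equal to token counts.
    The recursion is on the derivation itself, to reach the [painter_wins] nested under the
    existential. *)
Fixpoint painter_wins_lists U t (win : painter_wins U t) {struct win} :
  forall L : {set T} -> {fset nat}, (forall e, e \in U -> #|` L e| = t e) ->
  exists c : {set T} -> nat, (forall e, e \in U -> c e \in L e) /\ proper_edge_coloring U c.
Proof.
case: win => tpos step L LU.
case: (set_0Vmem U) => [U0|[e0 e0U]].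
  by exists (fun=> 0%N); split=> [e|e f]; rewrite U0 inE.
have [k kL] : exists k, k \in L e0.
  by apply/fset0Pn; rewrite -cardfs_gt0 LU // tpos.
pose A := [set e in U | k \in L e].
have AU : A \subset U by apply/subsetP => e; rewrite inE => /andP[].
have A0 : A != set0 by apply/set0Pn; exists e0; rewrite inE e0U.
case: (step A AU A0) => B [BA tB winB].
have [|c [cL pc]] := painter_wins_lists _ _ winB (fun e => L e `\ k)%fset.
  move=> e /setDP[eU _]; rewrite ffunE -(LU _ eU) [in RHS](cardfsD1 k).
  by rewrite inE eU /= addnC addnK.
exists (fun e => if e \in B then k else c e); split=> [e eU|].
  case: (boolP (e \in B)) => eB.
    by have := subsetP BA _ eB; rewrite inE => /andP[].
  by have := cL e; rewrite !inE eB eU => /(_ isT)/andP[].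
apply: proper_edge_coloring_extend => // e eUB.
by have := cL e eUB; rewrite !inE => /andP[].
Qed.

Lemma paintable_choosable E k : edge_paintable E k -> edge_choosable E k.
Proof.
by move=> win L LE; apply: (painter_wins_lists win) => e eE; rewrite LE // ffunE.
Qed.

(** With the same list [0, ..., k - 1] everywhere, the edges at [v] need distinct members of it. *)
Lemma choosable_degree E (v : T) k : edge_choosable E k ->
  (#|[set e in E | v \in e]| <= k)%N.
Proof.
move=> /(_ (fun=> [fset i in iota 0 k]%fset))[|c [cL pc]].
  by move=> e _; rewrite card_fseq undup_id ?iota_uniq // size_iota.
set A := [set e in E | v \in e].
have cI : {in enum A &, injective c}.
  move=> e f; rewrite !mem_enum !inE => /andP[eE ve] /andP[fE vf] /eqP cef.
  apply/eqP/negPn/negP => ef.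
  have nd : ~~ [disjoint e & f] by apply/pred0Pn; exists v; rewrite /= ve vf.
  by have := pc e f eE fE ef nd; rewrite cef.
rewrite cardE -(size_map c) -[leqRHS](size_iota 0); apply: uniq_leq_size.
  by rewrite map_inj_in_uniq ?enum_uniq.
move=> i /mapP[e]; rewrite mem_enum inE => /andP[eE _] ->.
by have := cL e eE; rewrite inE.
Qed.

Variable K : idomainType.
Local Notation N := #|{set T}|.
Local Notation var e := ('X_(enum_rank e) : {mpoly K[N]}).

(** There is a variable for every set of vertices, edge or not, so that the polynomial ring stays
    fixed while [U] shrinks during a play. *)
Definition linepoly U : {mpoly K[N]} :=
  \prod_(u : {set T} * {set T} |
     [&& u.1 \in U, u.2 \in U & rk u.1 u.2] && ~~ [disjoint u.1 & u.2])
   (var u.1 - var u.2).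

Definition lpairs U := [set u : {set T} * {set T} |
  [&& u.1 \in U, u.2 \in U & rk u.1 u.2] && ~~ [disjoint u.1 & u.2]].

Lemma linepoly_dhomog U : linepoly U \is #|lpairs U|.-homog for mdeg.
Proof.
rewrite /linepoly (eq_bigl (fun u => u \in lpairs U)); last by move=> u; rewrite inE.
have -> : #|lpairs U| = (\sum_(u in lpairs U) 1)%N by rewrite sum1_card.
apply: (big_ind2 (fun (p : {mpoly K[N]}) (k : nat) => p \is k.-homog for mdeg)).
- exact: dhomog1.
- by move=> p k q l; exact: dhomogM.
- by move=> u _; apply: rpredB; rewrite dhomogX /= mdeg1.
Qed.

Section Functional.
Variables (n : nat) (w : 'X_{1..n} -> K).

(** The linear functional with value [w m] at the monomial [m]. The bound [k] makes the monomials a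
    finite type, so that linearity is an exchange of finite sums. *)
Definition lam k (p : {mpoly K[n]}) := \sum_(m : 'X_{1..n < k}) p@_m * w m.

Lemma lam_supp k p : (msize p <= k)%N -> lam k p = \sum_(m <- msupp p) p@_m * w m.
Proof.
move=> pk; pose I : subFinType _ := 'X_{1..n < k}.
rewrite [RHS](big_mksub I) //=; first last.
  by move=> x /msize_mdeg_lt /leq_trans; apply.
  by rewrite msupp_uniq.
by rewrite big_rmcond //= => i /memN_msupp_eq0 ->; rewrite mul0r.
Qed.

Lemma lam_sum k (s : seq 'X_{1..n}) (c : 'X_{1..n} -> K) :
  {in s, forall m, (mdeg m < k)%N} ->
  lam k (\sum_(m <- s) c m *: 'X_[m]) = \sum_(m <- s) c m * w m.
Proof.
move=> sk; rewrite /lam.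
under eq_bigr do rewrite raddf_sum /= mulr_suml.
rewrite exchange_big /= big_seq [RHS]big_seq; apply: eq_bigr => m ms.
rewrite (bigD1 (BMultinom (sk m ms))) //= mcoeffZ mcoeffX eqxx mulr1 big1 ?addr0 //.
move=> m' ne; rewrite mcoeffZ mcoeffX (_ : (m == m') = false) ?mulr0 ?mul0r //.
by apply/negbTE; apply: contra ne => /eqP E; apply/eqP/val_inj; rewrite /= E.
Qed.

(** If the weights ignore the exponents of both variables, the functional takes the same value at
    ['X_i * p], ['X_j * p] and [p], so it kills multiples of the difference of the variables. *)
Lemma lam_shift (i j : 'I_n) (p : {mpoly K[n]}) :
  (forall m, w (U_(i) + m)%MM = w m) -> (forall m, w (U_(j) + m)%MM = w m) ->
  \sum_(m <- msupp (('X_i - 'X_j) * p)) (('X_i - 'X_j) * p)@_m * w m = 0.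
Proof.
move=> wi wj; pose q := ('X_i - 'X_j) * p.
pose k := maxn (msize q) (msize p).+1.
rewrite -(@lam_supp k) ?leq_maxl //.
have E l : 'X_l * p = \sum_(m <- [seq (U_(l) + m)%MM | m <- msupp p])
     p@_(m - U_(l))%MM *: 'X_[m].
  rewrite big_map {1}[p]mpolyE mulr_sumr; apply: eq_bigr => m _.
  by rewrite addmC addmK -scalerAr mpolyXD mulrC.
have small l : {in [seq (U_(l) + m)%MM | m <- msupp p], forall m, (mdeg m < k)%N}.
  move=> _ /mapP[m mp ->]; rewrite mdegD mdeg1 add1n leq_max ltnS.
  by rewrite msize_mdeg_lt ?orbT.
have lamE l : (forall m, w (U_(l) + m)%MM = w m) ->
    lam k ('X_l * p) = \sum_(m <- msupp p) p@_m * w m.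
  move=> wl; rewrite E lam_sum // big_map; apply: eq_bigr => m _.
  by rewrite wl addmC addmK.
have -> : lam k (('X_i - 'X_j) * p) = lam k ('X_i * p) - lam k ('X_j * p).
  rewrite /lam -sumrB; apply: eq_bigr => m _.
  by rewrite mulrBl mcoeffB mulrBl.
by rewrite !lamE // subrr.
Qed.

End Functional.

(** Painter's invariant. The inequality is strict, so every uncoloured edge still owns a token and
    the position is not lost. *)
Definition good U t :=
  exists2 m, m \in msupp (linepoly U) & forall e, e \in U -> (m (enum_rank e) < t e)%N.

(* The coefficient of [m] is [\sum_m' p@_m' * \prod_e c e m'], where [c e m']
   tests [m e <= m' e] for [e] in [A] and [m e = m' e] otherwise: by homogeneity
   only [m' = m] passes. Expanding each [m e <= m' e] as [1 - (m' e < m e)]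
   gives one term for every [B] inside [A]. If [B] contains two adjacent edges
   this term vanishes, as its weights ignore the exponents on [B]; otherwise
   Painter can colour a [B] whose term is nonzero. *)
Lemma good_step U t A : A \subset U -> good U t ->
  exists B : {set {set T}},
    [/\ B \subset A, trivIset B & good (U :\: B) (remove_tokens A t)].
Proof.
move=> AU [m mU mt].
pose lt (m' : 'X_{1..N}) e := (m' (enum_rank e) < m (enum_rank e))%N.
pose eqm (m' : 'X_{1..N}) e := (m' (enum_rank e) == m (enum_rank e)).
pose u e : K := (e \in A)%:R.
pose v (m' : 'X_{1..N}) e : K := if e \in A then - (lt m' e)%:R else (eqm m' e)%:R.
pose w (C : {set {set T}}) m' := \prod_e (if e \in C then u e else v m' e).
have homU : {in msupp (linepoly U), forall m', mdeg m' = mdeg m}.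
  have /dhomogP h := linepoly_dhomog U.
  by move=> m' /h ->; rewrite (h _ mU).
have coefE : (linepoly U)@_m =
    \sum_(C : {set {set T}}) \sum_(m' <- msupp (linepoly U)) (linepoly U)@_m' * w C m'.
  rewrite exchange_big /= (bigD1_seq m) ?msupp_uniq //= -mulr_sumr -bigA_distr.
  rewrite big1 ?mulr1 => [|e _]; last first.
    by rewrite /u /v /lt /eqm ltnn eqxx /=; case: (e \in A); rewrite ?mulr0n ?mulr1n ?oppr0 ?addr0 ?add0r.
  rewrite big_seq_cond big1 ?addr0 // => m' /andP[m'U ne].
  rewrite -mulr_sumr -bigA_distr.
  suff [e E] : exists e, u e + v m' e = 0.
    by rewrite (bigD1 e) //= E mul0r mulr0.
  case: (pickP (fun e => lt m' e)) => [e e1|nlt].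
    by exists e; rewrite /u /v /eqm e1 /=; case: (e \in A); rewrite ?subrr // ltn_eqF // ?mulr0n add0r.
  case: (pickP (fun e => (e \notin A) && ~~ eqm m' e)) => [e /andP[/negPf e1 /negPf e2]|neq].
    by exists e; rewrite /u /v e1 e2 addr0.
  case/eqP: ne; apply/mnmP => i.
  have le j : (m j <= m' j)%N by rewrite leqNgt -(enum_valK j); apply/negP; rewrite [X in is_true X](nlt _).
  have [_] := leqif_sum (P := xpredT) (fun j _ => leqif_eq (le j)).
  rewrite -!mdegE (homU _ m'U) eqxx => /esym/forall_inP/(_ i isT)/eqP.
  by [].
have [C CN0] : exists C : {set {set T}},
    \sum_(m' <- msupp (linepoly U)) (linepoly U)@_m' * w C m' != 0.
  apply/existsP; rewrite -[[exists _, _]]negbK negb_exists; apply/negP => /forallP h.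
  move: mU; rewrite mcoeff_msupp coefE big1 ?eqxx // => C _.
  by apply/eqP; rewrite -[_ == 0]negbK.
have CA : C \subset A.
  apply/subsetP => e eC; apply: contraNT CN0 => eA.
  rewrite big1 // => m' _; rewrite /w (bigD1 e) //= eC /u (negPf eA).
  by rewrite mul0r mulr0.
exists C; split=> //.
  apply/trivIsetP => e f eC fC ef; apply: contraNT CN0 => nd.
  have CU := subset_trans CA AU.
  wlog rr : e f eC fC ef nd / rk e f.
    move=> H; case: (boolP (rk e f)) => rr; first exact: (H e f).
    apply: (H f e) => //; rewrite 1?eq_sym 1?disjoint_sym //.
    by rewrite (@rk_tournament _ setT) ?inE // rr eq_sym ef.
  rewrite /linepoly (bigD1 (e, f)) /=; last first.
    by rewrite !(subsetP CU) // rr.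
  rewrite lam_shift // => m'; apply: eq_bigr => g _.
    case: ifPn => // gC; rewrite /v /lt /eqm !mnmDE mnm1E.
    by rewrite (inj_eq enum_rank_inj) (_ : (e == g) = false) //; apply: contraNF gC => /eqP <-.
  case: ifPn => // gC; rewrite /v /lt /eqm !mnmDE mnm1E.
  by rewrite (inj_eq enum_rank_inj) (_ : (f == g) = false) //; apply: contraNF gC => /eqP <-.
have [m' m'U wm'] : exists2 m', m' \in msupp (linepoly U) & w C m' != 0.
  apply/hasP; apply: contraNT CN0 => /hasPn h.
  by rewrite big_seq big1 // => m' /h /negPn/eqP ->; rewrite mulr0.
have wv e : e \notin C -> v m' e != 0.
  move=> eC; apply: contraNneq wm' => v0; rewrite /w (bigD1 e) //= (negPf eC) v0.
  by rewrite mul0r.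
(* Removing the edges of [C] only removes factors, so [m'] is a monomial [m1] of the smaller
   polynomial times another one, and the exponents of [m1] are at most those of [m']. *)
have [q UE] : exists q, linepoly U = linepoly (U :\: C) * q.
  rewrite /linepoly.
  rewrite (bigID (fun u : {set T} * {set T} => (u.1 \notin C) && (u.2 \notin C))) /=.
  eexists; congr (_ * _); apply: eq_bigl => -[e f] /=; rewrite !inE.
  by case: (e \in C); case: (f \in C); rewrite ?andbF ?andbT.
have /allpairsP[[m1 m2] /= [m1U _ m12]] : m' \in [seq (m1 + m2)%MM |
    m1 <- msupp (linepoly (U :\: C)), m2 <- msupp q].
  by apply: msuppM_le; rewrite -UE.
exists m1 => // e; rewrite inE => /andP[eC eU]; rewrite ffunE.
have m1m' : (m1 (enum_rank e) <= m' (enum_rank e))%N by rewrite m12 mnmDE leq_addr.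
(* On [A] a nonzero weight means that [m'] has a strictly smaller exponent than [m], which pays for
   the token lost; off [A] the exponents agree and no token is lost. *)
have := wv e eC; rewrite /v; case: ifP => eA.
  rewrite oppr_eq0 /lt; case: ltnP => h; last by rewrite mulr0n eqxx.
  move=> _;  rewrite subn1 ltn_predRL; apply: leq_ltn_trans (mt e eU).
  exact: leq_ltn_trans h.
rewrite /eqm; case: (m' _ =P m _) => h; last by rewrite mulr0n eqxx.
by move=> _; rewrite subn0; apply: leq_ltn_trans (mt e eU); rewrite -h.
Qed.

(** Induction on the total number of tokens on uncoloured edges: a marked edge either loses a token
    or is coloured and leaves with at least one. *)
Lemma good_painter_wins U t : good U t -> painter_wins U t.
Proof.
move: {2}(\sum_(e in U) t e)%N (leqnn (\sum_(e in U) t e)%N) => s.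
elim: s U t => [|s IH] U t ts gU.
  have t0 e : e \in U -> (0 < t e)%N.
    by case: gU => m _ mt /mt; apply: leq_ltn_trans.
  constructor=> // A AU A0; exfalso; case/set0Pn: A0 => e /(subsetP AU) eU.
  have := t0 e eU; move: ts; rewrite (bigD1 e) //=.
  by rewrite leqn0 addn_eq0 => /andP[/eqP ->].
have t0 e : e \in U -> (0 < t e)%N.
  by case: gU => m _ mt /mt; apply: leq_ltn_trans.
constructor=> // A AU A0.
have [B [BA tB gB]] := good_step AU gU.
exists B; split=> //; apply: IH gB; rewrite -ltnS; apply: leq_trans ts.
have [e0 e0A] := set0Pn _ A0.
have e0U := subsetP AU _ e0A.
rewrite [X in (_ < X)%N](big_setID B) /= (setIidPr (subset_trans BA AU)).
have rt e : (remove_tokens A t e <= t e)%N by rewrite ffunE leq_subr.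
case: (boolP (e0 \in B)) => e0B.
  rewrite -[X in (X < _)%N]add0n -addSn leq_add ?leq_sum //.
  by rewrite (bigD1 e0) //= ltn_addr ?t0.
apply: leq_trans (leq_addl _ _); have e0UB : e0 \in U :\: B by rewrite inE e0B.
rewrite (bigD1 e0) //= [X in (_ < X)%N](bigD1 e0) //= -addSn leq_add ?leq_sum //.
by rewrite ffunE e0A subn1 prednK ?t0.
Qed.

End Game.

(** * Signed edge colourings *)

Definition edges_at (V : finType) (E : {set {set V}}) (v : V) := [set e in E | v \in e].

Lemma meet2 (V : finType) (e f : {set V}) : #|e| = 2 -> #|f| = 2 -> e != f ->
  ~~ [disjoint e & f] -> exists v, e :&: f = [set v].
Proof.
move=> e2 f2 ef; rewrite -setI_eq0 => /set0Pn[v vI]; exists v; apply/esym/eqP.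
have : (#|e :&: f| < #|e|)%N.
  rewrite proper_card // properEneq subsetIl andbT; apply: contra ef => /eqP E.
  by rewrite eqEcard e2 f2 leqnn andbT -E subsetIr.
by rewrite e2 ltnS eqEcard sub1set vI cards1.
Qed.

(** Distinct edges that meet share exactly one vertex, so adjacent pairs are sorted by that vertex
    without repetition. The operation is arbitrary because this serves both the factors of the
    polynomial and its degree. *)
Lemma big_adjacent (V : finType) (R : Type) (idx : R) (op : Monoid.com_law idx)
    (E : {set {set V}}) (F : {set V} * {set V} -> R) : E \subset complete V ->
  \big[op/idx]_(u | [&& u.1 \in E, u.2 \in E & rk u.1 u.2] && ~~ [disjoint u.1 & u.2]) F u =
  \big[op/idx]_v \big[op/idx]_(u : {set V} * {set V} |
      [&& u.1 \in edges_at E v, u.2 \in edges_at E v & rk u.1 u.2]) F u.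
Proof.
move=> EK.
rewrite [RHS](exchange_big_dep
  (fun u : {set V} * {set V} => [&& u.1 \in E, u.2 \in E & rk u.1 u.2])) /=; last first.
  by move=> v u _ /and3P[]; rewrite !inE => /andP[-> _] /andP[-> _] ->.
rewrite [RHS](@bigID _ _ _ _ _ (fun u : {set V} * {set V} => [disjoint u.1 & u.2])) /= [X in op X _]big1 ?Monoid.mul1m.
  apply: eq_bigr => -[e f] /= /andP[/and3P[eE fE rr] nd].
  have := subsetP EK _ eE; have := subsetP EK _ fE; rewrite !inE => /eqP f2 /eqP e2.
  have ef : e != f by move: rr; rewrite (@rk_tournament _ setT) ?inE // => /andP[].
  have [v ev] := meet2 e2 f2 ef nd.
  rewrite (big_pred1 v) // => w; rewrite !inE eE fE rr andbT /=.
  by rewrite -in_setI ev inE.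
move=> [e f] /= /andP[/and3P[eE fE rr] dis]; rewrite big_pred0 // => w.
rewrite !inE eE fE /= rr andbT; apply/negP => /andP[we wf].
by move: (disjointFl dis wf); rewrite we.
Qed.

Lemma pp_sub (R : comNzRingType) (X : finType) (D D' : {set X}) (f : X -> X -> R) :
  D \subset D' ->
  (forall x y, x != y -> (x \notin D) || (y \notin D) -> f x y = 1) -> pp D' f = pp D f.
Proof.
move=> DD' f1; rewrite /pairprod [LHS](bigID (fun u => (u.1 \in D) && (u.2 \in D))) /=.
rewrite [X in _ * X]big1 ?mulr1.
  apply: eq_bigl => -[x y] /=; case: (boolP (x \in D)) => xD; rewrite ?andbF //.
  case: (boolP (y \in D)) => yD; rewrite ?andbF //= andbT.
  by rewrite !(subsetP DD').
move=> [x y] /= /andP[/and3P[_ _ rr]]; rewrite negb_and; apply: f1.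
by move: rr; rewrite (@rk_tournament _ setT) ?inE // => /andP[].
Qed.

(** [sg1] and [sg2] are the order signs of the two lexicographic orders on [V * Y], led by the first
    and by the second coordinate respectively. *)
Definition sg1 (V Y : finType) (kap : V -> nat) (mu : Y -> nat) (x y : V * Y) : int :=
  if x.1 == y.1 then sg mu x.2 y.2 else sg kap x.1 y.1.
Definition sg2 (V Y : finType) (kap : V -> nat) (mu : Y -> nat) (x y : V * Y) : int :=
  if x.2 == y.2 then sg kap x.1 y.1 else sg mu x.2 y.2.

Section Lex.
Variables (V Y : finType) (kap : V -> nat) (mu : Y -> nat).
Hypotheses (kI : injective kap) (mI : injective mu).
Implicit Types x y : V * Y.

Lemma sg1_sqr x y : sg1 kap mu x y * sg1 kap mu x y = 1.
Proof. by rewrite /sg1; case: ifP => _; rewrite sg_sqr. Qed.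
Lemma sg2_sqr x y : sg2 kap mu x y * sg2 kap mu x y = 1.
Proof. by rewrite /sg2; case: ifP => _; rewrite sg_sqr. Qed.

Lemma sg1N x y : x != y -> sg1 kap mu y x = - sg1 kap mu x y.
Proof.
case: x y => [a b] [c d]; rewrite xpair_eqE /sg1 /= [c == a]eq_sym.
by case: eqP => [_ /= h|/eqP h _]; rewrite sgN.
Qed.
Lemma sg2N x y : x != y -> sg2 kap mu y x = - sg2 kap mu x y.
Proof.
case: x y => [a b] [c d]; rewrite xpair_eqE /sg2 /= [d == b]eq_sym.
by case: (b =P d) => [_ /=|/eqP h _]; rewrite ?andbT => *; rewrite sgN.
Qed.

End Lex.

Definition ekey (V : finType) (e : {set V}) : nat := enum_rank e.
Lemma ekey_inj (V : finType) : injective (@ekey V).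
Proof. by move=> e f /ord_inj /enum_rank_inj. Qed.

Section Colorings.
Variables (V : finType) (kap : V -> nat) (E : {set {set V}}) (d : nat).
Hypotheses (kI : injective kap) (EK : E \subset complete V) (regE : regular E d).
Implicit Types (z : {set V} -> 'I_d).

Definition properb z := [forall e in E, forall f in E,
  (e != f) && ~~ [disjoint e & f] ==> (z e != z f)].

Lemma properbP z : reflect {in E &, forall e f : {set V}, e != f -> ~~ [disjoint e & f] ->
   z e != z f} (properb z).
Proof.
apply: (iffP forall_inP) => [h e f eE fE ef nd|h e eE].
  by have /forall_inP/(_ f fE) := h e eE; rewrite ef nd.
by apply/forall_inP => f fE; apply/implyP => /andP[]; apply: h.
Qed.

Definition cclass z (c : 'I_d) := [set e in E | z e == c].

(** At each vertex a proper colouring is a bijection from the incident edges to the [d] colours;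
    these are the inversion signs that the polynomial sees. *)
Definition vsign z : int :=
  \prod_v pp (edges_at E v) (fun e f => sg (@ekey V) e f * sg (@nat_of_ord d) (z e) (z f)).

Lemma proper_at z v : properb z -> {in edges_at E v &, injective z}.
Proof.
move=> /properbP pz e f; rewrite !inE => /andP[eE ve] /andP[fE vf] zef.
apply/eqP; apply: contraT => ef.
have nd : ~~ [disjoint e & f] by apply/pred0Pn; exists v; rewrite /= ve vf.
by have := pz e f eE fE ef nd; rewrite zef eqxx.
Qed.

Lemma proper_at_im z v : properb z -> z @: edges_at E v = [set: 'I_d].
Proof.
move=> pz; apply/eqP; rewrite eqEcard subsetT cardsT card_ord.
by rewrite (card_in_imset (@proper_at z v pz)) (regE v) leqnn.
Qed.

Lemma cclass_partition z c : properb z -> partition (cclass z c) [set: V].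
Proof.
move=> pz; apply/and3P; split.
- apply/eqP/setP => v; rewrite inE; have : c \in z @: edges_at E v by rewrite proper_at_im // in_setT.
  case/imsetP => e; rewrite inE => /andP[eE ve] ->.
  by apply/bigcupP; exists e => //; rewrite inE eE /=.
- apply/trivIsetP => e f; rewrite !inE => /andP[eE /eqP ze] /andP[fE /eqP zf] ef.
  by apply: contraT => nd; have /properbP/(_ e f eE fE ef nd) := pz; rewrite ze zf eqxx.
by rewrite inE; apply/negP => /andP[/(subsetP EK)]; rewrite inE cards0.
Qed.

(** A dart is an edge together with one of its ends. For a proper colouring of a [d]-regular graph,
    [dmap] is a bijection from the darts onto [V * 'I_d]. *)
Definition darts := [set x : V * {set V} | (x.2 \in E) && (x.1 \in x.2)].
Definition dmap z (x : V * {set V}) : V * 'I_d := (x.1, z x.2).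

Lemma dmap_inj z : properb z -> {in darts &, injective (dmap z)}.
Proof.
move=> pz [v e] [w f]; rewrite !inE /= => /andP[eE ve] /andP[fE wf] [vw zef].
by rewrite -vw (@proper_at z v pz e f) // !inE ?eE ?fE // vw.
Qed.

Lemma card_darts : #|darts| = (#|V| * d)%N.
Proof.
rewrite -sum1dep_card /=.
rewrite (eq_bigl (fun x : V * {set V} => xpredT x.1 && (x.2 \in edges_at E x.1))); last first.
  by move=> x; rewrite /= inE.
rewrite -(pair_big_dep xpredT (fun v e => e \in edges_at E v) (fun _ _ => 1%N)) /=.
under eq_bigr => v _ do rewrite sum1_card (regE v).
by rewrite sum_nat_const.
Qed.

Lemma dmap_im z : properb z -> dmap z @: darts = [set: V * 'I_d].
Proof.
move=> pz; apply/eqP; rewrite eqEcard subsetT cardsT card_prod card_ord.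
by rewrite (card_in_imset (dmap_inj pz)) card_darts leqnn.
Qed.

(** Group the darts by their vertex: two darts at different vertices are ordered by these vertices
    before and after [dmap], so such pairs cancel. *)
Lemma vsign_dart z : properb z -> vsign z =
  pp darts (fun x y => sg1 kap (@ekey V) x y *
                       sg1 kap (@nat_of_ord d) (dmap z x) (dmap z y)).
Proof.
move=> pz; rewrite (pp_fib fst) /=; last first.
  move=> x y xD yD; case: (eqVneq x y) => [->//|xy].
  rewrite (sg1N kI (@ekey_inj V)) 1?eq_sym // (sg1N kI val_inj) ?mulrNN //.
  by rewrite (inj_in_eq (dmap_inj pz)) // eq_sym.
rewrite [X in _ * X]pairprod1 ?mulr1; first last.
- move=> v w _ _ vw; rewrite big1 // => x /andP[_ /eqP xv]; rewrite big1 // => y /andP[_ /eqP yw].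
  by rewrite /sg1 /= xv yw (negPf vw) sg_sqr.
- exact: rk_tournament.
rewrite /vsign; apply: eq_bigr => v _.
have -> : [set x in darts | x.1 == v] = (fun e => (v, e)) @: edges_at E v.
  apply/setP=> -[w e]; rewrite !inE /=; apply/andP/imsetP => [[/andP[eE we] /eqP wv]|].
    by exists e; rewrite ?wv // inE eE -wv.
  by case=> f; rewrite inE => /andP[fE vf] [-> ->]; rewrite fE vf.
rewrite pp_imset.
- by apply: eq_pairprod => [|e f _ _ _]; [exact: rk_tournament | rewrite /sg1 /= eqxx].
- by move=> e f _ _ [].
move=> e f eE fE; case: (eqVneq e f) => [->//|ef]; rewrite /sg1 /= eqxx.
rewrite (sgN (@ekey_inj V)) 1?eq_sym // (sgN val_inj) ?mulrNN //.
by rewrite (inj_in_eq (@proper_at z v pz)) // eq_sym.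
Qed.

(** Group the darts by their edge. Between two edges the edge sign, and the colour sign if the
    colours differ, occurs for all four pairs of ends and cancels; for edges of equal colour the
    vertex signs remain, and they form [chi]. *)
Lemma msign_dart z : properb z -> \prod_c msign kap (cclass z c) =
  pp darts (fun x y => sg2 kap (@ekey V) x y *
                       sg2 kap (@nat_of_ord d) (dmap z x) (dmap z y)).
Proof.
move=> pz; rewrite [RHS](pp_fib snd) /=; last first.
  move=> x y xD yD; case: (eqVneq x y) => [->//|xy].
  rewrite (sg2N kI (@ekey_inj V)) 1?eq_sym // (sg2N kI val_inj) ?mulrNN //.
  by rewrite (inj_in_eq (dmap_inj pz)) // eq_sym.
rewrite [X in _ = X * _]big1 ?mul1r; last first.
  move=> e _; apply: pairprod1; first exact: rk_tournament.
  move=> x y; rewrite !inE => /andP[_ /eqP xe] /andP[_ /eqP ye] _.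
  by rewrite /sg2 /= xe ye !eqxx sg_sqr.
have fibE (e : {set V}) (G : V * {set V} -> int) : e \in E ->
    \prod_(x in darts | x.2 == e) G x = \prod_(v in e) G (v, e).
  move=> eE; transitivity (\prod_(x in [set (v, e) | v in e]) G x).
    2: by rewrite big_imset // => v w _ _ [].
  apply: eq_bigl => -[v f]; rewrite !inE /=; apply/andP/imsetP => [[/andP[fE vf] /eqP fe]|].
    by exists v; rewrite -fe.
  by case=> w we [-> ->]; rewrite eE we.
have fib0 (e : {set V}) (G : V * {set V} -> int) : e \notin E ->
    \prod_(x in darts | x.2 == e) G x = 1.
  move=> eE; rewrite big_pred0 // => -[v f]; rewrite inE /=.
  by apply: contraNF eE => /andP[/andP[fE _] /eqP <-].
rewrite (@pp_sub _ _ E) ?subsetT //; last first.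
  move=> e f _ /orP[] h; first by rewrite fib0.
  by rewrite big1 // => x _; rewrite fib0.
transitivity (pp E (fun e f => if z e == z f then chi kap e f else 1)).
  have cc e f : e \in E -> f \in E -> z e = z f -> chi kap e f = chi kap f e.
    move=> eE fE zef; case: (eqVneq e f) => [->//|ef]; apply: chiC => //.
      apply: contraT => nd; have /properbP/(_ e f eE fE ef nd) := pz.
      by rewrite zef eqxx.
    have := subsetP EK _ eE; rewrite inE => /eqP ->.
    by rewrite oddM.
  rewrite (pp_fib z); last first.
    by move=> e f eE fE; rewrite [z f == _]eq_sym; case: eqP => // zef; apply: cc.
  rewrite [X in _ = _ * X]pairprod1 ?mulr1; first last.
  - move=> c c' _ _ cc'; rewrite big1 // => e /andP[_ /eqP ec]; rewrite big1 // => f /andP[_ /eqP fc'].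
    by rewrite ec fc' (negPf cc').
  - exact: rk_tournament.
  apply: eq_bigr => c _; apply: eq_pairprod; first exact: rk_tournament.
  by move=> e f; rewrite !inE => /andP[_ /eqP ->] /andP[_ /eqP ->]; rewrite eqxx.
apply: eq_pairprod; first exact: rk_tournament.
move=> e f eE fE ef; rewrite fibE //; under eq_bigr => v _ do rewrite fibE //.
have := subsetP EK _ eE; have := subsetP EK _ fE; rewrite !inE => /eqP f2 /eqP e2.
have c4 (c : int) : c * c = 1 -> \prod_(v in e) \prod_(w in f) c = 1.
  move=> c1; under eq_bigr => v _ do rewrite prodr_const f2 expr2 c1.
  by rewrite big1.
rewrite /sg2 /= (negPf ef); under eq_bigr do rewrite big_split; rewrite big_split /=.
rewrite c4 ?sg_sqr // mul1r; case: ifP => // _.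
by rewrite c4 // sg_sqr.
Qed.

Definition dart_const : int :=
  pp darts (fun x y => sg1 kap (@ekey V) x y * sg2 kap (@ekey V) x y) *
  pp [set: V * 'I_d] (fun x y => sg1 kap (@nat_of_ord d) x y * sg2 kap (@nat_of_ord d) x y).

Lemma dart_const_sqr : dart_const * dart_const = 1.
Proof.
rewrite /dart_const mulrACA !pairprod_sqr1 ?mulr1 //; try exact: rk_tournament.
  by move=> x y _ _ _; rewrite mulrACA sg1_sqr sg2_sqr.
by move=> x y _ _ _; rewrite mulrACA sg1_sqr sg2_sqr.
Qed.

(* Both sides are inversion signs of the bijection [dmap z], for two pairs of
   orders on its source and target; changing these orders changes the sign by
   a factor independent of the bijection. *)
Lemma vsign_msign z : properb z ->
  vsign z = dart_const * \prod_c msign kap (cclass z c).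
Proof.
move=> pz; have sq : (\prod_c msign kap (cclass z c)) * (\prod_c msign kap (cclass z c)) = 1.
  by rewrite -big_split big1 // => c _; exact: msign_sqr.
set p := \prod_c _ in sq *; transitivity (vsign z * (p * p)); first by rewrite sq mulr1.
rewrite mulrA; congr (_ * _); rewrite /p.
rewrite vsign_dart // msign_dart // -pairprodM /dart_const -(dmap_im pz) pp_imset; first last.
- move=> x y xD yD; case: (eqVneq x y) => [->//|xy].
  have ne : dmap z y != dmap z x by rewrite (inj_in_eq (dmap_inj pz)) // eq_sym.
  by rewrite (sg1N kI val_inj ne) (sg2N kI val_inj ne) mulrNN.
- exact: dmap_inj.
rewrite -pairprodM; apply: eq_pairprod => [|x y _ _ _]; first exact: rk_tournament.
by rewrite mulrACA.
Qed.

End Colorings.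

Section SumColorings.
Variables (V : finType) (kap : V -> nat) (E : {set {set V}}) (d' : nat) (v0 : V).
Local Notation d := d'.+1.
Hypotheses (kI : injective kap) (EK : E \subset complete V) (regE : regular E d).
Implicit Types (z : {set V} -> 'I_d).

Definition classes_of z : {set {set {set V}}} := [set cclass E z c | c : 'I_d].

(** Colourings take the default colour off [E], so each proper colouring of [E] is counted once. *)
Definition colorings : {set {ffun {set V} -> 'I_d}} :=
  [set z | (z \in pffun_on ord0 (mem E) predT) && properb E z].

Lemma cclass_neq0 z c : properb E z -> exists e, e \in cclass E z c.
Proof.
move=> /(cclass_partition EK regE c)/and3P[/eqP cov _ _].
have : v0 \in cover (cclass E z c) by rewrite cov inE.
by case/bigcupP => e ec _; exists e.
Qed.

Lemma cclass_inj z : properb E z -> injective (cclass E z).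
Proof.
move=> pz c c' E1; have [e ec] := cclass_neq0 c pz; have ec' := ec.
by rewrite E1 in ec'; move: ec ec'; rewrite !inE => /andP[_ /eqP <-] /andP[_ /eqP <-].
Qed.

Lemma classes_of_factorization z : properb E z -> one_factorization E (classes_of z).
Proof.
move=> pz; apply/one_factorizationP; split; last first.
  by move=> _ /imsetP[c _ ->]; apply: cclass_partition.
apply/and3P; split.
- apply/eqP/setP => e; apply/bigcupP/idP => [[_ /imsetP[c _ ->]]|eE]; first by rewrite inE => /andP[].
  by exists (cclass E z (z e)); rewrite ?imset_f // inE eE /=.
- apply/trivIsetP => _ _ /imsetP[c _ ->] /imsetP[c' _ ->] ne.
  rewrite -setI_eq0; apply/eqP/setP => e; rewrite !inE.
  apply/negP => /andP[/andP[_ /eqP zc] /andP[_ /eqP zc']].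
  by case/eqP: ne; rewrite -zc -zc'.
apply/negP => /imsetP[c _ E0]; have [e] := cclass_neq0 c pz.
by rewrite -E0 inE.
Qed.

Lemma fsign_classes z : properb E z ->
  \prod_c msign kap (cclass E z c) = fsign kap (classes_of z).
Proof.
move=> pz; rewrite /fsign big_imset //=; by move=> c c' _ _; exact: cclass_inj.
Qed.

(** A colouring with classes [F] is a naming of the [d] matchings by the [d] colours: [zs] builds it
    from a permutation and [s0] recovers the permutation. *)
Lemma card_colorings_of F : one_factorization E F ->
  #|[set z in colorings | classes_of z == F]| = d`!.
Proof.
move=> Ff; have cF := card_factorization v0 regE Ff.
have /one_factorizationP[pF pM] := Ff; have /and3P[/eqP covF tF nF] := pF.
pose ind M : 'I_d := inord (index M (enum F)).
have indI : {in F &, injective ind}.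
  move=> M M' MF M'F /(congr1 val); rewrite /= !inordK; last first.
  - by rewrite -cF cardE index_mem mem_enum.
  - by rewrite -cF cardE index_mem mem_enum.
  by apply: (index_inj M); rewrite mem_enum.
have pbF e : e \in E -> pblock F e \in F by move=> eE; rewrite pblock_mem // covF.
have pbE M e : M \in F -> e \in M -> pblock F e = M.
  by move=> MF eM; rewrite (def_pblock tF MF eM).
pose zs (s : {perm 'I_d}) : {ffun {set V} -> 'I_d} :=
  [ffun e => if e \in E then s (ind (pblock F e)) else ord0].
have zs_proper s : properb E (zs s).
  apply/properbP => e f eE fE ef nd; rewrite !ffunE eE fE.
  rewrite (inj_eq perm_inj); apply/eqP => /(indI _ _ (pbF _ eE) (pbF _ fE)) pef.
  have fp : f \in pblock F e by rewrite pef mem_pblock covF.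
  have ep : e \in pblock F e by rewrite mem_pblock covF.
  have /and3P[_ /trivIsetP tM _] := pM _ (pbF _ eE).
  by rewrite (tM _ _ ep fp ef) in nd.
have sE M : M \in F -> M \subset E.
  by move=> MF; rewrite -covF; apply: bigcup_sup.
have clsE s M : M \in F -> cclass E (zs s) (s (ind M)) = M.
  move=> MF; apply/setP => e; rewrite inE ffunE; apply/andP/idP => [[eE]|eM].
    rewrite eE (inj_eq perm_inj) => /eqP /(indI _ _ (pbF _ eE) MF) <-.
    by rewrite mem_pblock covF.
  by rewrite (subsetP (sE _ MF) _ eM) (pbE M).
have zsF s : classes_of (zs s) = F.
  apply/esym/eqP; rewrite eqEcard; apply/andP; split.
    by apply/subsetP=> M MF; rewrite -(clsE s M MF) imset_f.
  by rewrite cF (leq_trans (leq_imset_card _ _)) // card_ord.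
have ind_onto c : exists2 M, M \in F & ind M = c.
  have : ind @: F = setT.
    by apply/eqP; rewrite eqEcard subsetT cardsT card_ord card_in_imset // cF leqnn.
  by move/setP/(_ c); rewrite inE => /imsetP[M MF ->]; exists M.
have zsI : injective zs.
  move=> s s' E1; apply/permP => c; have [M MF <-] := ind_onto c.
  have [e eM] : exists e, e \in M by apply/set0Pn; apply: contraNneq nF => <-.
  have := congr1 (fun z : {ffun _ -> _} => z e) E1.
  by rewrite !ffunE (subsetP (sE _ MF) _ eM) (pbE M).
rewrite -card_Sn -cardsT -(card_imset _ zsI).
apply: eq_card => z; apply/idP/imsetP => [|[s _ ->]]; last first.
  rewrite !inE zsF eqxx zs_proper !andbT; apply/pffun_onP; split=> //.
  by apply/supportP => e eE; rewrite ffunE (negPf eE).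
rewrite !inE => /andP[/andP[/pffun_onP[/supportP zsupp _] pz] /eqP zF].
have ex c : exists c', cclass E z c' == cclass E (zs 1%g) c.
  have : cclass E (zs 1%g) c \in classes_of z by rewrite zF -(zsF 1%g) imset_f.
  by case/imsetP => c' _ ->; exists c'.
pose s0 c := xchoose (ex c).
have s0P c : cclass E z (s0 c) = cclass E (zs 1%g) c by apply/eqP; exact: xchooseP (ex c).
have s0I : injective s0.
  by move=> c c' E1; apply: (cclass_inj (zs_proper 1%g)); rewrite -!s0P E1.
exists (perm s0I) => //; apply/ffunP => e; rewrite ffunE; case: ifP => eE; last first.
  by rewrite zsupp ?eE.
have : e \in cclass E (zs 1%g) (ind (pblock F e)) by rewrite inE eE ffunE eE perm1 /=.
by rewrite -s0P inE => /andP[_ /eqP ->]; rewrite permE.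
Qed.

Lemma sum_colorings :
  \sum_(z in colorings) \prod_c msign kap (cclass E z c) = d`!%:R * Ssum kap E.
Proof.
rewrite (partition_big (fun z : {ffun {set V} -> 'I_d} => classes_of z)
           (one_factorization E)) /=; last first.
  by move=> z; rewrite inE => /andP[_]; exact: classes_of_factorization.
rewrite /Ssum mulr_sumr; apply: eq_bigr => F Ff.
rewrite (eq_bigr (fun=> fsign kap F)); last first.
  by move=> z /andP[]; rewrite inE => /andP[_ pz] /eqP <-; exact: fsign_classes.
rewrite sumr_const -(card_colorings_of Ff) mulr_natl; congr (_ *+ _).
by apply: eq_card => z; rewrite [RHS]inE.
Qed.

End SumColorings.

Import Num.Theory.

(** * Degree of the line graph polynomial and its values at roots of unity *)

Lemma card_rk_pairs (X : finType) (D : {set X}) :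
  (2 * #|[set u : X * X | [&& u.1 \in D, u.2 \in D & rk u.1 u.2]]| = #|D| * #|D|.-1)%N.
Proof.
pose A := [set u : X * X | [&& u.1 \in D, u.2 \in D & rk u.1 u.2]].
pose sw (u : X * X) := (u.2, u.1).
have swI : injective sw by move=> [a b] [c d] [-> ->].
pose Dg := [set (x, x) | x in D].
have E1 : setX D D = Dg :|: (A :|: sw @: A).
  apply/setP => -[x y]; rewrite !inE /=; apply/andP/idP => [[xD yD]|].
    case: (eqVneq x y) => [->|xy]; first by rewrite imset_f.
    rewrite xD yD /=; case: (boolP (rk x y)) => rr; first by rewrite orbT.
    apply/orP; right; apply/orP; right; apply/imsetP; exists (y, x) => //.
    by rewrite inE /= xD yD (@rk_tournament _ setT) ?inE // eq_sym xy.
  case/orP => [/imsetP[w wD [-> ->]]|] //; case/orP => [/and3P[]|] //.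
  by case/imsetP => -[a b]; rewrite inE /= => /and3P[aD bD _] [-> ->].
have d1 : [disjoint A & sw @: A].
  rewrite -setI_eq0; apply/eqP/setP => -[x y]; rewrite !inE /=; apply/negP => /andP[/and3P[_ _ r1]].
  case/imsetP => -[a b]; rewrite inE /= => /and3P[_ _ r2] [ex ey]; subst.
  by move: r1; rewrite (@rk_tournament _ setT) ?inE // r2 andbF.
have d2 : [disjoint Dg & A :|: sw @: A].
  rewrite -setI_eq0; apply/eqP/setP => -[x y]; rewrite !inE /=; apply/negP => /andP[].
  case/imsetP => w _ [-> ->]; rewrite /rk ltnn !andbF /=.
  by case/imsetP => -[a b]; rewrite inE /= => /and3P[_ _ r2] [ex ey]; subst; rewrite /rk ltnn in r2.
have := cardsX D D; rewrite E1.
have cU (S S' : {set X * X}) : [disjoint S & S'] -> #|S :|: S'| = (#|S| + #|S'|)%N.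
  by move=> dd; rewrite cardsU (disjoint_setI0 dd) cards0 subn0.
rewrite !cU // (card_imset _ swI) card_imset; last by move=> x y [].
rewrite -/A; case: #|D| => [|k] /=; rewrite mul2n -addnn // mulnS.
by move/eqP; rewrite eqn_add2l => /eqP.
Qed.

Section Start.
Variables (V : finType) (kap : V -> nat) (E : {set {set V}}) (d' : nat) (v0 : V).
Local Notation d := d'.+1.
Hypotheses (kI : injective kap) (EK : E \subset complete V) (regE : regular E d).
Local Notation C := algC.

Lemma card_edges : (#|E| * 2 = #|V| * d)%N.
Proof.
have <- := card_darts regE; rewrite -sum1dep_card /=.
rewrite -(pair_big_dep xpredT (fun v (e : {set V}) => (e \in E) && (v \in e)) (fun _ _ => 1%N)) /=.
rewrite (exchange_big_dep (mem E)) /=; last by move=> v e _ /andP[].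
rewrite -sum_nat_const; apply: eq_bigr => e eE.
have := subsetP EK _ eE; rewrite inE => /eqP <-.
by rewrite sum1dep_card; apply: eq_card => v; rewrite inE eE.
Qed.

Lemma card_lpairs : (#|lpairs E| = #|E| * d')%N.
Proof.
rewrite -sum1dep_card (big_adjacent _ (fun _ => 1%N) EK) /=.
have := card_edges.
under eq_bigr => v _ do rewrite sum1dep_card.
have : (2 * \sum_v #|[set u : {set V} * {set V} | [&& u.1 \in edges_at E v,
      u.2 \in edges_at E v & rk u.1 u.2]]| = #|V| * (d * d'))%N.
  rewrite big_distrr /= -sum_nat_const; apply: eq_bigr => v _.
  by rewrite card_rk_pairs (regE v).
move=> h2 h1; apply/eqP; rewrite -(eqn_pmul2l (isT : 0 < 2)%N) h2.
by rewrite mulnA -h1 mulnAC mulnC.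
Qed.

Lemma linepoly_mdeg (K : idomainType) m :
  m \in msupp (linepoly K E) -> mdeg m = (#|E| * d')%N.
Proof. by rewrite -card_lpairs; have /dhomogP := linepoly_dhomog K E; apply. Qed.

Variable w : algC.
Hypothesis wP : d.-primitive_root w.
Let a (c : 'I_d) : algC := w ^+ c.

Lemma root_power_sum k : \sum_(c < d) a c ^+ k.+1 != 0 -> (d %| k.+1)%N.
Proof.
apply: contraNT => nd; have w1 : w ^+ k.+1 - 1 != 0.
  by rewrite subr_eq0 -(prim_order_dvd wP).
rewrite -(mulrI_eq0 _ (mulfI w1)).
under eq_bigr do rewrite /a exprAC.
by rewrite -subrX1 exprAC (prim_expr_order wP) expr1n subrr.
Qed.

Let ev (z : {set V} -> 'I_d) : algC :=
  (linepoly [the idomainType of algC] E).@[fun i => a (z (enum_val i))].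

(** The factors at a vertex form a Vandermonde product of all [d] roots, taken in the order in which
    the colours appear there; reordering costs the local sign of [vsign]. *)
Lemma ev_proper z : properb E z ->
  ev z = pp [set: 'I_d] (fun c c' => (sg (@nat_of_ord d) c c')%:~R * (a c - a c')) ^+ #|V| *
         (vsign E z)%:~R.
Proof.
move=> pz; rewrite /ev /linepoly rmorph_prod /=.
under eq_bigr => u _ do rewrite mevalB !mevalXU !enum_rankK.
rewrite (big_adjacent _ (fun u => a (z u.1) - a (z u.2)) EK) /=.
rewrite /vsign rmorph_prod /= -prodr_const -big_split; apply: eq_bigr => v _ /=.
rewrite -(proper_at_im regE v pz) pp_imset.
- rewrite rmorph_prod -big_split /=; apply: eq_bigr => -[e f] /= /and3P[_ _ rr].
  have -> : sg (@ekey V) e f = 1 by rewrite /sg (rr : (ekey e < ekey f)%N).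
  rewrite mul1r mulrAC.
  by rewrite -intrM sg_sqr mul1r.
- exact: proper_at.
move=> e f eE fE; case: (eqVneq (z e) (z f)) => [->//|ne].
by rewrite (sgN val_inj ne) rmorphN /= -[a (z e) - _]opprB mulrN mulNr.
Qed.

Lemma ev_improper (z : {set V} -> 'I_d) : ~~ properb E z -> ev z = 0.
Proof.
case/forall_inPn => e eE /forall_inPn[f fE]; rewrite negb_imply negbK => /andP[/andP[ef nd] /eqP zef].
wlog rr : e f eE fE ef nd zef / rk e f.
  move=> H; case: (boolP (rk e f)) => rr; first exact: (H e f).
  apply: (H f e) => //; rewrite 1?eq_sym 1?disjoint_sym //.
  by rewrite (@rk_tournament _ setT) ?inE // rr eq_sym ef.
rewrite /ev /linepoly rmorph_prod /= (bigD1 (e, f)) /=; last by rewrite eE fE rr.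
by rewrite mevalB !mevalXU !enum_rankK zef subrr mul0r.
Qed.

(** Improper colourings are zeros of the polynomial. On proper ones the weight is the constant [A],
    as each colour class has [#|V| / 2] edges, and the Vandermonde power is constant too; only the
    matching signs vary. *)
Lemma total_neq0 : Ssum kap E != 0 ->
  \sum_(z in pffun_on ord0 (mem E) predT) (\prod_(e in E) a (z e)) * ev z != 0.
Proof.
move=> S0; rewrite (bigID (fun z : {ffun {set V} -> 'I_d} => properb E z)) /=.
rewrite [X in _ + X]big1 ?addr0; last first.
  by move=> z /andP[_ /ev_improper ->]; rewrite mulr0.
set Vd := pp [set: 'I_d] (fun c c' => (sg (@nat_of_ord d) c c')%:~R * (a c - a c')).
have a0 c : a c != 0.
  rewrite expf_neq0 //; apply/eqP => w0; have := prim_expr_order wP.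
  by move/eqP; rewrite w0 expr0n /= eq_sym oner_eq0.
have Vd0 : Vd != 0.
  apply/prodf_neq0 => -[c c'] /= /and3P[_ _]; rewrite (@rk_tournament _ setT) ?inE // => /andP[cc' _].
  rewrite mulf_neq0 //; first by rewrite /sg; case: ifP => _; rewrite ?oppr_eq0 oner_eq0.
  by rewrite subr_eq0 /a (eq_prim_root_expr wP) !modn_small.
pose A := \prod_(c < d) a c ^+ (#|V| %/ 2).
have A0 : A != 0 by apply/prodf_neq0 => c _; rewrite expf_neq0.
rewrite (eq_bigr (fun z : {ffun {set V} -> 'I_d} => A * Vd ^+ #|V| * (dart_const kap E d)%:~R *
    (\prod_c msign kap (cclass E z c))%:~R)); last first.
  move=> z /andP[_ pz]; rewrite ev_proper // (vsign_msign kI EK regE pz) rmorphM /= !mulrA.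
  congr (_ * _ * _ * _); rewrite (partition_big z xpredT) //=.
  apply: eq_bigr => c _; rewrite (eq_bigr (fun=> a c)) => [|e /andP[_ /eqP ->]//].
  rewrite prodr_const; congr (_ ^+ _).
  have pc := cclass_partition EK regE c pz.
  have cK : cclass E z c \subset complete V.
    by apply: subset_trans EK; apply/subsetP=> e; rewrite inE => /andP[].
  rewrite (card_perfect_matching cK pc) mulnK //.
  by apply: eq_card => e; rewrite [RHS]inE.
rewrite -mulr_sumr -rmorph_sum /=.
rewrite (eq_bigl (fun z => z \in colorings E d')) => [|z]; last by rewrite [RHS]inE.
rewrite (sum_colorings kap v0 EK regE) !mulf_neq0 //.
- by rewrite expf_neq0.
- rewrite intr_eq0; apply/eqP => c0; have := dart_const_sqr kap E d.
  by rewrite c0 mul0r.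
by rewrite intr_eq0 mulf_neq0 // Num.Theory.pnatr_eq0 -lt0n fact_gt0.
Qed.

(** The weight raises each edge exponent by one, so the sum over colourings keeps only monomials
    whose edge exponents are all -1 modulo [d]. These exponents are at least [d - 1], and the total
    degree [#|E| * (d - 1)] leaves room for no more. *)
Lemma good_regular : Ssum kap E != 0 ->
  good [the idomainType of algC] E [ffun=> d].
Proof.
move=> /total_neq0; pose P := linepoly [the idomainType of algC] E.
have -> : \sum_(z in pffun_on ord0 (mem E) predT) (\prod_(e in E) a (z e)) * ev z =
    \sum_(m <- msupp P) P@_m * \prod_(e in E) \sum_(c < d) a c ^+ (m (enum_rank e)).+1.
  under eq_bigr => z _ do rewrite /ev -/P mevalE mulr_sumr.
  rewrite exchange_big /=; apply: eq_bigr => m _.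
  rewrite (big_distr_big_dep ord0) /= mulr_sumr; apply: eq_bigr => z /pffun_onP[/supportP zE _].
  rewrite mulrCA; congr (_ * _); rewrite (reindex _ (onW_bij _ (@enum_rank_bij [the finType of {set V}]))) /=.
  (* Variables of sets outside [E] take the default colour 0, hence the value [w ^+ 0 = 1]. *)
  rewrite [X in _ * X](bigID (mem E)) /= [X in _ * (_ * X)]big1 ?mulr1; last first.
    by move=> e eE; rewrite enum_rankK zE // /a expr0 expr1n.
  rewrite -big_split; apply: eq_bigr => e _ /=.
  by rewrite enum_rankK exprS.
rewrite big_seq => S0; have [m mP mE] : exists2 m, m \in msupp P &
    forall e, e \in E -> (d %| (m (enum_rank e)).+1)%N.
  have [/hasP[m mP /forall_inP h]|/hasPn h] :=
    boolP (has (fun m : 'X_{1..#|{set V}|} => [forall e in E, (d %| (m (enum_rank e)).+1)%N]) (msupp P)).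
    by exists m.
  case/eqP: S0; apply: big1 => m /h /forall_inPn[e eE nd].
  rewrite (bigD1 e) //= (_ : \sum_(c < d) _ = 0) ?mul0r ?mulr0 //.
  by apply/eqP; apply: contraNT nd; exact: root_power_sum.
exists m => // e eE; rewrite ffunE.
have le f : f \in E -> (d' <= m (enum_rank f))%N.
  by move=> /mE; move/dvdn_leq; rewrite ltnS; apply.
have := linepoly_mdeg mP; rewrite mdegE (reindex _ (onW_bij _ (@enum_rank_bij [the finType of {set V}]))) /= => sm.
have : (\sum_(f in E) m (enum_rank f) <= #|E| * d')%N.
  by rewrite -sm [leqRHS](bigID (mem E)) /= leq_addr.
rewrite (bigD1 e) //= -sum_nat_const [leqRHS](bigD1 e) //=.
have : (\sum_(i in E | i != e) d' <= \sum_(i in E | i != e) m (enum_rank i))%N.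
  by apply: leq_sum => f /andP[/le].
move=> h1 h2; rewrite ltnS -(leq_add2r (\sum_(i in E | i != e) d')).
by apply: leq_trans h2; rewrite leq_add2l.
Qed.

End Start.

Lemma Ssum_paintable (V : finType) (kap : V -> nat) (E : {set {set V}}) d (v : V) :
  injective kap -> E \subset complete V -> regular E d -> (0 < d)%N ->
  Ssum kap E != 0 ->
  is_edge_paintability_index E d /\ is_list_edge_index E d.
Proof.
case: d => // d kI EK regE _ S0.
have [w wP] := C_prim_root_exists (ltn0Sn d).
have win : edge_paintable E d.+1.
  by apply: good_painter_wins (good_regular v kI EK regE wP S0).
have deg k : edge_choosable E k -> (d.+1 <= k)%N.
  by move/(choosable_degree v); rewrite regE.
split; split=> //; first by move=> k /paintable_choosable /deg.
exact: paintable_choosable.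
Qed.

(** * The complete graph on [p - 1] vertices *)

Section InvariantFunctions.
Variables (D : finType).

Lemma porbit_inv (C : Type) (s : {perm D}) (f : D -> C) : (forall x, f (s x) = f x) ->
  forall x y, y \in porbit s x -> f y = f x.
Proof.
move=> fs x y /porbitP[i ->]; elim: i => [|i IH]; first by rewrite perm1.
by rewrite expgSr permM fs.
Qed.

(** Invariant functions factor through the orbits, and functions on orbits are counted with a
    default colour elsewhere. An empty colour set offers no default and is treated apart. *)
Lemma card_invariant_functions (C : finType) (s : {perm D}) :
  #|[set f : {ffun D -> C} | [forall x, f (s x) == f x]]| = (#|C| ^ #|porbits s|)%N.
Proof.
case: (pickP (fun _ : C => true)) => [c0 _|C0]; last first.
  have c0 : #|C| = 0%N by apply: eq_card0 => c; have := C0 c.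
  case: (pickP (fun _ : D => true)) => [x0 _|D0].
    rewrite c0 exp0n; last by apply/card_gt0P; exists (porbit s x0); exact: imset_f.
    by apply: eq_card0 => f; have := C0 (f x0).
  have -> : #|porbits s| = 0%N.
    by apply: eq_card0 => A; apply/negP => /imsetP[x _ _]; have := D0 x.
  rewrite expn0; have fE (f : {ffun D -> C}) : [forall x, f (s x) == f x].
    by apply/forallP => x; have := D0 x.
  rewrite -[RHS](_ : #|{ffun D -> C}| = 1%N); last first.
    by rewrite card_ffun (eq_card0 (A := D)) ?expn0 // => x; have := D0 x.
  by apply: eq_card => f; rewrite inE fE.
have <- : #|pffun_on c0 (mem (porbits s)) (mem C)| = (#|C| ^ #|porbits s|)%N.
  by rewrite card_pffun_on.
pose g (h : {ffun {set D} -> C}) : {ffun D -> C} := [ffun x => h (porbit s x)].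
have ps x : porbit s (s x) = porbit s x.
  by apply/eqP; rewrite eq_porbit_mem; exact: (mem_porbit s 1).
have -> : [set f : {ffun D -> C} | [forall x, f (s x) == f x]] =
    g @: [set h in pffun_on c0 (mem (porbits s)) (mem C)].
  apply/setP => f; rewrite inE; apply/forallP/imsetP => [fs|[h _ ->] x]; last first.
    by rewrite !ffunE ps.
  exists [ffun A => if A \in porbits s then
     (if [pick x in A] is Some x then f x else c0) else c0].
    rewrite inE; apply/pffun_onP; split=> //; apply/supportP => A AP.
    by rewrite ffunE (negPf AP).
  apply/ffunP => x; rewrite !ffunE imset_f //; case: pickP => [y yx|/(_ x)].
    by apply/esym/(porbit_inv (s := s)) => // z; apply/eqP.
  by rewrite porbit_id.
rewrite card_in_imset; first by apply: eq_card => h; rewrite inE.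
move=> h h'; rewrite !inE => /pffun_onP[/supportP hP _] /pffun_onP[/supportP hP' _] gg.
apply/ffunP => A; case: (boolP (A \in porbits s)) => AP; last by rewrite hP ?hP'.
have /imsetP[x _ ->] := AP.
by have := congr1 (fun f : {ffun D -> C} => f x) gg; rewrite !ffunE.
Qed.

End InvariantFunctions.

(** * Two fixed-point-free involutions and the orientations of their alternating cycles *)

Section TwoInvolutions.
Variables (D : finType) (F T : D -> D).
Hypotheses (FK : involutive F) (TK : involutive T).
Hypotheses (F0 : forall x, F x != x) (T0 : forall x, T x != x).

Definition anti (o : D -> bool) (G : D -> D) := [forall x, o (G x) == ~~ o x].
Definition invar (C : eqType) (f : D -> C) (G : D -> D) := [forall x, f (G x) == f x].

(** The pairs of [F] and [T] form alternating cycles. When both involutions reverse [o], this map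
    follows [F] and [T] in turn and runs once around each cycle, in the direction prescribed by
    [o]. *)
Definition swapfun (o : D -> bool) x := if o x then F x else T x.

Lemma swapfun_inj o : anti o F -> anti o T -> injective (swapfun o).
Proof.
move=> /forallP oF /forallP oT x y; rewrite /swapfun.
case: (boolP (o x)) (boolP (o y)) => ox [] oy E.
- exact: (inv_inj FK).
- by have /eqP := oF x; rewrite E (eqP (oT y)) ox (negPf oy).
- by have /eqP := oF y; rewrite -E (eqP (oT x)) oy (negPf ox).
- exact: (inv_inj TK).
Qed.

(** The identity is only a default for an [o] whose [swapfun] is not injective. *)
Definition swapperm o : {perm D} :=
  if insub (finfun (swapfun o)) is Some s then s else 1%g.

Lemma swappermE o : anti o F -> anti o T -> swapperm o =1 swapfun o.
Proof.
move=> oF oT x; rewrite /swapperm; case: insubP => [s _ sE|].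
  by rewrite -pvalE [pval s]sE ffunE.
by case/negP; apply/injectiveP => y z; rewrite !ffunE; apply: swapfun_inj.
Qed.

Lemma invar_swapperm (C : eqType) (f : D -> C) o : anti o F -> anti o T ->
  invar f (swapperm o) = invar f F && invar f T.
Proof.
move=> oF oT; have sE := swappermE oF oT.
apply/forallP/andP => [fs|[/forallP fF /forallP fT] x]; last first.
  by rewrite sE /swapfun; case: ifP.
split; apply/forallP => x; case: (boolP (o x)) => ox.
- by have := fs x; rewrite sE /swapfun ox.
- have oFx : o (F x) by rewrite (eqP (forallP oF x)).
  by have := fs (F x); rewrite sE /swapfun oFx FK eq_sym.
- have oTx : o (T x) = false by rewrite (eqP (forallP oT x)) ox.
  by have := fs (T x); rewrite sE /swapfun oTx TK eq_sym.
- by have := fs x; rewrite sE /swapfun (negPf ox).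
Qed.

Let s : {perm D} := (perm (inv_inj FK) * perm (inv_inj TK))%g.

Lemma sE x : s x = T (F x). Proof. by rewrite permM !permE. Qed.

Lemma sVE x : (s^-1)%g x = F (T x).
Proof. by apply: (@perm_inj _ s); rewrite permKV sE FK TK. Qed.

Lemma F_sX i x : F ((s ^+ i)%g x) = (s ^- i)%g (F x).
Proof.
elim: i x => [|i IH] x; first by rewrite expg0 invg1 !perm1.
rewrite {1}expgS permM IH expgSr invMg [RHS]permM; congr (fun_of_perm _ _).
by rewrite sVE sE.
Qed.

(** [F] conjugates [s] to its inverse. If [F x] were [s ^+ i] of [x], the midpoint of the path would
    be fixed by [F] when [i] is even and by [T] when [i] is odd. *)
Lemma not_porbit x : F x \notin porbit s x.
Proof.
apply/negP => /porbitP[i Fx].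
have [j [e|e]] : exists j, i = j.*2 \/ i = j.*2.+1.
  by exists i./2; have := odd_double_half i; case: (odd i) => /= E; [right|left]; rewrite -{1}E.
- have := F0 ((s ^+ j)%g x).
  by rewrite F_sX Fx e -addnn -[X in X != _]permM expgD mulgK eqxx.
have := T0 ((s ^+ j.+1)%g x).
have -> y : T y = s (F y) by rewrite sE FK.
rewrite F_sX Fx e -[X in s X]permM -[X in X != _]permM.
have -> : (j.*2.+1 = j + j.+1)%N by rewrite addnS addnn.
by rewrite expgD mulgK -expgSr eqxx.
Qed.

(** [F] and [T] both exchange the orbit of [x] under [s] with a different one, that of [F x]; [o]
    singles out the orbit of smaller rank. *)
Lemma exists_anti : exists o : D -> bool, anti o F && anti o T.
Proof.
pose r (A : {set D}) : nat := enum_rank A.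
have rI A B : r A = r B -> A = B by move/ord_inj/enum_rank_inj.
have ne x : porbit s x != porbit s (F x).
  by rewrite eq_porbit_mem porbit_sym; exact: not_porbit.
have ne' x : r (porbit s (F x)) != r (porbit s x).
  by apply/eqP => /rI/eqP; rewrite eq_sym (negPf (ne x)).
exists (fun x => (r (porbit s x) < r (porbit s (F x)))%N).
apply/andP; split; apply/forallP => x.
  by rewrite FK -leqNgt ltn_neqAle ne'.
have -> : porbit s (T x) = porbit s (F x).
  apply/eqP; rewrite eq_porbit_mem; apply/porbitP; exists 1%N.
  by rewrite expg1 sE FK.
have -> : porbit s (F (T x)) = porbit s x.
  by apply/eqP; rewrite eq_porbit_mem -sVE -porbitV; exact: (mem_porbit s^-1 1).
by rewrite -leqNgt ltn_neqAle ne'.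
Qed.

(* Colourings constant along the cycles of two involutions in [d] colours
   number [d ^ c], and [-2] can be substituted for [d] at the price of
   counting signed alternating orientations of these cycles. *)
Lemma invariant_vs_alternating (R : comNzRingType) (C : finType) :
  ~~ odd #|D| -> #|C|%:R = -1 * 2%:R :> R ->
  (#|[set f : {ffun D -> C} | invar f F && invar f T]|%:R : R) =
  \sum_(o : {ffun D -> bool} | anti o F && anti o T) (-1) ^+ (swapperm o).
Proof.
move=> oD cC; have [o0 [o0F o0T]] : exists o0 : {ffun D -> bool}, anti o0 F /\ anti o0 T.
  have [o /andP[/forallP oF /forallP oT]] := exists_anti; exists (finfun o).
  by split; apply/forallP=> x; rewrite !ffunE.
have cardE (B : finType) o : anti o F -> anti o T ->
    #|[set f : {ffun D -> B} | invar f F && invar f T]| = (#|B| ^ #|porbits (swapperm o)|)%N.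
  move=> oF oT; rewrite -card_invariant_functions; apply: eq_card => f.
  by rewrite !inE -(invar_swapperm f oF oT).
have po (o : {ffun D -> bool}) : anti o F && anti o T ->
    #|porbits (swapperm o)| = #|porbits (swapperm o0)|.
  case/andP=> oF oT; have := cardE (bool : finType) _ oF oT.
  rewrite (cardE (bool : finType) _ o0F o0T) card_bool => /eqP.
  by rewrite eqn_exp2l // => /eqP.
rewrite (cardE C _ o0F o0T) natrX cC.
rewrite (eq_bigr (fun=> (-1) ^+ #|porbits (swapperm o0)|)); last first.
  by move=> o /po oo; rewrite /odd_perm (negPf oD) oo /= signr_odd.
rewrite sumr_const -[RHS]mulr_natl exprMn mulrC; congr (_ * _).
rewrite -natrX; congr (_%:R).
rewrite -[X in (X ^ _)%N]card_bool -(cardE (bool : finType) _ o0F o0T).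
(* Exclusive or with the fixed orientation [o0] exchanges two-colourings constant along cycles with
   alternating orientations, so the latter number 2 to the number of cycles. *)
pose h (f : {ffun D -> bool}) := [ffun x => f x (+) o0 x].
have hK : involutive h by move=> f; apply/ffunP => x; rewrite !ffunE -addbA addbb addbF.
rewrite -(card_imset _ (inv_inj hK)); apply: eq_card => o.
have hi G (f : {ffun D -> bool}) : anti o0 G -> invar f G = anti (h f) G.
  move=> /forallP aG; apply: eq_forallb => x; rewrite !ffunE (eqP (aG x)).
  by case: (f x); case: (f (G x)); case: (o0 x).
apply/idP/imsetP => [|[f]].
  rewrite inE (hi F) // (hi T) // => oo; exists (h o); last by rewrite hK.
  by rewrite unfold_in.
by rewrite unfold_in => /andP[aF aT] ->; rewrite inE (hi F) // (hi T) // hK aF aT.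
Qed.

End TwoInvolutions.

Definition pairing (D : finType) (G : D -> D) : {set {set D}} := [set [set x; G x] | x : D].

Section Pairings.
Variables (D : finType) (G : D -> D).
Hypotheses (GK : involutive G) (G0 : forall x, G x != x).

Lemma pairing_block x y : y \in [set x; G x] -> [set y; G y] = [set x; G x].
Proof. by case/set2P=> -> //; rewrite GK setUC. Qed.

Lemma partition_pairing : partition (pairing G) [set: D].
Proof.
apply/and3P; split.
- apply/eqP/setP => x; rewrite inE; apply/bigcupP; exists [set x; G x]; rewrite ?set21 //.
  exact: imset_f.
- apply/trivIsetP => _ _ /imsetP[x _ ->] /imsetP[y _ ->] ne.
  rewrite -setI_eq0; apply/eqP/setP => z; rewrite inE [RHS]inE; apply/negP => /andP[zx zy].
  by case/eqP: ne; rewrite -(pairing_block zx) -(pairing_block zy).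
by apply/negP => /imsetP[x _ /setP/(_ x)]; rewrite !inE eqxx.
Qed.

Lemma card_pairing e : e \in pairing G -> #|e| = 2.
Proof. by case/imsetP => x _ ->; rewrite cards2 eq_sym G0. Qed.

Lemma even_pairs_pairing : even_pairs (pairing G).
Proof. by move=> e f /card_pairing -> _ _; rewrite oddM. Qed.

Lemma pairing_repr (o : D -> bool) (b : bool) e : anti o G -> e \in pairing G ->
  exists2 x, o x = b & e = [set x; G x].
Proof.
move=> /forallP oG /imsetP[x _ ->]; case: (eqVneq (o x) b) => ox; first by exists x.
exists (G x); last by rewrite GK setUC.
by rewrite (eqP (oG x)); case: (o x) ox; case: b.
Qed.

Lemma big_pairing (R : comNzRingType) (o : D -> bool) (g : {set D} -> R) : anti o G ->
  \prod_(e in pairing G) g e = \prod_(x | o x) g [set x; G x].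
Proof.
move=> /forallP oG; pose O := [set x | o x].
have -> : pairing G = [set [set x; G x] | x in O].
  apply/setP=> e; apply/imsetP/imsetP => -[x _ ->]; last by exists x.
  case: (boolP (o x)) => ox; first by exists x; rewrite ?inE.
  by exists (G x); rewrite ?GK 1?setUC // inE (eqP (oG x)).
rewrite big_imset /=; last first.
  move=> x y; rewrite !inE => ox oy /set2_eq[[]|[xy _]] //.
  by move: ox; rewrite xy (eqP (oG y)) oy.
by apply: eq_bigl => x; rewrite inE.
Qed.

End Pairings.

Section SwapSign.
Variables (D : finType) (F T : D -> D) (del : D -> nat) (o : D -> bool).
Hypotheses (FK : involutive F) (TK : involutive T).
Hypotheses (F0 : forall x, F x != x) (T0 : forall x, T x != x).
Hypotheses (dI : injective del) (oF : anti o F) (oT : anti o T).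

Lemma swapperm_pairing : im2 (swapperm F T o) (pairing F) = pairing T.
Proof.
have sE := swappermE FK TK oF oT.
have im x : o x -> swapperm F T o @: [set x; F x] = [set F x; T (F x)].
  move=> ox; rewrite imsetU1 imset_set1 !sE /swapfun ox.
  by rewrite (eqP (forallP oF x)) ox.
apply/setP => e; apply/imsetP/idP => [[f /(pairing_repr FK true oF)[x ox ->] ->]|].
  by rewrite im //; exact: imset_f.
case/(pairing_repr TK false oT) => x ox ->; have oFx : o (F x) by rewrite (eqP (forallP oF x)) ox.
by exists [set F x; F (F x)]; [exact: imset_f | rewrite im // FK].
Qed.

(** [swapperm] carries the pairs of [F] to those of [T], so [msign_relabel] expresses its signature
    by the two matching signs and the inversions inside pairs. The latter compare the ends of every
    [F]-pair and [T]-pair along its orientation. *)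
Lemma swapperm_sign :
  (-1) ^+ swapperm F T o = msign del (pairing T) * msign del (pairing F) *
    (\prod_(x | o x) sg del x (F x)) * \prod_(x | ~~ o x) sg del x (T x).
Proof.
have sE := swappermE FK TK oF oT.
have := msign_relabel dI dI (@perm_inj _ (swapperm F T o)) (partition_pairing FK)
   (even_pairs_pairing F0).
rewrite -/(im2 _ _) swapperm_pairing => E.
rewrite -(bsign_perm dI).
have E2 : \prod_(e in pairing F) pp e (flip del del (swapperm F T o)) =
   (\prod_(x | o x) sg del x (F x)) * \prod_(x | ~~ o x) sg del x (T x).
  rewrite (big_pairing FK _ oF) [X in _ = _ * X](reindex_inj (inv_inj FK)) /=.
  rewrite [X in _ = _ * X](eq_bigl o); last first.
    by move=> x; rewrite (eqP (forallP oF x)) negbK.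
  rewrite -big_split; apply: eq_bigr => x ox /=.
  rewrite pp_set2 1?eq_sym ?F0 //; last exact: (flipC dI dI (@perm_inj _ _)).
  rewrite /flip; congr (_ * _); rewrite !sE /swapfun ox.
  by rewrite (eqP (forallP oF x)) ox.
rewrite E E2 -!mulrA.
set X := \prod_(x | o x) _; set Y := \prod_(x | ~~ o x) _.
set N := bsign _ _ _; set M := msign _ _.
have M2 : M * M = 1 by exact: msign_sqr.
have X2 : X * X = 1 by rewrite /X -big_split big1 // => x _; exact: sg_sqr.
have Y2 : Y * Y = 1 by rewrite /Y -big_split big1 // => x _; exact: sg_sqr.
transitivity (N * (M * M) * (X * X) * (Y * Y)); first by rewrite M2 X2 Y2 !mulr1.
ring.
Qed.

End SwapSign.

(** [S] contains one point of each pair of [F]; on each pair [o] freely chooses which of the two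
    points is true. *)
Lemma sum_anti (D : finType) (F : D -> D) (S : {set D}) (R : comNzRingType) (c : D -> R) :
  involutive F -> (forall x, (F x \in S) = (x \notin S)) ->
  \sum_(o : {ffun D -> bool} | anti o F) \prod_(x | o x) c x =
  \prod_(x in S) (c x + c (F x)).
Proof.
move=> FK FS.
rewrite [RHS]big_mkcond /=.
rewrite (eq_bigr (fun x => (if x \in S then c x else 0) + (if x \in S then c (F x) else 1)));
  last by move=> x _; case: ifP => _; rewrite ?add0r.
rewrite bigA_distr /=.
pose JO (J : {set D}) : {ffun D -> bool} :=
  [ffun x => if x \in S then x \in J else F x \notin J].
rewrite (reindex_onto JO (fun o : {ffun D -> bool} => [set x in S | o x])) /=; last first.
  move=> o /forallP aF; apply/ffunP => x; rewrite ffunE !inE.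
  by case: (boolP (x \in S)) => xS //=; rewrite FS xS (eqP (aF x)) /= negbK.
rewrite [RHS](bigID (fun J : {set D} => J \subset S)) /= [X in _ + X]big1 ?addr0; last first.
  move=> J /subsetPn[x xJ xS]; rewrite (bigD1 x) //= xJ (negPf xS).
  by rewrite mul0r.
apply: eq_big => [J|J].
  apply/andP/idP => [[_ /eqP <-]|JS]; first by apply/subsetP => x; rewrite inE => /andP[].
  split; last first.
    apply/eqP/setP => x; rewrite inE ffunE; case: (boolP (x \in S)) => //= xS.
    by apply/esym/negbTE; apply: contra xS; apply: (subsetP JS).
  apply/forallP => x; rewrite !ffunE FS FK.
  by case: (x \in S) => /=; rewrite ?negbK.
move=> /andP[aF /eqP JE].
have JS : J \subset S by rewrite -JE; apply/subsetP => x; rewrite inE => /andP[].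
rewrite [LHS]big_mkcond [LHS](bigID (mem S)) [RHS](bigID (mem S)) /=.
rewrite [X in _ * X = _](reindex_inj (inv_inj FK)) /=.
rewrite [X in _ * X = _](eq_bigl (mem S)) => [|x]; last by rewrite FS negbK.
rewrite [X in _ = _ * X]big1 ?mulr1; last first.
  by move=> x xS; rewrite (negPf xS) (_ : x \in J = false) //; apply: contraNF xS; apply: (subsetP JS).
rewrite -big_split; apply: eq_bigr => x xS /=.
rewrite !ffunE xS FS FK xS /=; case: ifP => _; by rewrite ?mulr1 ?mul1r.
Qed.

(** * Half-edges of the complete graph and the signed count of its colourings *)

Section Darts.
Variable k : nat.
Local Notation h := k.+1.
Local Notation m := (k.*2).+1.
Local Notation n := m.+1.
Local Notation dart := ('I_n * 'I_m)%type.

(* The pair [(v, a)] is the edge from [v] to [lift v a], seen from [v]. *)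
Definition dflip (x : dart) : dart :=
  (lift x.1 x.2, odflt x.2 (unlift (lift x.1 x.2) x.1)).

Lemma lift_dflip x : lift (dflip x).1 (dflip x).2 = x.1.
Proof.
rewrite /dflip /=; case: unliftP => [j e|e] /=; first by rewrite -e.
by have := neq_lift x.1 x.2; rewrite -e eqxx.
Qed.

Lemma dart_inj (x y : dart) : x.1 = y.1 -> lift x.1 x.2 = lift y.1 y.2 -> x = y.
Proof. by case: x y => [a b] [c d] /= <- /lift_inj <-. Qed.

Lemma dflipK : involutive dflip.
Proof. by move=> x; apply: dart_inj; rewrite ?lift_dflip //= lift_dflip. Qed.

Lemma dflip_neq x : dflip x != x.
Proof. by apply/eqP => /(congr1 fst) /= e; have := neq_lift x.1 x.2; rewrite e eqxx. Qed.

(** The vertices are paired by [rev_ord]: [lo] and [hi] list the lower and upper members, and [idx]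
    returns the number of the pair. *)
Definition lo (i : 'I_h) : 'I_n := inord i.
Definition hi (i : 'I_h) : 'I_n := rev_ord (lo i).
Definition idx (v : 'I_n) : 'I_h := inord (if (v < h)%N then v : nat else rev_ord v).

Lemma val_lo i : lo i = i :> nat.
Proof. by rewrite /lo inordK //; have := ltn_ord i; lia. Qed.

Lemma lo_lt i : (lo i < h)%N. Proof. by rewrite val_lo. Qed.

Lemma hi_lt i : (hi i < h)%N = false.
Proof. by rewrite /hi /= val_lo; have := ltn_ord i; lia. Qed.

Lemma idx_lo i : idx (lo i) = i.
Proof. by apply: val_inj; rewrite /idx lo_lt /= inordK val_lo. Qed.

Lemma idx_hi i : idx (hi i) = i.
Proof. by apply: val_inj; rewrite /idx hi_lt rev_ordK /= inordK val_lo. Qed.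

Lemma lo_idx (v : 'I_n) : (v < h)%N -> lo (idx v) = v.
Proof. by move=> vh; apply: val_inj; rewrite /= val_lo /idx vh /= inordK. Qed.

Lemma hi_idx (v : 'I_n) : (v < h)%N = false -> hi (idx v) = v.
Proof.
move=> vh; rewrite /hi -[RHS]rev_ordK; congr rev_ord; apply: val_inj.
rewrite /= val_lo /idx vh inordK //=.
by have := ltn_ord v; lia.
Qed.

Lemma rev_lo i : rev_ord (lo i) = hi i. Proof. by []. Qed.
Lemma rev_hi i : rev_ord (hi i) = lo i. Proof. exact: rev_ordK. Qed.

Lemma big_lohi (R : comNzRingType) (f : 'I_n -> R) :
  \prod_v f v = \prod_(i < h) (f (lo i) * f (hi i)).
Proof.
rewrite big_split (bigID (fun v : 'I_n => (v < h)%N)) /=; congr (_ * _).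
  rewrite (reindex_onto lo idx) /=; last by move=> v; exact: lo_idx.
  by apply: eq_bigl => i; rewrite lo_lt idx_lo eqxx.
rewrite (reindex_onto hi idx) /=; last by move=> v /negbTE; exact: hi_idx.
by apply: eq_bigl => i; rewrite hi_lt idx_hi eqxx.
Qed.

Variable pi : {ffun 'I_h -> {perm 'I_m}}.

(** The second involution glues the half-edges at [lo i] to those at [hi i] along [pi i]. Invariance
    under it says that the colour words at the two vertices agree up to [pi i]. *)
Definition turn (x : dart) : dart :=
  (rev_ord x.1, if (x.1 < h)%N then pi (idx x.1) x.2 else (pi (idx x.1))^-1%g x.2).

Lemma turn_lo i a : turn (lo i, a) = (hi i, pi i a).
Proof. by rewrite /turn /= lo_lt idx_lo rev_lo. Qed.
Lemma turn_hi i a : turn (hi i, a) = (lo i, (pi i)^-1%g a).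
Proof. by rewrite /turn /= hi_lt idx_hi rev_hi. Qed.

Lemma dart_lohi (P : dart -> Prop) :
  (forall i a, P (lo i, a)) -> (forall i a, P (hi i, a)) -> forall x, P x.
Proof.
move=> Plo Phi [v a]; case: (boolP (v < h)%N) => vh; first by rewrite -(lo_idx vh).
by rewrite -(hi_idx (negbTE vh)).
Qed.

Lemma turnK : involutive turn.
Proof.
by apply: dart_lohi => i a; rewrite ?(turn_lo, turn_hi) ?(turn_lo, turn_hi) ?permK ?permKV.
Qed.

Lemma turn_neq x : turn x != x.
Proof.
move: x; apply: dart_lohi => i a; rewrite ?turn_lo ?turn_hi xpair_eqE.
  by apply/negP => /andP[/eqP e _]; have := lo_lt i; rewrite -e hi_lt.
by apply/negP => /andP[/eqP e _]; have := lo_lt i; rewrite e hi_lt.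
Qed.

Lemma invar_turn (C : eqType) (f : dart -> C) :
  invar f turn = [forall i, forall a, f (lo i, a) == f (hi i, pi i a)].
Proof.
apply/forallP/forallP => [H i|H x].
  by apply/forallP => a; have := H (lo i, a); rewrite turn_lo eq_sym.
move: x; apply: dart_lohi => i a.
  by rewrite turn_lo eq_sym; have /forallP := H i.
by rewrite turn_hi; have /forallP/(_ ((pi i)^-1%g a)) := H i; rewrite permKV.
Qed.

End Darts.

Section ColumnSigns.
Variable m : nat.
Implicit Types f g : 'I_m -> 'I_m.

(** The signature, extended by 0 to maps that are not injective, so that improper colourings vanish
    by themselves. *)
Definition fsgn f : int := \det (\matrix_(a, c) (f a == c)%:R).

(** One 0-1 matrix times the transpose of the other has the entries [f a == g b]; the left side is
    the expansion of its determinant. *)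
Lemma fsgn_mul f g :
  \sum_(s : {perm 'I_m}) (-1) ^+ s * \prod_a (f a == g (s a))%:R = fsgn f * fsgn g.
Proof.
rewrite /fsgn -[X in _ * X]det_tr -det_mulmx.
apply: eq_bigr => s _; congr (_ * _); apply: eq_bigr => a _; rewrite !mxE.
rewrite (bigD1 (g (s a))) //= !mxE eqxx mulr1 big1 ?addr0 // => c ne.
by rewrite !mxE [g _ == c]eq_sym (negPf ne) mulr0.
Qed.

Lemma fsgn0 f : ~~ injectiveb f -> fsgn f = 0.
Proof.
case/injectivePn => a [b ab fab]; apply: (determinant_alternate ab) => c.
by rewrite !mxE fab.
Qed.

Lemma fsgn_inj f : injective f -> fsgn f = bsign (@nat_of_ord m) (@nat_of_ord m) f.
Proof.
move=> fI; have -> : fsgn f = (-1) ^+ perm fI.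
  rewrite -det_perm /fsgn; congr (\det _); apply/matrixP => a b.
  by rewrite !mxE permE.
rewrite -(bsign_perm val_inj); apply: eq_pairprod; first exact: rk_tournament.
by move=> x y _ _ _; rewrite /flip !permE.
Qed.

End ColumnSigns.

Section TraceSum.
Variable k : nat.
Local Notation h := k.+1.
Local Notation m := (k.*2).+1.
Local Notation n := m.+1.
Local Notation dart := ('I_n * 'I_m)%type.

(* Multiplying the determinants of the vertices [lo i] and [hi i] and expanding
   the determinant of the product gives one permutation [pi i] per pair. *)
Definition trace_sum : int :=
  \sum_(pi : {ffun 'I_h -> {perm 'I_m}}) (\prod_i (-1) ^+ pi i) *
    #|[set f : {ffun dart -> 'I_m} | invar f (@dflip k) && invar f (turn pi)]|%:R.

Lemma prod_forall (I : finType) (P : pred I) :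
  \prod_i (P i)%:R = [forall i, P i]%:R :> int.
Proof.
case: (boolP [forall i, P i]) => [/forallP H|/forallPn[i /negPf Pi]].
  by rewrite big1 // => i _; rewrite H.
by rewrite (bigD1 i) //= Pi mul0r.
Qed.

Lemma trace_sum_columns : trace_sum =
  \sum_(f : {ffun dart -> 'I_m} | invar f (@dflip k)) \prod_v fsgn (fun a => f (v, a)).
Proof.
rewrite /trace_sum.
transitivity (\sum_(pi : {ffun 'I_h -> {perm 'I_m}})
  \sum_(f : {ffun dart -> 'I_m} | invar f (@dflip k))
    \prod_(i < h) ((-1) ^+ pi i * \prod_a (f (lo i, a) == f (hi i, pi i a))%:R) : int).
  apply: eq_bigr => pi _; rewrite -sum1dep_card natr_sum big_distrr /= big_mkcondr /=.
  apply: eq_bigr => f _; rewrite big_split /=.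
  under [X in _ = _ * X]eq_bigr do rewrite prod_forall.
  rewrite prod_forall invar_turn; case: ifP => //; last by rewrite mulr0.
rewrite exchange_big /=; apply: eq_bigr => f _.
rewrite big_lohi; under [in RHS]eq_bigr do rewrite -fsgn_mul.
by rewrite bigA_distr_bigA.
Qed.

Definition dcol (z : {ffun {set 'I_n} -> 'I_m}) : {ffun dart -> 'I_m} :=
  [ffun x => z [set x.1; lift x.1 x.2]].

Definition ecol (f : {ffun dart -> 'I_m}) : {ffun {set 'I_n} -> 'I_m} :=
  [ffun e => if [pick x : dart | e == [set x.1; lift x.1 x.2]] is Some x then f x else ord0].

Lemma dart_edge (x : dart) : [set x.1; lift x.1 x.2] \in complete 'I_n.
Proof. by rewrite inE cards2 neq_lift. Qed.

Lemma edge_dart (e : {set 'I_n}) : e \in complete 'I_n ->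
  exists x : dart, e = [set x.1; lift x.1 x.2].
Proof.
rewrite inE => /cards2P[v [w [vw ->]]]; have [a -> _] := unlift_some vw.
by exists (v, a).
Qed.

Lemma edge_dflip (x y : dart) : [set x.1; lift x.1 x.2] = [set y.1; lift y.1 y.2] ->
  x = y \/ x = dflip y.
Proof.
case/set2_eq=> -[e1 e2]; [left|right]; apply: dart_inj => //.
by rewrite lift_dflip e2.
Qed.

Lemma invar_dcol z : invar (dcol z) (@dflip k).
Proof. by apply/forallP => x; rewrite !ffunE lift_dflip /= setUC. Qed.

Lemma ecolK (f : {ffun dart -> 'I_m}) : invar f (@dflip k) -> dcol (ecol f) = f.
Proof.
move=> /forallP fF; apply/ffunP => x; rewrite !ffunE; case: pickP => [y /eqP|/(_ x)].
  by case/edge_dflip => [->//|->]; rewrite (eqP (fF y)).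
by rewrite eqxx.
Qed.

Lemma dcolK (z : {ffun {set 'I_n} -> 'I_m}) : z \in pffun_on ord0 (mem (complete 'I_n)) predT -> ecol (dcol z) = z.
Proof.
move=> /pffun_onP[/supportP z0 _]; apply/ffunP => e; rewrite ffunE.
case: pickP => [x /eqP ->|ne]; first by rewrite ffunE.
rewrite z0 //; apply/negP => /edge_dart[x ex].
by have := ne x; rewrite ex eqxx.
Qed.

Lemma ecol_supp (f : {ffun dart -> 'I_m}) : ecol f \in pffun_on ord0 (mem (complete 'I_n)) predT.
Proof.
apply/pffun_onP; split=> //; apply/supportP => e eK; rewrite ffunE.
by case: pickP => // x /eqP ex; case/negP: eK; rewrite ex; exact: dart_edge.
Qed.

Local Notation kn := (@nat_of_ord n).
Local Notation K := (complete 'I_n).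

Lemma edges_at_complete (v : 'I_n) : edges_at K v = [set [set v; lift v a] | a in [set: 'I_m]].
Proof.
apply/setP => e; apply/idP/imsetP => [|[a _ ->]]; last first.
  by rewrite inE set21 (dart_edge (v, a)).
rewrite !inE => /andP[/cards2P[x [y [xy ->]]] /set2P[] vE].
  by rewrite vE; have [a -> _] := unlift_some xy; exists a; rewrite ?inE.
rewrite vE eq_sym in xy *; have [a -> _] := unlift_some xy.
by exists a; rewrite ?inE // setUC.
Qed.

(** Compares, at each vertex, the order of the half-edges with the order [ekey] of the edges; the
    colouring does not enter. *)
Definition col_const : int := \prod_(v : 'I_n)
  pp [set: 'I_m] (fun a b => sg (@nat_of_ord m) a b *
                             sg (@ekey 'I_n) [set v; lift v a] [set v; lift v b]).

Lemma edge_inj (v : 'I_n) : injective (fun a : 'I_m => [set v; lift v a]).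
Proof.
move=> a b /set2_eq[[_ /lift_inj]|[e _]] //.
by have := neq_lift v b; rewrite -e eqxx.
Qed.

Lemma prod_fsgn_dcol z :
  \prod_v fsgn (fun a => dcol z (v, a)) = if properb K z then col_const * vsign K z else 0.
Proof.
case: ifPn => [pz|].
  rewrite /vsign -big_split; apply: eq_bigr => v _ /=.
  have zI : injective (fun a => dcol z (v, a)).
    move=> a b; rewrite !ffunE /= => E; apply: (@edge_inj v).
    by apply: (proper_at (v := v) pz) E; rewrite edges_at_complete; apply: imset_f; rewrite inE.
  rewrite fsgn_inj // edges_at_complete pp_imset.
  - rewrite -pairprodM; apply: eq_pairprod; first exact: rk_tournament.
    move=> a b _ _ _; rewrite /flip !ffunE /= -mulrA; congr (_ * _).
    by rewrite mulrA sg_sqr mul1r.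
  - by move=> a b _ _; exact: edge_inj.
  move=> a b _ _; case: (eqVneq a b) => [->//|ab].
  have zab : z [set v; lift v a] != z [set v; lift v b].
    by apply: contra ab => /eqP E; apply/eqP/zI; rewrite !ffunE.
  rewrite (sgN val_inj zab) (@sgN _ _ (@ekey_inj _) [set v; lift v a]) ?mulrNN //.
  by rewrite (inj_eq (@edge_inj v)).
case/forall_inPn => e eE /forall_inPn[f fE].
rewrite negb_imply negbK => /andP[/andP[ef nd] /eqP zef].
have e2 : #|e| = 2 by move: eE; rewrite inE => /eqP.
have f2 : #|f| = 2 by move: fE; rewrite inE => /eqP.
have [v ev] := meet2 e2 f2 ef nd.
have : v \in e :&: f by rewrite ev inE.
rewrite inE => /andP[ve vf].
have : e \in edges_at K v by rewrite inE eE.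
have : f \in edges_at K v by rewrite inE fE.
rewrite edges_at_complete => /imsetP[b _ fb] /imsetP[a _ ea].
rewrite (bigD1 v) //= fsgn0 ?mul0r //; apply/injectivePn.
exists a; exists b; last by rewrite !ffunE /= -ea -fb.
by apply: contra ef => /eqP ab; rewrite ea fb ab.
Qed.

(** An improper colouring has a repeated row in the determinant of some vertex. Proper ones carry
    [vsign], which [vsign_msign] turns into matching signs; the factorial counts the namings of the
    colours. *)
Lemma trace_sum_Ssum :
  trace_sum = col_const * dart_const kn K m * (m`!)%:R * Ssum kn K.
Proof.
have regK : regular K m by have := @regular_complete 'I_n; rewrite card_ord.
rewrite trace_sum_columns (reindex_onto dcol ecol) /=; last exact: ecolK.
rewrite (eq_bigl (fun z => z \in pffun_on ord0 (mem K) predT)); last first.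
  move=> z; rewrite invar_dcol /=; apply/eqP/idP => [<-|]; [exact: ecol_supp | exact: dcolK].
under eq_bigr do rewrite prod_fsgn_dcol.
rewrite -big_mkcondr /= -!mulrA -(sum_colorings kn ord0 (subxx K) regK).
rewrite !mulr_sumr; apply: eq_big => [z|z /andP[_ pz]]; first by rewrite [RHS]inE.
by rewrite (vsign_msign (@ord_inj n) (subxx K) regK pz) /dart_const -!mulrA.
Qed.

End TraceSum.

(** * Power sums modulo a prime, and a count of permutations *)

Section PrimeField.
Variable p : nat.
Hypothesis pP : prime p.
Local Notation K := 'F_p.

Lemma Fp_natr_eq0 a : ((a%:R : K) == 0) = (p %| a)%N.
Proof. by rewrite -(dvdn_pcharf (pchar_Fp pP)). Qed.

Lemma fact_neq0 a : (a < p)%N -> (a`!%:R : K) != 0.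
Proof.
rewrite Fp_natr_eq0; elim: a => [_|a IH ap]; first by rewrite dvdn1 gtn_eqF ?prime_gt1.
by rewrite factS Euclid_dvdM // negb_or gtnNdvd //= IH // ltnW.
Qed.

Lemma Fp_expr_order (x : K) : x != 0 -> x ^+ p.-1 = 1.
Proof.
move=> x0; have := expf_card x; rewrite card_Fp // => xp.
by apply: (mulfI x0); rewrite -exprS prednK ?prime_gt0 // xp mulr1.
Qed.

Lemma Fp_prim_root : exists g : K, p.-1.-primitive_root g.
Proof.
have p1 : (0 < p.-1)%N by rewrite -ltnS prednK ?prime_gt1 ?prime_gt0.
suff /hasP[g _ gP] : has p.-1.-primitive_root [seq x <- enum 'F_p | x != 0] by exists g.
apply: has_prim_root => //.
- apply/allP => x; rewrite mem_filter => /andP[x0 _].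
  by apply/unity_rootP; rewrite Fp_expr_order.
- by rewrite filter_uniq ?enum_uniq.
have -> : p.-1 = #|predC1 (0 : K)| by rewrite cardC1 card_Fp.
rewrite cardE; apply: uniq_leq_size; first exact: enum_uniq.
by move=> x; rewrite mem_enum mem_filter inE mem_enum => ->.
Qed.

(** Multiplication by a primitive root [g] permutes the residues and multiplies the sum by [g ^+ e],
    which is not 1. *)
Lemma power_sum0 e : ~~ (p.-1 %| e)%N -> \sum_(x : K) x ^+ e = 0.
Proof.
move=> ne; have [g gP] := Fp_prim_root.
have g0 : g != 0.
  apply/eqP => g0; have := prim_expr_order gP; rewrite g0 expr0n.
  by rewrite gtn_eqF ?(prim_order_gt0 gP) // => /eqP; rewrite eq_sym oner_eq0.
have ge : g ^+ e - 1 != 0 by rewrite subr_eq0 -(prim_order_dvd gP).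
apply: (mulfI ge); rewrite mulr0 mulrBl mul1r mulr_sumr.
under eq_bigr do rewrite -exprMn.
by rewrite [X in _ - X](reindex_inj (mulfI g0)) /= subrr.
Qed.

Lemma power_sum_zero : \sum_(x : K) x ^+ 0 = 0.
Proof.
rewrite sumr_const [X in _ *+ X](card_Fp pP); apply/eqP.
by rewrite Fp_natr_eq0.
Qed.

Lemma power_sum1 e : (0 < e)%N -> (p.-1 %| e)%N -> \sum_(x : K) x ^+ e = -1.
Proof.
move=> e0 /dvdnP[q eq]; rewrite (bigD1 0) //= expr0n gtn_eqF // add0r.
rewrite (eq_bigr (fun=> 1)) => [|x x0]; last by rewrite eq mulnC exprM Fp_expr_order // expr1n.
rewrite sumr_const (_ : #|_| = p.-1); last first.
  by have := cardC1 (0 : K); rewrite card_Fp // => <-; apply: eq_card => x; rewrite !inE.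
apply/eqP; rewrite -subr_eq0 opprK -mulrSr prednK ?prime_gt0 //.
by rewrite Fp_natr_eq0.
Qed.

Lemma power_sumE e : (0 < e < p.-1.*2)%N ->
  \sum_(x : K) x ^+ e = if e == p.-1 then -1 else 0.
Proof.
move=> /andP[e0 e2]; case: eqP => [->|ne].
  by apply: power_sum1 => //; rewrite -ltnS prednK ?prime_gt1 ?prime_gt0.
apply: power_sum0; apply/negP => /dvdnP[[|[|q]] eq]; first by rewrite eq in e0.
  by rewrite mul1n in eq.
by move: e2; rewrite eq -mul2n ltn_mul2r andbF.
Qed.

End PrimeField.

Section CountPerms.
Variable T : finType.
Implicit Types A B : {set T}.

Lemma exists_perm_image A B : #|A| = #|B| -> exists s : {perm T}, s @: A = B.
Proof.
move=> AB; have AB' : #|~: A| = #|~: B| by rewrite [LHS]cardsCs [RHS]cardsCs !setCK AB.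
pose f x := if x \in A then nth x (enum B) (index x (enum A))
            else nth x (enum (~: B)) (index x (enum (~: A))).
have fA x : x \in A -> f x \in B.
  by move=> xA; rewrite /f xA -mem_enum mem_nth // -cardE -AB cardE index_mem mem_enum.
have fA' x : x \notin A -> f x \in ~: B.
  move=> xA; rewrite /f (negPf xA) -mem_enum mem_nth // -cardE -AB' cardE index_mem.
  by rewrite mem_enum inE.
have fI : injective f.
  move=> x y; case: (boolP (x \in A)) (boolP (y \in A)) => xA [] yA E.
  - move: E; rewrite /f xA yA => E.
    have ix : (index x (enum A) < size (enum B))%N by rewrite -cardE -AB cardE index_mem mem_enum.
    have iy : (index y (enum A) < size (enum B))%N by rewrite -cardE -AB cardE index_mem mem_enum.
    move: E; rewrite (set_nth_default y x ix) => /eqP.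
    rewrite nth_uniq ?enum_uniq // => /eqP /(index_inj x); apply; by rewrite mem_enum.
  - by have := fA' _ yA; rewrite -E inE fA.
  - by have := fA' _ xA; rewrite E inE fA.
  - move: E; rewrite /f (negPf xA) (negPf yA) => E.
    have ix : (index x (enum (~: A)) < size (enum (~: B)))%N.
      by rewrite -cardE -AB' cardE index_mem mem_enum inE.
    have iy : (index y (enum (~: A)) < size (enum (~: B)))%N.
      by rewrite -cardE -AB' cardE index_mem mem_enum inE.
    move: E; rewrite (set_nth_default y x ix) => /eqP.
    rewrite nth_uniq ?enum_uniq // => /eqP /(index_inj x); apply; by rewrite mem_enum inE.
exists (perm fI); apply/eqP; rewrite eqEcard card_imset ?AB ?leqnn ?andbT; last exact: perm_inj.
by apply/subsetP => _ /imsetP[x xA ->]; rewrite permE fA.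
Qed.

(** All sets of the size of [A] are images of [A] under equally many permutations, so the number is
    a factorial divided by a binomial coefficient. *)
Lemma card_perm_image A B :
  #|[set s : {perm T} | s @: A == B]| = if #|A| == #|B| then ((#|A|)`! * (#|T| - #|A|)`!)%N else 0%N.
Proof.
case: eqP => [AB|AB]; last first.
  apply: eq_card0 => s; rewrite inE; apply/eqP => sAB; case: AB.
  by rewrite -sAB card_imset //; exact: perm_inj.
pose N B' := #|[set s : {perm T} | s @: A == B']|.
have imM (s t : {perm T}) (C : {set T}) : (s * t)%g @: C = t @: (s @: C).
  by rewrite -imset_comp; apply: eq_imset => x; rewrite /= permM.
have NE B' : #|B'| == #|A| -> N B' = N B.
  rewrite AB => /eqP B'B; have [t tB] := exists_perm_image (esym B'B); rewrite /N.
  have -> : [set s : {perm T} | s @: A == B'] = [set (s * t)%g | s in [set s : {perm T} | s @: A == B]].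
    apply/setP => s; rewrite inE; apply/eqP/imsetP => [sA|[u + ->]].
      exists (s * t^-1)%g; rewrite ?mulgKV // inE imM sA -tB -imM mulgV.
      by apply/eqP/setP => x; rewrite -[RHS](mem_imset _ _ (@perm_inj _ 1%g)) perm1.
    by rewrite inE imM => /eqP ->.
  by rewrite (card_imset _ (mulIg t)).
have : (N B * 'C(#|T|, #|A|) = (#|T|)`!)%N.
  rewrite -card_draws mulnC -sum_nat_const.
  rewrite (eq_bigr N) => [|B']; last by rewrite inE => /NE ->.
  transitivity (\sum_(s : {perm T}) 1)%N; last first.
    rewrite sum1_card -cardsT -card_perm; apply: eq_card => s.
    have -> : s \in perm_on [set: T] by apply/subsetP => x; rewrite inE.
    by [].
  rewrite [RHS](partition_big (fun s : {perm T} => s @: A) (fun B' => B' \in [set C : {set T} | #|C| == #|A|])) /=.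
    by apply: eq_bigr => B' _; rewrite /N -sum1dep_card.
  by move=> s _; rewrite inE card_imset //; exact: perm_inj.
have Al : (#|A| <= #|T|)%N by exact: max_card.
rewrite -(bin_fact Al) mulnC => /eqP; rewrite eqn_pmul2l ?bin_gt0 // => /eqP <-.
by [].
Qed.

End CountPerms.

(** * From alternating orientations to out-degrees *)

Section Alternating.
Variable k : nat.
Local Notation h := k.+1.
Local Notation m := (k.*2).+1.
Local Notation n := m.+1.
Local Notation dart := ('I_n * 'I_m)%type.
Local Notation F := (@dflip k).
Local Notation kn := (@nat_of_ord n).
Implicit Types (pi : {ffun 'I_h -> {perm 'I_m}}) (o : {ffun dart -> bool}).

Lemma lo_lt_hi (i : 'I_h) : (lo i < hi i)%N.
Proof. by rewrite /= val_lo; have := ltn_ord i; lia. Qed.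

Lemma lo_neq_hi (i : 'I_h) : lo i != hi i.
Proof. by rewrite -(inj_eq (@ord_inj n)) ltn_eqF ?lo_lt_hi. Qed.

Definition dkey (x : dart) : nat := (x.1 * m + x.2)%N.

Lemma dkey_inj : injective dkey.
Proof.
move=> [v a] [w b]; rewrite /dkey /= => E.
have m0 : (0 < m)%N by [].
have e1 : v = w :> nat.
  by have := congr1 (divn^~ m) E; rewrite !divnMDl // !divn_small ?addn0.
have e2 : a = b :> nat by move: E; rewrite e1 => /addnI.
by congr (_, _); apply: ord_inj.
Qed.

Lemma sg_dkey (x y : dart) : x.1 != y.1 -> sg dkey x y = sg kn x.1 y.1.
Proof.
move=> ne; have lt (u w : dart) : (u.1 < w.1)%N -> (dkey u < dkey w)%N.
  move=> uw; rewrite /dkey; apply: (@leq_trans (u.1 * m + m)); first by rewrite ltn_add2l.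
  by rewrite -mulSnr; apply: leq_trans (leq_addr _ _); rewrite leq_mul2r uw orbT.
rewrite /sg; case: (ltngtP x.1 y.1) => [/lt -> //|/lt|/ord_inj e]; last by rewrite e eqxx in ne.
by move=> h1; rewrite ltnNge (ltnW h1).
Qed.

(** Relabels the half-edges at upper vertices so that gluing along identities becomes gluing along
    [pi]; this isolates the dependence of [msign_turn] on [pi]. *)
Definition upper pi (x : dart) : dart :=
  if (x.1 < h)%N then x else (x.1, pi (idx x.1) x.2).

Lemma upper_lo pi i a : upper pi (lo i, a) = (lo i, a).
Proof. by rewrite /upper lo_lt. Qed.
Lemma upper_hi pi i a : upper pi (hi i, a) = (hi i, pi i a).
Proof. by rewrite /upper hi_lt idx_hi. Qed.

Lemma upper_fst pi x : (upper pi x).1 = x.1.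
Proof. by rewrite /upper; case: ifP. Qed.

Lemma upper_inj pi : injective (upper pi).
Proof.
move=> [v a] [w b] E; have vw : v = w by have := congr1 fst E; rewrite !upper_fst.
by move: E; rewrite -vw /upper /=; case: ifP => _ // [] /perm_inj ->.
Qed.

Lemma upper_turn pi x : upper pi (turn [ffun=> 1%g] x) = turn pi (upper pi x).
Proof.
move: x; apply: dart_lohi => i a.
  by rewrite upper_lo !turn_lo upper_hi ffunE perm1.
by rewrite upper_hi !turn_hi upper_lo permK ffunE invg1 perm1.
Qed.

Lemma upper_pairing pi : im2 (upper pi) (pairing (turn [ffun=> 1%g])) = pairing (turn pi).
Proof.
have [g gK Kg] := injF_bij (@upper_inj pi).
have imE x : upper pi @: [set x; turn [ffun=> 1%g] x] = [set upper pi x; turn pi (upper pi x)].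
  by rewrite imsetU1 imset_set1 upper_turn.
apply/setP => e; apply/imsetP/imsetP => [[_ /imsetP[x _ ->] ->]|[x _ ->]].
  by exists (upper pi x); rewrite ?imE.
exists [set g x; turn [ffun=> 1%g] (g x)]; first exact: imset_f.
by rewrite imE Kg.
Qed.

Lemma anti_lower pi : anti (fun x : dart => (x.1 < h)%N) (turn pi).
Proof.
by apply/forallP; apply: dart_lohi => i a; rewrite ?turn_lo ?turn_hi /= hi_lt lo_lt.
Qed.

Lemma bsign_upper pi : bsign dkey dkey (upper pi) = \prod_i (-1) ^+ pi i.
Proof.
have fC x y : flip dkey dkey (upper pi) x y = flip dkey dkey (upper pi) y x.
  exact: (flipC dkey_inj dkey_inj (@upper_inj pi)).
rewrite /bsign (pp_fib fst) /=; last by move=> x y _ _; exact: fC.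
rewrite [X in _ * X]pairprod1 ?mulr1; first last.
- move=> v w _ _ vw; rewrite big1 // => x /andP[_ /eqP xv]; rewrite big1 // => y /andP[_ /eqP yw].
  by rewrite /flip !sg_dkey ?upper_fst ?xv ?yw // sg_sqr.
- exact: rk_tournament.
have fibE v : pp [set x in [set: dart] | x.1 == v] (flip dkey dkey (upper pi)) =
    pp [set: 'I_m] (fun a b => flip dkey dkey (upper pi) (v, a) (v, b)).
  have -> : [set x in [set: dart] | x.1 == v] = [set (v, a) | a in [set: 'I_m]].
    apply/setP => -[w a]; rewrite !inE /=; apply/eqP/imsetP => [->|[b _ [-> _]]//].
    by exists a; rewrite ?inE.
  by rewrite pp_imset // => a b _ _ [].
have same v a b : sg dkey (v, a) (v, b) = sg (@nat_of_ord m) a b.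
  by rewrite /sg /dkey /= ltn_add2l.
rewrite big_lohi; apply: eq_bigr => i _; rewrite !fibE.
rewrite pairprod1; first last.
- by move=> a b _ _ _; rewrite /flip !upper_lo sg_sqr.
- exact: rk_tournament.
rewrite mul1r -(bsign_perm (@ord_inj m)); apply: eq_pairprod; first exact: rk_tournament.
by move=> a b _ _ _; rewrite /flip !upper_hi !same.
Qed.

Lemma msign_turn pi : msign dkey (pairing (turn pi)) =
  msign dkey (pairing (turn [ffun=> 1%g])) * \prod_i (-1) ^+ pi i.
Proof.
rewrite -upper_pairing (msign_relabel dkey_inj dkey_inj (@upper_inj pi)
  (partition_pairing (turnK _)) (even_pairs_pairing (@turn_neq _ _))).
rewrite bsign_upper (big_pairing (turnK _) _ (anti_lower _)) [X in _ * X = _]big1 ?mulr1 //.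
move=> x xl; rewrite pp_set2 1?eq_sym ?turn_neq //; last first.
  exact: (flipC dkey_inj dkey_inj (@upper_inj pi)).
have lt (y : dart) : (y.1 < h)%N -> (y.1 < (turn [ffun=> 1%g] y).1)%N.
  by move: y; apply: dart_lohi => i a; rewrite ?hi_lt // turn_lo /= val_lo; have := ltn_ord i; lia.
have ne (y : dart) : (y.1 < (turn [ffun=> 1%g] y).1)%N -> y.1 != (turn [ffun=> 1%g] y).1.
  by move=> yl; apply: contraTneq yl => <-; rewrite ltnn.
rewrite /flip !sg_dkey ?upper_fst ?ne ?lt //.
by rewrite sg_sqr.
Qed.

(** The direction signs of [swapperm_sign]. A step of [turn] goes up from a lower vertex and down
    from an upper one whatever [pi] is, so [pi] has disappeared. *)
Definition orient_weight o : int :=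
  (\prod_(x | o x) sg kn x.1 (lift x.1 x.2)) *
  \prod_(x | ~~ o x) (if (x.1 < h)%N then 1 else -1).

Definition pairing_const : int :=
  msign dkey (pairing (turn [ffun=> 1%g])) * msign dkey (pairing F).

Lemma pairing_const_sqr : pairing_const * pairing_const = 1.
Proof. by rewrite /pairing_const mulrACA !msign_sqr. Qed.

(** The signature of [pi] carried by each term of [trace_sum] occurs again in [msign_turn]. The two
    cancel, and the sum over [pi] becomes a plain count. *)
Lemma swapperm_turn pi o : anti o F -> anti o (turn pi) ->
  (\prod_i (-1) ^+ pi i) * (-1) ^+ swapperm F (turn pi) o = pairing_const * orient_weight o :> int.
Proof.
move=> oF oT; rewrite (swapperm_sign (@dflipK k) (turnK pi) (@dflip_neq k) dkey_inj oF oT).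
rewrite msign_turn /orient_weight /pairing_const.
have -> : \prod_(x | o x) sg dkey x (F x) = \prod_(x | o x) sg kn x.1 (lift x.1 x.2).
  by apply: eq_bigr => x _; rewrite sg_dkey // neq_lift.
have -> : \prod_(x | ~~ o x) sg dkey x (turn pi x) =
          \prod_(x : dart | ~~ o x) (if (x.1 < h)%N then 1 else -1).
  apply: eq_bigr; apply: dart_lohi => i a _.
    by rewrite turn_lo sg_dkey /= ?lo_neq_hi // lo_lt /sg lo_lt_hi.
  rewrite turn_hi sg_dkey /= 1?eq_sym ?lo_neq_hi // hi_lt /sg.
  by rewrite ltnNge ltnW ?lo_lt_hi.
set P := \prod_i _; set A := msign _ _; set B := msign _ _; set X := bigop _ _ _; set Y := bigop _ _ _.
have PP : P * P = 1.
  by rewrite /P -big_split big1 //= => i _; rewrite -signr_addb addbb.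
transitivity ((P * P) * (A * B * (X * Y))); first by ring.
by rewrite PP mul1r.
Qed.

Definition out o (v : 'I_n) := #|[set a | o (v, a)]|.

(** With out-degrees [a] at [lo i] and [b] at [hi i], [pi i] must map the [m - a] incoming
    half-edges onto the [b] outgoing ones: this forces [a + b = m] and leaves [a! b!] choices. The
    sign comes from the [m - b = a] incoming half-edges at [hi i]. *)
Definition fact_form (a b : nat) : int :=
  if (a + b == m)%N then (-1) ^+ a * (a`! * b`!)%:R else 0.

Lemma anti_turn pi o : anti o (turn pi) =
  [forall i, pi i @: [set a | ~~ o (lo i, a)] == [set a | o (hi i, a)]].
Proof.
apply/forallP/forallP => [H i|H].
  apply/eqP/setP => b; rewrite inE; have /eqP := H (hi i, b); rewrite turn_hi => E.
  by rewrite -[o _]negbK -E -[b in LHS](permKV (pi i)) mem_imset ?inE //; exact: perm_inj.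
apply: dart_lohi => i a.
  have /eqP/setP/(_ (pi i a)) := H i.
  rewrite turn_lo (mem_imset _ _ (@perm_inj _ (pi i))) !inE => <-.
  by [].
have /eqP/setP/(_ a) := H i; rewrite turn_hi -[a in X in X = _](permKV (pi i)).
rewrite (mem_imset _ _ (@perm_inj _ (pi i))) !inE => <-.
by rewrite negbK.
Qed.

Lemma sum_turns o : orient_weight o *
  \sum_(pi | anti o (turn pi)) 1 =
  (\prod_(x | o x) sg kn x.1 (lift x.1 x.2)) *
  \prod_(i < h) fact_form (out o (lo i)) (out o (hi i)).
Proof.
rewrite /orient_weight -mulrA; congr (_ * _).
have -> : \sum_(pi | anti o (turn pi)) 1 = \prod_(i < h)
   (#|[set s : {perm 'I_m} | s @: [set a | ~~ o (lo i, a)] == [set a | o (hi i, a)]]|%:R : int).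
  rewrite big_mkcond /= (eq_bigr (fun pi => \prod_(i < h)
    ((pi i @: [set a | ~~ o (lo i, a)] == [set a | o (hi i, a)])%:R : int))); last first.
    by move=> pi _; rewrite anti_turn prod_forall; case: ifP.
  rewrite -(bigA_distr_bigA (fun i (s : {perm 'I_m}) =>
    ((s @: [set a | ~~ o (lo i, a)] == [set a | o (hi i, a)])%:R : int))).
  apply: eq_bigr => i _; rewrite -sum1dep_card natr_sum [RHS]big_mkcond /=.
  by apply: eq_bigr => s _; case: ifP.
have -> : \prod_(x : dart | ~~ o x) (if (x.1 < h)%N then 1 else -1) =
   \prod_(i < h) ((-1) ^+ #|[set a | ~~ o (hi i, a)]| : int).
  rewrite big_mkcond /= (eq_bigr (fun x : dart => (fun v a =>
    if ~~ o (v, a) then (if (v < h)%N then 1 else -1) else 1) x.1 x.2 : int)); last by case.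
  rewrite -(pair_bigA _ (fun v a =>
    if ~~ o (v, a) then (if (v < h)%N then 1 else -1) else 1 : int)) /= big_lohi.
  apply: eq_bigr => i _; rewrite big1 ?mul1r => [|a _]; last by rewrite lo_lt if_same.
  rewrite hi_lt -big_mkcond /= -prodr_const; apply: eq_bigl => a.
  by rewrite inE.
rewrite -big_split; apply: eq_bigr => i _ /=.
rewrite card_perm_image /fact_form card_ord.
have ol v : (out o v <= m)%N by rewrite (leq_trans (max_card _)) // card_ord.
have co v : #|[set a | ~~ o (v, a)]| = (m - out o v)%N.
  have := cardsC [set a | o (v, a)]; rewrite card_ord -/(out o v).
  rewrite (_ : ~: [set a | o (v, a)] = [set a | ~~ o (v, a)]).
    by move=> E; have := ol v; lia.
  by apply/setP => a; rewrite !inE.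
rewrite !co -/(out o (hi i)); have l1 := ol (lo i); have l2 := ol (hi i).
case: eqP => [e1|e1]; case: eqP => [e2|e2]; rewrite ?mulr0n ?mulr0 //; try by exfalso; lia.
rewrite [((out _ _)`! * _)%N]mulnC.
by congr (_ ^+ _ * (_ * _)%:R); [lia | congr (_`!); lia | congr (_`!); lia].
Qed.

End Alternating.

(** * Evaluation modulo [p = n + 1] *)

Section FpEvaluation.
Variable k : nat.
Local Notation h := k.+1.
Local Notation m := (k.*2).+1.
Local Notation n := m.+1.
Local Notation p := n.+1.
Local Notation dart := ('I_n * 'I_m)%type.
Local Notation F := (@dflip k).
Local Notation kn := (@nat_of_ord n).
Local Notation K := 'F_p.
Hypothesis pP : prime p.

Lemma trace_sum_orient : (trace_sum k)%:~R = (pairing_const k)%:~R *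
  \sum_(o : {ffun dart -> bool} | anti o F)
    (\prod_(x | o x) sg kn x.1 (lift x.1 x.2))%:~R *
    (\prod_(i < h) fact_form k (out o (lo i)) (out o (hi i)))%:~R :> K.
Proof.
have even_dart : ~~ odd #|{: dart}| by rewrite card_prod !card_ord oddM /= negbK odd_double.
have card_m : #|'I_m|%:R = -1 * 2%:R :> K.
  rewrite card_ord mulN1r; apply/eqP; rewrite -addr_eq0 -natrD.
  by rewrite Fp_natr_eq0 // addn2.
rewrite /trace_sum rmorph_sum /=.
under eq_bigr => pi _ do rewrite rmorphM /= rmorph_nat
  (invariant_vs_alternating (@dflipK k) (turnK pi) (@dflip_neq k) (@turn_neq k pi)
     even_dart card_m) mulr_sumr.
rewrite (exchange_big_dep (fun o : {ffun dart -> bool} => anti o F)) /=; last first.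
  by move=> pi o _ /andP[].
rewrite mulr_sumr; apply: eq_bigr => o oF.
rewrite -!rmorphM /= -sum_turns mulrA; set W := pairing_const k * _.
rewrite rmorphM rmorph_sum /= mulr_sumr.
apply: eq_big => [pi|pi /andP[_ oT]]; first by rewrite oF.
by rewrite mulr1 /W -(swapperm_turn oF oT) rmorphM /= [X in _ = _ * X]rmorphXn /= rmorphN1.
Qed.

(** A function whose moments of exponents at most [m] are the values of [fact_form]. Since
    [n = p - 1], the power sum of exponent [a + (n - c)] is -1 for [c = a] and 0 otherwise, and the
    two signs cancel. It turns a factor in the out-degrees into a combination of monomials, to which
    Vandermonde applies. *)
Definition kernel (q : K * K) : K :=
  \sum_(a < n) (fact_form k a (m - a))%:~R * (q.1 ^+ (n - a) * q.2 ^+ (n - (m - a))).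

Lemma kernel_moment a b : (a <= m)%N -> (b <= m)%N ->
  \sum_(q : K * K) q.1 ^+ a * q.2 ^+ b * kernel q = (fact_form k a b)%:~R.
Proof.
move=> am bm; rewrite /kernel.
under eq_bigr => q _ do rewrite mulr_sumr.
rewrite exchange_big /=.
have psum a' (c : 'I_n) : (a' <= m)%N ->
    \sum_(z : K) z ^+ (a' + (n - c)) = if a' == c :> nat then -1 else 0.
  move=> a'm; rewrite power_sumE //; last by have := ltn_ord c; rewrite -/n /=; lia.
  have := ltn_ord c; case: (a' =P c :> nat) => [->|ne] cn; first by rewrite subnKC ?eqxx // ltnW.
  by rewrite [X in if X then _ else _](_ : _ = false) //; apply/eqP => /= e; lia.
have E (c : 'I_n) : \sum_(q : K * K) q.1 ^+ a * q.2 ^+ b *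
      ((fact_form k c (m - c))%:~R * (q.1 ^+ (n - c) * q.2 ^+ (n - (m - c)))) =
      (fact_form k c (m - c))%:~R * ((\sum_(z : K) z ^+ (a + (n - c))) *
        \sum_(w : K) w ^+ (b + (n - (m - c)))).
  rewrite big_distrlr /= pair_big mulr_sumr; apply: eq_bigr => q _ /=.
  by rewrite !exprD; ring.
under eq_bigr => c _ do rewrite E psum //.
rewrite (bigD1 (inord a)) //= inordK ?ltnS // eqxx [X in _ + X = _]big1 ?addr0; last first.
  move=> c ca; case: eqP => [ac|]; last by rewrite mul0r mulr0.
  by case/eqP: ca; apply: ord_inj; rewrite inordK ?ltnS.
have -> : (m - a = @inord m (m - a))%N by rewrite inordK // ltnS leq_subr.
rewrite psum // inordK ?ltnS ?leq_subr //.
rewrite /fact_form subnKC // eqxx.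
have -> : (a + b == m)%N = (b == m - a)%N by apply/eqP/eqP; lia.
by case: eqP => [->|]; rewrite ?mulrNN ?mulr1 // !mulr0.
Qed.

Definition point (y : {ffun 'I_h -> K * K}) (v : 'I_n) : K :=
  if (v < h)%N then (y (idx v)).1 else (y (idx v)).2.

Lemma prod_fact_form (e : 'I_n -> nat) : (forall v, e v <= m)%N ->
  (\prod_(i < h) fact_form k (e (lo i)) (e (hi i)))%:~R =
  \sum_(y : {ffun 'I_h -> K * K}) (\prod_i kernel (y i)) * \prod_v point y v ^+ e v :> K.
Proof.
move=> em; rewrite rmorph_prod /=.
under eq_bigr => i _ do rewrite -kernel_moment //.
rewrite bigA_distr_bigA /=; apply: eq_bigr => y _.
rewrite big_lohi -big_split; apply: eq_bigr => i _ /=.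
by rewrite /point lo_lt hi_lt idx_lo idx_hi mulrC.
Qed.

Definition ascending := [set x : dart | (x.1 < lift x.1 x.2)%N].

Lemma ascending_flip x : (F x \in ascending) = (x \notin ascending).
Proof.
rewrite !inE lift_dflip -leqNgt -[(F x).1]/(lift x.1 x.2) [RHS]leq_eqVlt (inj_eq (@ord_inj n)).
by rewrite [lift _ _ == _]eq_sym (negPf (neq_lift _ _)).
Qed.

(* Expanding the factors of the Vandermonde product orients the edges. *)
Lemma sum_tournaments (z : 'I_n -> K) :
  \sum_(o : {ffun dart -> bool} | anti o F)
    (\prod_(x | o x) sg kn x.1 (lift x.1 x.2))%:~R * \prod_v z v ^+ out o v =
  (-1) ^+ #|ascending| * \sum_(s : 'S_n) (-1) ^+ s * \prod_v z v ^+ s v.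
Proof.
transitivity (\prod_(x in ascending) (z x.1 - z (lift x.1 x.2))).
  transitivity (\sum_(o : {ffun dart -> bool} | anti o F)
     \prod_(x | o x) ((sg kn x.1 (lift x.1 x.2))%:~R * z x.1)).
    apply: eq_bigr => o _; rewrite big_split /= rmorph_prod; congr (_ * _).
    transitivity (\prod_v \prod_(a | o (v, a)) z v).
      2: by rewrite pair_big_dep /=; apply: eq_big => -[v a].
    by apply: eq_bigr => v _; rewrite prodr_const; congr (_ ^+ _); apply: eq_card => a; rewrite inE.
  rewrite (sum_anti _ (@dflipK k) ascending_flip); apply: eq_bigr => x; rewrite inE => xl.
  rewrite lift_dflip /sg xl /= ltnNge (ltnW xl) /=.
  by rewrite mul1r rmorphN1 mulN1r.
rewrite (eq_bigr (fun x : dart => - (z (lift x.1 x.2) - z x.1))) => [|x _]; last by rewrite opprB.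
rewrite prodrN; congr (_ * _).
transitivity (\det (Vandermonde n (\row_j z j))).
  rewrite det_Vandermonde pair_big_dep /=.
  rewrite (reindex_onto (fun x : dart => (x.1, lift x.1 x.2))
     (fun u : 'I_n * 'I_n => (u.1, odflt ord0 (unlift u.1 u.2)))) /=; last first.
    move=> [i j] /= ij; congr (_, _).
    by case: unliftP => [a ->|e] //=; rewrite e ltnn in ij.
  apply: eq_big => [[v a]|x _]; last by rewrite !mxE.
  by rewrite inE /= liftK /= eqxx andbT.
rewrite -det_tr; apply: eq_bigr => s _; congr (_ * _).
by apply: eq_bigr => v _; rewrite !mxE.
Qed.

(** The permutations for which every factor [fact_form] survives, namely [s (lo i) + s (hi i) = m]
    for all [i]. Seen as a centralizer they form a group. *)
Definition comm_rev : {set 'S_n} := [set s : 'S_n | [forall v, s (rev_ord v) == rev_ord (s v)]].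

(** Write the factors in the out-degrees as moments, apply Vandermonde under the sum over the
    points, and read the moments backwards: the out-degrees have been replaced by the values of a
    permutation. *)
Lemma trace_sum_perms : (trace_sum k)%:~R =
  (pairing_const k)%:~R * (-1) ^+ #|ascending| *
  (\sum_(s : 'S_n) (-1) ^+ s * \prod_(i < h) fact_form k (s (lo i)) (s (hi i)))%:~R :> K.
Proof.
rewrite trace_sum_orient -mulrA; congr (_ * _).
have outm (o : {ffun dart -> bool}) v : (out o v <= m)%N by rewrite (leq_trans (max_card _)) // card_ord.
under eq_bigr => o _ do rewrite (prod_fact_form (outm o)) mulr_sumr.
rewrite exchange_big /=.
under eq_bigr => y _.
  under eq_bigr => o _ do rewrite mulrCA.
  rewrite -mulr_sumr sum_tournaments; over.
rewrite rmorph_sum /= mulr_sumr.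
under [RHS]eq_bigr => s _.
  rewrite rmorphM /= (prod_fact_form (e := fun v => s v)); last by move=> v; rewrite -ltnS.
  rewrite rmorphXn /= rmorphN1 !mulr_sumr; over.
rewrite exchange_big /=; apply: eq_bigr => y _.
rewrite mulrCA !mulr_sumr; apply: eq_bigr => s _.
by congr (_ * _); rewrite mulrCA.
Qed.

Definition half_sign (e : {set 'I_n}) : int := \prod_(a in e | (a < h)%N) (-1) ^+ a.

Lemma rev_neq (v : 'I_n) : rev_ord v != v.
Proof. by rewrite -(inj_eq (@ord_inj n)) /=; apply/eqP; have := ltn_ord v; lia. Qed.

Lemma anti_half : anti (fun v : 'I_n => (v < h)%N) (@rev_ord n).
Proof. by apply/forallP => v /=; rewrite -leqNgt; apply/eqP; have := ltn_ord v; lia. Qed.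

Lemma half_signE (v : 'I_n) : half_sign [set v; rev_ord v] =
  (if (v < h)%N then 1 else -1) * (-1) ^+ v.
Proof.
have bigE (a b : 'I_n) : (a < h)%N -> (b < h)%N = false -> half_sign [set a; b] = (-1) ^+ a.
  move=> ah bh; rewrite /half_sign (big_pred1 a) // => c; rewrite !inE.
  by case: eqP => [->|_]; rewrite ?ah //=; case: eqP => [->|]; rewrite ?bh.
have /eqP rv := forallP anti_half v; case: ifP rv => vh rv; first by rewrite bigE // mul1r.
rewrite setUC bigE // /= subSS mulN1r -signr_odd oddB; last by have := ltn_ord v.
rewrite -[in RHS]signr_odd /= odd_double /=.
by case: (odd v); rewrite ?opprK.
Qed.

Lemma comm_rev_group : group_set comm_rev.
Proof.
apply/group_setP; split; first by rewrite inE; apply/forallP => v; rewrite !perm1.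
move=> s t; rewrite !inE => /forallP sr /forallP tr; apply/forallP => v.
by rewrite !permM (eqP (sr v)) (eqP (tr _)).
Qed.

(** [s] permutes the blocks of the reversal, so by [msign_relabel] its signature counts the blocks
    that it turns over. As [n - 1] is odd, [(-1) ^+ s v] also changes when a block is turned over;
    together the two signs depend only on the image block. *)
Lemma comm_rev_sign (s : 'S_n) : s \in comm_rev ->
  (-1) ^+ s * \prod_(v : 'I_n | (v < h)%N) (-1) ^+ s v =
  \prod_(e in pairing (@rev_ord n)) half_sign e :> int.
Proof.
rewrite inE => /forallP sr.
have im v : s @: [set v; rev_ord v] = [set s v; rev_ord (s v)].
  by rewrite imsetU1 imset_set1 (eqP (sr v)).
have imM : im2 s (pairing (@rev_ord n)) = pairing (@rev_ord n).
  apply/eqP; rewrite eqEcard (card_imset _ (imset_inj (@perm_inj _ s))) leqnn andbT.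
  by apply/subsetP => _ /imsetP[_ /imsetP[v _ ->] ->]; rewrite im; exact: imset_f.
have := msign_relabel (@ord_inj n) (@ord_inj n) (@perm_inj _ s)
  (partition_pairing (@rev_ordK n)) (even_pairs_pairing rev_neq).
rewrite -/(im2 s _) imM (big_pairing (@rev_ordK n) _ anti_half).
rewrite (bsign_perm (@ord_inj n)).
set M := msign _ _; set P := \prod_(x | _) _ => E.
have MM : M * M = 1 by exact: msign_sqr.
have sP : (-1) ^+ s * P = 1.
  transitivity (M * M * ((-1) ^+ s * P)); first by rewrite MM mul1r.
  by rewrite -mulrA (mulrA M ((-1) ^+ s) P) -E MM.
have sE : (-1) ^+ s = P.
  by rewrite -[LHS]mulr1 -[X in _ * X]sP mulrA -signr_addb addbb mul1r.
rewrite sE /P -big_split /=.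
transitivity (\prod_(v : 'I_n | (v < h)%N) half_sign (s @: [set v; rev_ord v])); last first.
  rewrite -(big_pairing (@rev_ordK n) (fun e => half_sign (s @: e)) anti_half).
  have big_im M' : \prod_(e in im2 s M') half_sign e = \prod_(e in M') half_sign (s @: e).
    by rewrite /im2 big_imset //= => e f _ _; apply: imset_inj; exact: perm_inj.
  by rewrite -[in RHS]imM big_im.
apply: eq_bigr => v vh; rewrite im half_signE; congr (_ * _).
rewrite pp_set2 1?eq_sym ?rev_neq //; last first.
  exact: (flipC (@ord_inj n) (@ord_inj n) (@perm_inj _ s)).
rewrite /flip (eqP (sr v)) /sg.
have ltr (w : 'I_n) : (w < rev_ord w)%N = (w < h)%N.
  by rewrite /=; have := ltn_ord w; case: (ltnP w h) => ? ?; apply/idP; lia.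
by rewrite !ltr vh mul1r.
Qed.

Lemma trace_sum_neq0 : (trace_sum k)%:~R != 0 :> K.
Proof.
pose c := \prod_(e in pairing (@rev_ord n)) half_sign e.
have prod_half (s : 'S_n) : \prod_(v : 'I_n | (v < h)%N) (-1) ^+ s v =
    \prod_(i < h) (-1) ^+ s (lo i) :> int.
  rewrite big_mkcond big_lohi; apply: eq_bigr => i _.
  by rewrite lo_lt hi_lt mulr1.
have -> : (trace_sum k)%:~R = (pairing_const k)%:~R * (-1) ^+ #|ascending| *
   (c * (\prod_(v : 'I_n) v`!)%:R * #|comm_rev|%:R)%:~R :> K.
  rewrite trace_sum_perms; congr (_ * _%:~R).
  rewrite (bigID (mem comm_rev)) /= [X in _ + X]big1 ?addr0; last first.
    move=> s; rewrite inE => ns.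
    suff [i /negPf Hi] : exists i : 'I_h, (s (lo i) + s (hi i) != m)%N.
      by rewrite (bigD1 i) //= /fact_form Hi mul0r mulr0.
    apply/existsP; apply: contraNT ns; rewrite negb_exists => /forallP H.
    have E i : s (hi i) = rev_ord (s (lo i)).
      by apply: ord_inj; have := H i; rewrite negbK => /eqP /= e; lia.
    apply/forallP => v; case: (boolP (v < h)%N) => vh.
      by rewrite -(lo_idx vh) rev_lo E.
    by rewrite -(hi_idx (negbTE vh)) rev_hi E rev_ordK.
  rewrite (eq_bigr (fun=> c * (\prod_(v : 'I_n) v`!)%:R)); last first.
    move=> s sC; rewrite /c -(comm_rev_sign sC) prod_half -mulrA; congr (_ * _).
    have sr v : s (rev_ord v) = rev_ord (s v) by move: sC; rewrite inE => /forallP/(_ v)/eqP.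
    rewrite (reindex_inj (@perm_inj _ s)) natr_prod big_lohi -big_split.
    apply: eq_bigr => i _; rewrite /fact_form /hi sr /= -natrM.
    by rewrite ifT //; apply/eqP; have := ltn_ord (s (lo i)); lia.
  by rewrite sumr_const -[LHS]mulr_natr; congr (_ * _%:R); apply: eq_card.
have unit_sq (a : int) : a * a = 1 -> (a%:~R : K) != 0.
  by move=> aa; apply/eqP => a0; have := congr1 (fun x : int => x%:~R : K) aa; rewrite intrM a0 mul0r => /eqP; rewrite eq_sym oner_eq0.
rewrite !mulf_neq0 //.
- by apply: unit_sq; exact: pairing_const_sqr.
- by rewrite expf_neq0 // oppr_eq0 oner_eq0.
rewrite !rmorphM /= !rmorph_nat !mulf_neq0 //.
- apply: unit_sq; rewrite /c -big_split big1 // => e _; rewrite /half_sign -big_split big1 //= => a _.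
  by rewrite -signr_odd -signr_addb addbb.
- rewrite natr_prod; apply/prodf_neq0 => v _; apply: fact_neq0 => //.
  by apply: leq_trans (ltn_ord v) _.
rewrite Fp_natr_eq0 //; apply: contraL (fact_neq0 pP (ltnSn n)) => pd.
rewrite negbK Fp_natr_eq0 // -card_Sn; apply: dvdn_trans pd _.
rewrite -cardsT; exact: (cardSg (G := [set: 'S_n]%G) (H := Group comm_rev_group) (subsetT _)).
Qed.

End FpEvaluation.

Lemma Ssum_complete_pred_prime (p : nat) (V : finType) (kap : V -> nat) :
  prime p -> odd p -> (3 < p)%N -> #|V| = p.-1 -> injective kap -> Ssum kap (complete V) != 0.
Proof.
move=> pP po p3 cV kI; pose k := (p./2).-1.
have pE : p = (k.*2).+3.
  by rewrite -{1}(odd_double_half p) po /k; case: p./2 (odd_double_half p) => [|j] //=; rewrite po; lia.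
have cV' : #|V| = (k.*2).+2 by rewrite cV pE.
have := trace_sum_neq0 (k := k); rewrite -pE => /(_ pP).
rewrite trace_sum_Ssum; apply: contraNneq => S0.
have [b bB] : exists b : 'I_(k.*2).+2 -> V, bijective b.
  exists (fun i => enum_val (cast_ord (esym cV') i)); apply: inj_card_bij.
    by move=> i j /enum_val_inj /cast_ord_inj.
  by rewrite cV' card_ord.
have := Ssum_complete bB (@ord_inj _) kI; rewrite card_ord S0 /= negbK odd_double.
by move=> <- //; rewrite mulr0.
Qed.

(** * The signed sum over starters *)

Section Starters.
Variable h' : nat.
Local Notation h := h'.+1.
Local Notation p := (h.*2).+1.
Local Notation K := 'F_p.

(** Position 0 stands alone and the pair of difference [d + 1] occupies two consecutive places, so
    that no other position lies between them. *)
Definition fst_pos (d : 'I_h) : 'I_p := inord (d.*2).+1.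
Definition snd_pos (d : 'I_h) : 'I_p := inord (d.*2).+2.
Definition half_pos (i : 'I_p) : 'I_h := inord i.-1./2.

Lemma val_fst_pos d : fst_pos d = (d.*2).+1 :> nat.
Proof. by rewrite inordK //; have := ltn_ord d; lia. Qed.
Lemma val_snd_pos d : snd_pos d = (d.*2).+2 :> nat.
Proof. by rewrite inordK //; have := ltn_ord d; lia. Qed.
Lemma half_fst_pos d : half_pos (fst_pos d) = d.
Proof. by apply: val_inj; rewrite /half_pos /= val_fst_pos /= doubleK inordK. Qed.
Lemma half_snd_pos d : half_pos (snd_pos d) = d.
Proof. by apply: val_inj; rewrite /half_pos /= val_snd_pos /= uphalf_double inordK. Qed.

Lemma pos_cases (P : 'I_p -> Prop) :
  P ord0 -> (forall d, P (fst_pos d)) -> (forall d, P (snd_pos d)) -> forall i, P i.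
Proof.
move=> P0 P1 P2 i; case: (posnP i) => [i0|i0]; first by rewrite (_ : i = ord0) //; apply: ord_inj.
have hi : (i.-1./2 < h)%N by have := ltn_ord i; lia.
case: (boolP (odd i)) => oi.
  rewrite (_ : i = fst_pos (half_pos i)) //; apply: ord_inj.
  rewrite val_fst_pos /half_pos inordK //; have := odd_double_half i; rewrite oi; lia.
rewrite (_ : i = snd_pos (half_pos i)) //; apply: ord_inj.
rewrite val_snd_pos /half_pos inordK //.
have := odd_double_half i; rewrite (negPf oi); lia.
Qed.

Lemma big_pos (R : Type) (idx : R) (op : Monoid.com_law idx) (f : 'I_p -> R) :
  \big[op/idx]_i f i =
  op (f ord0) (op (\big[op/idx]_d f (fst_pos d)) (\big[op/idx]_d f (snd_pos d))).
Proof.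
rewrite (bigD1 ord0) //=; congr (op _ _); rewrite (bigID (fun i : 'I_p => odd i)) /=.
congr (op _ _).
  rewrite (reindex_onto fst_pos half_pos) /=; last first.
    apply: pos_cases => [//|d _|d]; first by rewrite half_fst_pos.
    by rewrite val_snd_pos /= odd_double andbF.
  apply: eq_bigl => d; rewrite val_fst_pos /= odd_double half_fst_pos eqxx !andbT.
  by rewrite -(inj_eq (@ord_inj p)) val_fst_pos.
rewrite (reindex_onto snd_pos half_pos) /=; last first.
  apply: pos_cases => [//|d|d _]; last by rewrite half_snd_pos.
  by rewrite val_fst_pos /= odd_double andbF.
apply: eq_bigl => d; rewrite val_snd_pos /= odd_double half_snd_pos eqxx !andbT.
by rewrite -(inj_eq (@ord_inj p)) val_snd_pos.
Qed.

(* The pairs [{a d, a d + d + 1}] form a starter exactly when the word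
   [0, a 0, a 0 + 1, a 1, a 1 + 2, ...] has distinct letters. *)
Definition word (a : {ffun 'I_h -> K}) (i : 'I_p) : K :=
  if i == ord0 then 0 else
  if odd i then a (half_pos i) else a (half_pos i) + (half_pos i).+1%:R.

Lemma word0 a : word a ord0 = 0. Proof. by []. Qed.
Lemma word_fst a d : word a (fst_pos d) = a d.
Proof.
by rewrite /word -(inj_eq (@ord_inj p)) val_fst_pos /= odd_double half_fst_pos.
Qed.
Lemma word_snd a d : word a (snd_pos d) = a d + d.+1%:R.
Proof.
by rewrite /word -(inj_eq (@ord_inj p)) val_snd_pos /= odd_double half_snd_pos.
Qed.

Definition kkey (x : K) : nat := x.
Lemma kkey_inj : injective kkey. Proof. exact: ord_inj. Qed.
Local Notation pkey := (@nat_of_ord p).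

(** The sum [T]; a starter is signed as the bijection from positions to residues given by its
    word. *)
Definition starter_sum : K :=
  \sum_(a : {ffun 'I_h -> K} | injectiveb (word a)) (bsign pkey kkey (word a))%:~R.

Definition vdm (u : 'I_p -> K) : K :=
  \prod_(i < p) \prod_(j < p | (i < j)%N) (u j - u i).

Lemma vdmE u : vdm u = pp [set: 'I_p] (fun i j => (sg pkey i j)%:~R * (u j - u i)).
Proof.
rewrite (@pairprod_tour _ _ _ (fun i j : 'I_p => (i < j)%N)); first last.
- move=> i j _ _; case: (eqVneq i j) => [->//|ij].
  by rewrite (sgN (@ord_inj p) ij) rmorphN /= mulNr -mulrN opprB.
- exact: (key_tournament (@ord_inj p)).
- exact: rk_tournament.
rewrite /vdm pair_big_dep /= /pairprod; apply: eq_big => [[i j]|[i j]] /=; first by rewrite !inE.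
by move=> ij; rewrite /sg ij mul1r.
Qed.

Definition vdm_all : K := pp [set: K] (fun x y => (sg kkey x y)%:~R * (y - x)).

Hypothesis pP : prime p.

Lemma bsign_vdm u : injective u -> (bsign pkey kkey u)%:~R * vdm_all = vdm u.
Proof.
move=> uI; have uT : u @: [set: 'I_p] = [set: K].
  by apply/eqP; rewrite eqEcard subsetT (card_imset _ uI) !cardsT (card_Fp pP) card_ord leqnn.
rewrite /vdm_all -uT pp_imset; first last.
- move=> i j _ _; case: (eqVneq i j) => [->//|ij].
  by rewrite (@sgN _ _ kkey_inj (u i) (u j)) ?(inj_eq uI) // rmorphN /= mulNr -mulrN opprB.
- by move=> i j _ _; exact: uI.
rewrite vdmE /bsign /pairprod rmorph_prod -big_split; apply: eq_bigr => -[i j] _ /=.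
rewrite /flip rmorphM /= -!mulrA; congr (_ * _).
by rewrite mulrA -intrM sg_sqr mul1r.
Qed.

Lemma vdm0 u : ~~ injectiveb u -> vdm u = 0.
Proof.
case/injectivePn => i [j ij uij]; rewrite /vdm.
have [lt|lt] : (i < j)%N \/ (j < i)%N by move: ij; rewrite -(inj_eq (@ord_inj p)) neq_ltn => /orP[]; auto.
  by rewrite (bigD1 i) //= (bigD1 j) //= uij subrr !mul0r.
by rewrite (bigD1 j) //= (bigD1 i) //= uij subrr !mul0r.
Qed.

Lemma starter_vdm : starter_sum * vdm_all = \sum_a vdm (word a).
Proof.
rewrite [RHS](bigID (fun a => injectiveb (word a))) /= [X in _ + X]big1 ?addr0; last first.
  by move=> a; exact: vdm0.
by rewrite mulr_suml; apply: eq_bigr => a /injectiveP; exact: bsign_vdm.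
Qed.

Lemma vdm_allE : vdm_all = \prod_(j < p) j`!%:R.
Proof.
pose u (i : 'I_p) : K := i%:R.
have uK (i : 'I_p) : kkey (u i) = i.
  by rewrite /kkey /u /= val_Fp_nat // modn_small.
have uI : injective u by move=> i j E; apply: ord_inj; rewrite -uK E uK.
have <- : (bsign pkey kkey u)%:~R * vdm_all = vdm_all.
  rewrite [bsign _ _ _](_ : _ = 1) ?mul1r //; apply: pairprod1; first exact: rk_tournament.
  by move=> i j _ _ _; rewrite /flip /sg !uK; case: ifP.
rewrite bsign_vdm // /vdm (exchange_big_dep xpredT) //=; apply: eq_bigr => j _.
rewrite -(big_ord_widen p (fun i => j%:R - i%:R) (ltnW (ltn_ord j))).
rewrite fact_prod big_add1 big_mkord natr_prod (reindex_inj rev_ord_inj) /=.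
apply: eq_bigr => i _; rewrite -natrB ?leq_subr //; congr (_%:R).
by have := ltn_ord i; lia.
Qed.

Lemma two_neq0 : (2%:R : K) != 0.
Proof. by rewrite Fp_natr_eq0 // gtnNdvd. Qed.

(** Wilson's theorem is the case [j = 0]; moving one factor from one factorial to the other changes
    the sign, as [p - (j + 1)] is [- (j + 1)]. *)
Lemma fact_complement j : (j < p)%N -> j`!%:R * (p.-1 - j)`!%:R = (-1) ^+ j.+1 :> K.
Proof.
elim: j => [_|j IH jp].
  rewrite fact0 mul1r subn0 expr1; apply/eqP; rewrite -addr_eq0 -mulrSr Fp_natr_eq0 //.
  by rewrite -Wilson.
have j1 : (j.+1%:R : K) != 0 by rewrite Fp_natr_eq0 // gtnNdvd.
apply: (mulfI j1); rewrite exprS mulN1r mulrN -IH ?(ltnW jp) //.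
have -> : (p.-1 - j = (p.-1 - j.+1).+1)%N by move: jp => /= ; lia.
rewrite [(_.+1)`!]factS factS !natrM.
have -> : ((p.-1 - j.+1).+1%:R : K) = - j.+1%:R.
  apply/eqP; rewrite -addr_eq0 -natrD Fp_natr_eq0 //.
  by rewrite (_ : (_ + _ = p)%N) //; move: jp => /=; lia.
by ring.
Qed.

(** Multiply the product of factorials by its reversal and use [fact_complement]: -1 appears for
    each even [j], and there are [h + 1] of them. *)
Lemma vdm_all_sqr : vdm_all * vdm_all = (-1) ^+ h.+1.
Proof.
rewrite vdm_allE [X in _ * X](reindex_inj rev_ord_inj) -big_split /=.
rewrite (eq_bigr (fun j : 'I_p => (-1) ^+ j.+1)) => [|j _]; last first.
  by rewrite -fact_complement //= subSS.
rewrite big_pos /= expr1 big1 => [|d _]; last by rewrite val_fst_pos -signr_odd /= odd_double.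
rewrite (eq_bigr (fun=> -1)) => [|d _]; last by rewrite val_snd_pos -signr_odd /= odd_double.
by rewrite prodr_const card_ord /= mul1r -exprS.
Qed.

Definition moment (c : K) (i j : nat) : K := \sum_(x : K) x ^+ i * (x + c) ^+ j.

(** The substitution of [- x - c] for [x] exchanges [x] and [x + c] up to sign. *)
Lemma moment_swap c i j : moment c j i = (-1) ^+ (i + j) * moment c i j.
Proof.
rewrite /moment mulr_sumr.
have neg_inj : injective (fun x : K => - x - c) by move=> x y /addIr /oppr_inj.
rewrite (reindex_inj neg_inj) /=; apply: eq_bigr => x _.
rewrite subrK -opprD -[- (x + c)]mulN1r -[- x]mulN1r !exprMn exprD; ring.
Qed.

Lemma momentE c i j : moment c i j =
  \sum_(r < j.+1) c ^+ r *+ 'C(j, r) * \sum_(x : K) x ^+ (i + (j - r)).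
Proof.
rewrite /moment; under eq_bigr => x _ do rewrite exprDn mulr_sumr.
rewrite exchange_big /=; apply: eq_bigr => r _; rewrite mulr_sumr; apply: eq_bigr => x _.
by rewrite exprD mulrnAr mulrnAl; congr (_ *+ _); rewrite [LHS]mulrA [RHS]mulrC.
Qed.

Lemma power_sum_small e : (e < p.-1)%N -> \sum_(x : K) x ^+ e = 0.
Proof.
case: (posnP e) => [-> _|e0 ep]; first exact: power_sum_zero.
by apply: power_sum0 => //; rewrite gtnNdvd.
Qed.

Lemma moment_small c i j : (i + j < p.-1)%N -> moment c i j = 0.
Proof.
move=> ij; rewrite momentE big1 // => r _; rewrite power_sum_small ?mulr0 //.
by apply: leq_ltn_trans ij; rewrite leq_add2l leq_subr.
Qed.

Lemma pred_ndvd : ~~ (p.-1 %| p)%N.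
Proof.
have ndvd q : (1 < q)%N -> ~~ (q %| q.+1)%N.
  by move=> q1; rewrite -[q.+1]addn1 dvdn_addr ?dvdnn // dvdn1 gtn_eqF.
by apply: ndvd; rewrite doubleS.
Qed.

(** In the binomial expansion the power sums of exponent [p] and of exponents below [p - 1] vanish.
    Exponent [p - 1] leaves [- j * c], and [- j] is [i] modulo [p]. *)
Lemma moment_eq c i j : (0 < i)%N -> (i + j = p)%N -> moment c i j = i%:R * c.
Proof.
move=> i0 ij; rewrite momentE.
have [S SE] : exists S : nat -> K, forall e, \sum_(x : K) x ^+ e = S e.
  by exists (fun e => \sum_(x : K) x ^+ e).
under eq_bigr => r _ do rewrite SE.
have Sp : S p = 0 by rewrite -SE power_sum0 // pred_ndvd.
case: j ij => [|j] ij.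
  rewrite big_ord_recl big_ord0 addr0 /= subn0 ij Sp mulr0.
  rewrite addn0 in ij; rewrite ij (_ : (p%:R : K) = 0) ?mul0r //.
  by apply/eqP; rewrite Fp_natr_eq0.
rewrite 2!big_ord_recl /= big1 => [|r _]; last first.
  rewrite -SE power_sum_small ?mulr0 //= /bump /=; have := ltn_ord r; lia.
rewrite addr0 /bump /= !subn0 ij Sp mulr0 add0r bin1 expr1.
rewrite -SE power_sum1 //; last first.
- by rewrite (_ : (i + _ = p.-1)%N) //=; lia.
- by lia.
rewrite mulrN1 -mulr_natl -mulNr; congr (_ * _).
by apply/eqP; rewrite eq_sym -subr_eq0 opprK -natrD ij Fp_natr_eq0.
Qed.

(** Leibniz expansion followed by separate summation over each letter. The fixed letter 0 leaves the
    power of 0 that will force [s ord0] to be 0. *)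
Lemma sum_vdm_word : \sum_a vdm (word a) =
  \sum_(s : 'S_p) (-1) ^+ s * ((0 : K) ^+ s ord0 *
     \prod_(d < h) moment d.+1%:R (s (fst_pos d)) (s (snd_pos d))).
Proof.
have E (u : 'I_p -> K) : vdm u = \sum_(s : 'S_p) (-1) ^+ s * \prod_i u i ^+ s i.
  transitivity (\det (Vandermonde p (\row_j u j))).
    by rewrite det_Vandermonde; apply: eq_bigr => i _; apply: eq_bigr => j _; rewrite !mxE.
  rewrite -det_tr; apply: eq_bigr => s _; congr (_ * _).
  by apply: eq_bigr => v _; rewrite !mxE.
under eq_bigr => a _ do rewrite E.
rewrite exchange_big /=; apply: eq_bigr => s _; rewrite -mulr_sumr; congr (_ * _).
rewrite /moment bigA_distr_bigA /= mulr_sumr; apply: eq_bigr => a _.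
rewrite big_pos word0; congr (_ * _); rewrite -big_split; apply: eq_bigr => d _.
by rewrite /= word_fst word_snd.
Qed.

End Starters.

Lemma im2_pairing (V W : finType) (b : V -> W) (G : V -> V) (H : W -> W) : bijective b ->
  (forall x, b (G x) = H (b x)) -> im2 b (pairing G) = pairing H.
Proof.
move=> [a ba ab] bG; have im x : b @: [set x; G x] = [set b x; H (b x)].
  by rewrite imsetU1 imset_set1 bG.
apply/setP => e; apply/imsetP/imsetP => [[_ /imsetP[x _ ->] ->]|[y _ ->]].
  by exists (b x).
by exists [set a y; G (a y)]; [exact: imset_f | rewrite im ab].
Qed.

Lemma even_pairs_pairing1 (D : finType) (G : D -> D) (x0 : D) :
  (forall x, G x = x -> x = x0) -> even_pairs (pairing G).
Proof.
move=> G0; have odd_block e : e \in pairing G -> odd #|e| -> e = [set x0; G x0].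
  case/imsetP => x _ ->; rewrite cards2; case: (eqVneq x (G x)) => //= /esym/G0 -> //.
move=> e f eG fG ef; rewrite oddM; apply: contra ef => /andP[oe of_].
by rewrite (odd_block _ eG oe) (odd_block _ fG of_).
Qed.

(** * Value of the starter sum *)

Section StarterSum.
Variable h' : nat.
Local Notation h := h'.+1.
Local Notation p := (h.*2).+1.
Local Notation K := 'F_p.
Hypothesis pP : prime p.
Local Notation fst_pos := (@fst_pos h').
Local Notation snd_pos := (@snd_pos h').
Local Notation half_pos := (@half_pos h').
Implicit Types s : 'S_p.

Lemma fst_neq0 d : fst_pos d != ord0.
Proof. by rewrite -(inj_eq (@ord_inj p)) val_fst_pos. Qed.
Lemma snd_neq0 d : snd_pos d != ord0.
Proof. by rewrite -(inj_eq (@ord_inj p)) val_snd_pos. Qed.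
Lemma fst_neq_snd d e : fst_pos d != snd_pos e.
Proof.
rewrite -(inj_eq (@ord_inj p)) val_fst_pos val_snd_pos; apply/eqP => E.
by have := congr1 odd E; rewrite /= !odd_double.
Qed.
Lemma fst_pos_inj : injective fst_pos.
Proof. by move=> d e E; rewrite -(half_fst_pos d) E half_fst_pos. Qed.
Lemma snd_pos_inj : injective snd_pos.
Proof. by move=> d e E; rewrite -(half_snd_pos d) E half_snd_pos. Qed.

Lemma pos_neq d e : d != e -> [/\ fst_pos e != fst_pos d, snd_pos e != fst_pos d,
  fst_pos e != snd_pos d & snd_pos e != snd_pos d].
Proof.
by move=> de; rewrite (inj_eq fst_pos_inj) (inj_eq snd_pos_inj) eq_sym de
   [snd_pos e == _]eq_sym !fst_neq_snd.
Qed.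

Definition signed_moment s : K := (-1) ^+ s * ((0 : K) ^+ s ord0 *
     \prod_(d < h) moment d.+1%:R (s (fst_pos d)) (s (snd_pos d))).

Definition even_pair s (d : 'I_h) := ~~ odd (s (fst_pos d) + s (snd_pos d)).

(* Exchanging the values of [s] on the first even pair reverses the sign. *)
Lemma sum_even_pair : \sum_(s | [exists d, even_pair s d]) signed_moment s = 0.
Proof.
pose dd s := odflt ord0 [pick d | even_pair s d].
pose swap s := (tperm (fst_pos (dd s)) (snd_pos (dd s)) * s)%g.
have swapE s : even_pair (swap s) =1 even_pair s.
  move=> d; rewrite /even_pair /swap !permM; congr (~~ odd _).
  case: (eqVneq d (dd s)) => [->|ne]; first by rewrite tpermL tpermR addnC.
  by have [n1 n2 n3 n4] := pos_neq ne; rewrite !tpermD.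
have ddE s : dd (swap s) = dd s by rewrite /dd (eq_pick (swapE s)).
have swapK : involutive swap.
  by move=> s; rewrite {1}/swap ddE mulgA tperm2 mul1g.
have badE s : [exists d, even_pair (swap s) d] = [exists d, even_pair s d].
  by apply: eq_existsb; exact: swapE.
have neg s : [exists d, even_pair s d] -> signed_moment (swap s) = - signed_moment s.
  move=> /existsP bad; have evd : even_pair s (dd s).
    by rewrite /dd; case: pickP => // H; case: bad => d; rewrite H.
  rewrite /signed_moment {1}/swap odd_permM odd_tperm fst_neq_snd signr_addb expr1 mulN1r mulNr.
  congr (- (_ * _)); congr (_ * _).
    by rewrite /swap permM tpermD // ?fst_neq0 ?snd_neq0.
  rewrite (bigD1 (dd s)) //= [RHS](bigD1 (dd s)) //=; congr (_ * _).
    rewrite /swap !permM tpermL tpermR moment_swap -signr_odd.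
    by move: evd; rewrite /even_pair => /negPf ->; rewrite mul1r.
  apply: eq_bigr => d ne; rewrite /swap !permM.
  by have [n1 n2 n3 n4] := pos_neq ne; rewrite !tpermD.
apply/eqP; rewrite -(mulrI_eq0 _ (mulfI (two_neq0 pP))) mulrDl mul1r.
rewrite {1}(reindex_inj (inv_inj swapK)) /= (eq_bigl _ _ badE).
by rewrite -big_split big1 //= => s /neg ->; rewrite addNr.
Qed.

Definition balanced : {set 'S_p} := [set s : 'S_p | (s ord0 == ord0) &&
  [forall d, s (fst_pos d) + s (snd_pos d) == p]%N].

Lemma balancedP s : reflect (s ord0 = ord0 /\ forall d, s (fst_pos d) + s (snd_pos d) = p)%N
  (s \in balanced).
Proof.
rewrite inE; apply: (iffP andP) => [[/eqP s0 /forallP H]|[-> H]]; split=> //.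
  by move=> d; apply/eqP.
by apply/forallP => d; apply/eqP.
Qed.

Lemma sum_ord : (2 * \sum_(i < p) i = p * p.-1)%N.
Proof.
rewrite mul2n -addnn {2}(reindex_inj rev_ord_inj) -big_split /=.
rewrite (eq_bigr (fun=> h.*2)) => [|i _]; last by have := ltn_ord i; lia.
by rewrite sum_nat_const card_ord.
Qed.

(** Sums on pairs below [p - 1] kill the term, and [p - 1] is even, so without even pairs all [h]
    sums are at least [p]. Their total is [h * p] once [s ord0] is 0, so all are equal to [p]. *)
Lemma signed_moment0 s : ~~ [exists d, even_pair s d] -> s \notin balanced -> signed_moment s = 0.
Proof.
rewrite negb_exists => /forallP odd_s nb; rewrite /signed_moment.
case: (eqVneq (s ord0) ord0) => s0; last first.
  by rewrite expr0n (negPf (s0 : s ord0 != 0%N :> nat)) mul0r mulr0.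
case: (pickP (fun d => (s (fst_pos d) + s (snd_pos d) < p.-1)%N)) => [d lt|H].
  by rewrite (bigD1 d) //= moment_small // mul0r !mulr0.
case/balancedP: nb; split=> //.
have ge d : (p <= s (fst_pos d) + s (snd_pos d))%N.
  have := H d => /negbT; rewrite -leqNgt leq_eqVlt => /orP[/eqP E|//].
  by have := odd_s d; rewrite /even_pair -E /= odd_double.
have tot : (\sum_(d < h) (s (fst_pos d) + s (snd_pos d)) = \sum_(d < h) p)%N.
  have := sum_ord; rewrite (reindex_inj (@perm_inj _ s)) /= big_pos s0 /= add0n -big_split /=.
  move=> E; apply/eqP; rewrite sum_nat_const card_ord -(eqn_pmul2l (isT : 0 < 2)%N) E.
  by rewrite mulnA mul2n mulnC.
have [_] := leqif_sum (P := xpredT) (fun d _ => leqif_eq (ge d)).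
rewrite tot eqxx => /esym/forall_inP EE d.
by apply/esym/eqP/EE.
Qed.

Lemma balanced_neq0 s d : s \in balanced -> (0 < s (fst_pos d))%N.
Proof.
case/balancedP => s0 _; rewrite lt0n; apply/negP => /eqP e.
have : s (fst_pos d) = s ord0 by rewrite s0; apply: ord_inj.
by move/perm_inj/eqP; rewrite (negPf (fst_neq0 d)).
Qed.

Lemma starter_balanced : starter_sum h' * (vdm_all h') =
  h`!%:R * \sum_(s in balanced) (-1) ^+ s * \prod_(d < h) (s (fst_pos d) : nat)%:R.
Proof.
rewrite (starter_vdm pP) (sum_vdm_word).
rewrite (bigID (fun s => [exists d, even_pair s d])) /= sum_even_pair add0r.
rewrite (bigID (mem balanced)) /= [X in _ + X]big1 ?addr0; last first.
  by move=> s /andP[]; exact: signed_moment0.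
rewrite mulr_sumr; apply: eq_big => s.
  rewrite andb_idl // => /balancedP[_ H]; rewrite negb_exists; apply/forallP => d.
  by rewrite /even_pair H negbK /= odd_double.
move=> /andP[_ sb]; have /balancedP[s0 H] := sb.
rewrite s0 expr0 mul1r mulrCA; congr (_ * _).
have -> : h`!%:R = \prod_(d < h) d.+1%:R :> K by rewrite fact_prod big_add1 big_mkord natr_prod.
rewrite -big_split; apply: eq_bigr => d _ /=.
by rewrite moment_eq ?balanced_neq0 // mulrC.
Qed.

(** A balanced permutation carries [mirror] to negation, so [msign_relabel] computes its signature
    from these two pairings. *)
Definition mirror (i : 'I_p) : 'I_p :=
  if i == ord0 then ord0 else if odd i then snd_pos (half_pos i) else fst_pos (half_pos i).

Lemma mirror0 : mirror ord0 = ord0. Proof. by []. Qed.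
Lemma mirror_fst d : mirror (fst_pos d) = snd_pos d.
Proof. by rewrite /mirror (negPf (fst_neq0 d)) half_fst_pos val_fst_pos /= odd_double. Qed.
Lemma mirror_snd d : mirror (snd_pos d) = fst_pos d.
Proof. by rewrite /mirror (negPf (snd_neq0 d)) half_snd_pos val_snd_pos /= odd_double. Qed.
Lemma mirrorK : involutive mirror.
Proof. by apply: pos_cases => [//|d|d]; rewrite ?mirror_fst ?mirror_snd ?mirror_fst. Qed.
Lemma mirror_fix x : mirror x = x -> x = ord0.
Proof.
move: x; apply: pos_cases => [//|d|d]; rewrite ?mirror_fst ?mirror_snd => /eqP.
  by rewrite eq_sym (negPf (fst_neq_snd _ _)).
by rewrite (negPf (fst_neq_snd _ _)).
Qed.

Lemma big_mirror (g : {set 'I_p} -> int) : \prod_(e in pairing mirror) g e =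
  g [set ord0] * \prod_d g [set fst_pos d; snd_pos d].
Proof.
have -> : pairing mirror = [set ord0] |: [set [set fst_pos d; snd_pos d] | d : 'I_h].
  apply/setP => e; rewrite in_setU1; apply/imsetP/orP => [[x _ ->]|].
    elim/pos_cases: x => [|d|d]; rewrite ?mirror0 ?mirror_fst ?mirror_snd.
    - by left; rewrite setUid.
    - by right; apply: imset_f.
    - by right; rewrite setUC; apply: imset_f.
  case=> [/eqP ->|/imsetP[d _ ->]]; first by exists ord0; rewrite // mirror0 setUid.
  by exists (fst_pos d); rewrite // mirror_fst.
rewrite big_setU1 /=; last first.
  apply/negP => /imsetP[d _] /setP/(_ (fst_pos d)).
  by rewrite !inE eqxx (negPf (fst_neq0 d)).
rewrite big_imset //= => d e _ _ /setP/(_ (fst_pos d)).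
by rewrite !inE eqxx !(negPf (fst_neq_snd _ _)) !orbF => /esym/eqP/fst_pos_inj.
Qed.

Lemma val_opp (x : 'I_p) : (0 < x)%N -> (- x)%R = (p - x)%N :> nat.
Proof. by move=> x0; rewrite /= modn_small // ltn_subrL x0. Qed.

Lemma opp_fix (x : 'I_p) : - x = x -> x = ord0.
Proof.
case: (posnP x) => [x0 _|x0 /(congr1 (@nat_of_ord p))]; first exact: ord_inj.
by rewrite val_opp //; have := ltn_ord x; lia.
Qed.

Lemma balanced_mirror s x : s \in balanced -> s (mirror x) = - s x.
Proof.
move=> sb; have /balancedP[s0 H] := sb.
have key d : s (snd_pos d) = - s (fst_pos d).
  by apply: ord_inj; rewrite val_opp ?balanced_neq0 //; have := H d; lia.
elim/pos_cases: x => [|d|d]; rewrite ?mirror0 ?mirror_fst ?mirror_snd ?key ?opprK //.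
by rewrite s0; apply: ord_inj; rewrite /= subn0 modnn.
Qed.

Local Notation pkey := (@nat_of_ord p).
Definition mirror_sign : int := msign pkey (pairing mirror) * msign pkey (pairing (-%R : 'I_p -> 'I_p)).

Lemma mirror_sign_sqr : mirror_sign * mirror_sign = 1.
Proof. by rewrite /mirror_sign mulrACA !msign_sqr. Qed.

Lemma sign_balanced s : s \in balanced ->
  (-1) ^+ s = mirror_sign * \prod_d sg pkey (s (fst_pos d)) (s (snd_pos d)) :> int.
Proof.
move=> sb; have sB : bijective s by exact: injF_bij perm_inj.
have := msign_relabel (@ord_inj p) (@ord_inj p) (@perm_inj _ s) (partition_pairing mirrorK)
   (even_pairs_pairing1 mirror_fix).
rewrite -/(im2 s _) (im2_pairing sB (fun x => balanced_mirror x sb)) big_mirror.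
rewrite (bsign_perm (@ord_inj p)).
set X := \prod_d _; set Y := \prod_d _; set Z := pp _ _.
have -> : Z = 1.
  apply: pairprod1; first exact: rk_tournament.
  by move=> x y /set1P-> /set1P->; rewrite eqxx.
have -> : X = Y.
  apply: eq_bigr => d _; rewrite pp_set2 ?fst_neq_snd //; last first.
    by apply: flipC; [exact: ord_inj|exact: ord_inj|exact: perm_inj].
  by rewrite /flip {1}/sg val_fst_pos val_snd_pos ltnSn mul1r.
have Y2 : Y * Y = 1 by rewrite -big_split big1 // => d _; exact: sg_sqr.
rewrite /mirror_sign mul1r => ->; set A := msign _ _.
have A2 : A * A = 1 by exact: msign_sqr.
move: A Y ((-1) ^+ s) A2 Y2 => A Y e A2 Y2.
by transitivity ((A * A) * (Y * Y) * e); [rewrite A2 Y2 !mul1r|ring].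
Qed.

(** The least absolute value of a residue. *)
Definition fold (x : 'I_p) : nat := minn x (p - x).

Lemma fold_opp (x : 'I_p) : (0 < x)%N -> fold (- x) = fold x.
Proof. by move=> x0; rewrite /fold val_opp //; have := ltn_ord x; lia. Qed.

Lemma fold_inj (x y : 'I_p) : fold x = fold y -> x = y \/ x = - y.
Proof.
case: (posnP y) => [y0 E|y0 E].
  by left; apply: ord_inj; move: E; rewrite /fold y0; have := ltn_ord x; lia.
case: (eqVneq (x : nat) y) => [/ord_inj ->|ne]; first by left.
by right; apply: ord_inj; rewrite val_opp //; move: E ne; rewrite /fold; have := ltn_ord x; lia.
Qed.

Definition fold_fst s (d : 'I_h) : 'I_h := inord (fold (s (fst_pos d))).-1.

Lemma fold_fstE s d : s \in balanced -> (fold_fst s d).+1 = fold (s (fst_pos d)).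
Proof.
move=> sb; have := balanced_neq0 d sb; have := ltn_ord (s (fst_pos d)).
rewrite /fold_fst /fold; move: (s _) => x xp x0. by rewrite inordK; lia.
Qed.

Lemma fold_fst_inj s : s \in balanced -> injective (fold_fst s).
Proof.
move=> sb d e /(congr1 (fun x : 'I_h => (x : nat).+1)) /=; rewrite !fold_fstE // => /fold_inj[].
  by move/perm_inj/fst_pos_inj.
rewrite -balanced_mirror // mirror_fst => /perm_inj/eqP.
by rewrite (negPf (fst_neq_snd _ _)).
Qed.

(** The signature contributes -1 exactly for the pairs whose first value is minus its absolute value
    modulo [p]. After this correction the first values run through [1, ..., h]. *)
Lemma balanced_term s : s \in balanced ->
  (-1) ^+ s * \prod_(d < h) (s (fst_pos d) : nat)%:R = mirror_sign%:~R * h`!%:R :> K.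
Proof.
move=> sb; have /balancedP[_ H] := sb.
have -> : (-1) ^+ s = ((-1) ^+ s : int)%:~R :> K by rewrite rmorphXn /= rmorphN1.
rewrite sign_balanced // rmorphM rmorph_prod /= -mulrA -big_split /=; congr (_ * _).
rewrite fact_prod big_add1 big_mkord natr_prod [RHS](reindex_inj (fold_fst_inj sb)) /=.
apply: eq_bigr => d _; rewrite fold_fstE // /fold /sg.
have lt := ltn_ord (s (fst_pos d)); have := H d.
case: ifP => [l E|/negbT l E]; first by rewrite mul1r; congr (_%:R); lia.
rewrite mulN1r; apply/eqP; rewrite eq_sym -addr_eq0 -natrD Fp_natr_eq0 //.
by rewrite (_ : (_ + _ = p)%N) //; lia.
Qed.

(** A balanced permutation amounts to a permutation of the absolute values and a choice of signs. *)
Definition unfold_fun (u : {perm 'I_h} * {ffun 'I_h -> bool}) (i : 'I_p) : 'I_p :=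
  if i == ord0 then ord0 else
  let x : 'I_p := inord (u.1 (half_pos i)).+1 in
  if odd i == u.2 (half_pos i) then x else - x.

Lemma val_succ (d : 'I_h) : (inord d.+1 : 'I_p) = d.+1 :> nat.
Proof. by rewrite inordK //; have := ltn_ord d; lia. Qed.

Lemma succ_neq_opp (d : 'I_h) : (inord d.+1 : 'I_p) != - inord d.+1.
Proof. by apply/eqP => /esym/opp_fix/(congr1 (@nat_of_ord p)); rewrite val_succ. Qed.

Lemma unfold0 u : unfold_fun u ord0 = ord0. Proof. by []. Qed.
Lemma unfold_fst u d : unfold_fun u (fst_pos d) =
  if u.2 d then inord (u.1 d).+1 else - inord (u.1 d).+1.
Proof. by rewrite /unfold_fun (negPf (fst_neq0 _)) half_fst_pos val_fst_pos /= odd_double. Qed.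
Lemma unfold_snd u d : unfold_fun u (snd_pos d) =
  if u.2 d then - inord (u.1 d).+1 else inord (u.1 d).+1.
Proof.
by rewrite /unfold_fun (negPf (snd_neq0 _)) half_snd_pos val_snd_pos /= odd_double; case: (u.2 d).
Qed.

Lemma fold_unfold u i : i != ord0 -> fold (unfold_fun u i) = (u.1 (half_pos i)).+1.
Proof.
move=> i0; rewrite /unfold_fun (negPf i0); set x := inord _.
have xE : x = (u.1 (half_pos i)).+1 :> nat by exact: val_succ.
have -> : fold (if odd i == u.2 (half_pos i) then x else - x) = fold x.
  by case: ifP => // _; rewrite fold_opp // xE.
by rewrite /fold xE; have := ltn_ord (u.1 (half_pos i)); lia.
Qed.

Lemma unfold_inj u : injective (unfold_fun u).
Proof.
move=> i j; case: (eqVneq i ord0) => [->|i0]; case: (eqVneq j ord0) => [->//|j0].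
- by move/(congr1 fold); rewrite unfold0 fold_unfold // /fold min0n.
- by move/(congr1 fold); rewrite unfold0 fold_unfold // /fold min0n.
move=> E; have := congr1 fold E; rewrite !fold_unfold // => -[] /ord_inj/perm_inj hij.
move: E; rewrite /unfold_fun (negPf i0) (negPf j0) hij; have := succ_neq_opp (u.1 (half_pos j)).
set x := inord _ => nx E.
have oij : odd i = odd j.
  by move: E; case: (u.2 _) (odd i) (odd j) => [] [] [] //= /eqP;
    rewrite ?(negPf nx) // eq_sym (negPf nx).
move: i0 j0 hij oij; clear; elim/pos_cases: i => [|d|d]; elim/pos_cases: j => [|e|e] // _ _.
all: by rewrite ?half_fst_pos ?half_snd_pos ?val_fst_pos ?val_snd_pos /= ?odd_double => ->.
Qed.

Lemma card_balanced : #|balanced| = (h`! * 2 ^ h)%N.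
Proof.
have -> : balanced = [set perm (@unfold_inj u) | u : {perm 'I_h} * {ffun 'I_h -> bool}].
  apply/setP => s; apply/idP/imsetP => [sb|[u _ ->]]; last first.
    apply/balancedP; split; first by rewrite permE.
    move=> d; rewrite !permE unfold_fst unfold_snd; have := val_succ (u.1 d).
    by case: (u.2 d) => E; rewrite val_opp E //; have := ltn_ord (u.1 d); lia.
  exists (perm (fold_fst_inj sb), [ffun d => s (fst_pos d) == inord (fold_fst s d).+1]) => //.
  have Hf d : s (fst_pos d) = unfold_fun (perm (fold_fst_inj sb),
      [ffun d => s (fst_pos d) == inord (fold_fst s d).+1]) (fst_pos d).
    rewrite unfold_fst /= ffunE permE; case: eqP => // ne.
    have [|//|//] := @fold_inj (s (fst_pos d)) (inord (fold_fst s d).+1).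
    by rewrite /fold val_succ fold_fstE // /fold; move: (s (fst_pos d)) => x; have := ltn_ord x; lia.
  apply/permP => i; rewrite permE; elim/pos_cases: i => [|d|d]; last 1 first.
  - rewrite -mirror_fst balanced_mirror // Hf mirror_fst unfold_fst unfold_snd.
    by case: ifP => //; rewrite opprK.
  - by have /balancedP[-> _] := sb.
  - exact: Hf.
rewrite card_imset; last first.
  move=> [t o] [t' o'] /permP E; have {}E i : unfold_fun (t, o) i = unfold_fun (t', o') i.
    by have := E i; rewrite !permE.
  have tt : t = t'.
    apply/permP => d; apply: ord_inj; apply: succn_inj.
    by have := congr1 fold (E (fst_pos d)); rewrite !fold_unfold ?fst_neq0 // half_fst_pos.
  rewrite -tt in E *; congr (_, _); apply/ffunP => d; have := E (fst_pos d).
  rewrite !unfold_fst /=; have /eqP := succ_neq_opp (t d).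
  by case: (o d) (o' d) => [] [] // ne /esym.
by rewrite card_prod card_Sn card_ffun card_bool !card_ord.
Qed.

(** Up to sign, [T] times [vdm_all] is [2 ^ h] times the cube of [h!]. On squaring, the power of 2
    gives 1 by Fermat, while [h! * h!] and [vdm_all * vdm_all] are both [(-1) ^+ h.+1]. *)
Lemma starter_sum_sqr : starter_sum h' * starter_sum h' = 1.
Proof.
have E := starter_balanced; rewrite (eq_bigr _ balanced_term) sumr_const card_balanced -[X in _ = _ * X]mulr_natr natrM in E.
have h2 : (h`!%:R * h`!%:R : K) = (-1) ^+ h.+1.
  have e : (p.-1 - h = h)%N by rewrite [p.-1]/= -addnn addnK.
  by have := @fact_complement h' pP h; rewrite e; apply; rewrite ltnS -addnn leq_addl.
have two : (2 ^ h)%:R * (2 ^ h)%:R = 1 :> K.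
  by rewrite -natrM -expnD addnn natrX (Fp_expr_order pP) // two_neq0.
have e2 : (mirror_sign%:~R * mirror_sign%:~R : K) = 1 by rewrite -intrM mirror_sign_sqr.
have s2 : (-1) ^+ h.+1 * (-1) ^+ h.+1 = 1 :> K by rewrite -expr2 sqrr_sign.
have V2 := vdm_all_sqr pP.
have : starter_sum h' * starter_sum h' * (vdm_all h' * vdm_all h') = (-1) ^+ h.+1.
  rewrite mulrACA E.
  transitivity (((mirror_sign%:~R * mirror_sign%:~R : K)) * ((2 ^ h)%:R * (2 ^ h)%:R) *
    (h`!%:R * h`!%:R) * (h`!%:R * h`!%:R) * (h`!%:R * h`!%:R)); first by ring.
  by rewrite e2 two h2 !mul1r -mulrA s2 mulr1.
by rewrite V2 -[RHS]mul1r => /mulIf -> //; rewrite signr_eq0.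
Qed.

End StarterSum.

(** * Factorizations fixed by a translation *)

Definition is_shift (p : nat) (X : Type) (act : 'F_p -> X -> X) :=
  (forall x, act 0 x = x) /\ (forall t u x, act (t + u) x = act t (act u x)).

Lemma shift_imset p (X : finType) (act : 'F_p -> X -> X) : is_shift act ->
  is_shift (fun t (A : {set X}) => act t @: A).
Proof.
case=> act0 actD; split=> [A|t u A]; first by rewrite (eq_imset _ act0) imset_id.
by rewrite -imset_comp; apply: eq_imset => x /=.
Qed.

Section Shifts.
Variables (p : nat) (pP : prime p) (X : finType) (act : 'F_p -> X -> X).
Hypothesis shift : is_shift act.
Local Notation K := 'F_p.

Lemma shift0 x : act 0 x = x. Proof. exact: shift.1. Qed.
Lemma shiftD t u x : act (t + u) x = act t (act u x). Proof. exact: shift.2. Qed.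
Lemma shiftK t : cancel (act t) (act (- t)).
Proof. by move=> x; rewrite -shiftD addNr shift0. Qed.
Lemma shiftNK t : cancel (act (- t)) (act t).
Proof. by move=> x; rewrite -shiftD subrr shift0. Qed.
Lemma shift_inj t : injective (act t). Proof. exact: can_inj (shiftK t). Qed.
Lemma shift_bij t : bijective (act t).
Proof. exists (act (- t)); [exact: shiftK | exact: shiftNK]. Qed.

Lemma shift_fix t u x : t != 0 -> act t x = x -> act u x = x.
Proof.
move=> t0 tx; have iter_fix n : act (t *+ n) x = x.
  by elim: n => [|n IH]; rewrite ?mulr0n ?shift0 // mulrS shiftD IH.
have -> : u = t *+ (u / t : K).
  by rewrite -mulr_natr natr_Zp mulrC divfK.
exact: iter_fix.
Qed.

Lemma shift_free x : act 1 x != x -> injective (act^~ x).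
Proof.
move=> nfix t u /= E; apply/eqP; apply: contraNT nfix => tu; apply/eqP.
apply: (@shift_fix (t - u)); first by rewrite subr_eq0.
by rewrite addrC shiftD E shiftK.
Qed.

(** An orbit that is not a fixed point has [p] elements of equal weight and contributes 0 modulo
    [p]. *)
Lemma sum_fixed (A : {set X}) (w : X -> K) :
  (forall t x, (act t x \in A) = (x \in A)) -> (forall t x, x \in A -> w (act t x) = w x) ->
  \sum_(x in A) w x = \sum_(x in A | act 1 x == x) w x.
Proof.
move=> stA stw; pose orb x := [set act t x | t : K].
have orbE x y : (orb y == orb x) = (y \in orb x).
  apply/eqP/imsetP => [E|[t _ ->]].
    by apply/imsetP; rewrite -/(orb x) -E; apply/imsetP; exists 0; rewrite ?shift0.
  apply/setP => z; apply/imsetP/imsetP => -[u _ ->]; first by exists (u + t); rewrite // shiftD.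
  by exists (u - t); rewrite // -shiftD subrK.
rewrite big_mkcond [RHS]big_mkcond /= !(partition_big orb xpredT) //=.
apply: eq_bigr => O _; case: (pickP (fun x => orb x == O)) => [x /eqP <-|O0]; last first.
  by rewrite !big_pred0.
rewrite !(eq_bigl _ _ (orbE x)); case: (eqVneq (act 1 x) x) => [fx|nfx].
  have -> : orb x = [set x].
    apply/setP => y; rewrite inE; apply/imsetP/eqP => [[t _ ->]|->]; last by exists 0; rewrite ?shift0.
    by rewrite (shift_fix _ _ fx) // oner_neq0.
  by rewrite !big_set1 fx eqxx andbT.
rewrite [RHS]big1 => [|_ /imsetP[t _ ->]]; last first.
  by rewrite -shiftD addrC shiftD (inj_eq (@shift_inj _)) (negPf nfx) andbF.
transitivity (\sum_(y in orb x) (if x \in A then w x else 0)).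
  by apply: eq_bigr => _ /imsetP[t _ ->]; rewrite stA; case: ifP => // xA; exact: stw.
rewrite sumr_const card_imset ?card_Fp //; last exact: shift_free.
by rewrite -mulr_natr (_ : p%:R = 0) ?mulr0 //; apply/eqP; rewrite Fp_natr_eq0.
Qed.

End Shifts.

Section ShiftSigns.
Variables (p : nat) (pP : prime p) (p_odd : odd p).
Variables (V : finType) (kap : V -> nat) (sh : 'F_p -> V -> V).
Hypotheses (kI : injective kap) (shift : is_shift sh).
Local Notation K := 'F_p.

Lemma Fp_half (t : K) : exists u, t = u + u.
Proof.
have two0 : (2%:R : K) != 0.
  rewrite Fp_natr_eq0 // dvdn_prime2 //; by apply/eqP => E; move: p_odd; rewrite E.
by exists (t / 2%:R); rewrite -mulr2n -[RHS]mulr_natr divfK.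
Qed.

(* [sh t] is the square of [sh (t / 2)]. *)
Lemma bsign_shift t : bsign kap kap (sh t) = 1.
Proof.
have [u ->] := Fp_half t.
transitivity (bsign kap kap (sh u \o sh u)).
  apply: eq_pairprod; first exact: rk_tournament.
  by move=> x y _ _ _; rewrite /flip /= !(shiftD shift).
by rewrite (bsign_comp kap kI kI (shift_bij shift u) (@shift_inj _ _ _ shift u)) bsign_sqr.
Qed.

Lemma shift_im2 : is_shift (fun t => im2 (sh t)).
Proof. exact: shift_imset (shift_imset shift). Qed.

Lemma shift_im3 : is_shift (fun t => im3 (sh t)).
Proof. exact: shift_imset shift_im2. Qed.

(** A translation is another one applied twice, so the relabelling factor, a sign, is squared. *)
Lemma fsign_shift (E : {set {set V}}) d (v : V) F t : E \subset complete V -> regular E d ->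
  (forall u, im2 (sh u) E = E) -> one_factorization E F ->
  fsign kap (im3 (sh t) F) = fsign kap F.
Proof.
move=> EK regE stE Ff; have [u ->] := Fp_half t.
have shB := shift_bij shift u.
have Ff' : one_factorization E (im3 (sh u) F) by rewrite -{1}(stE u) one_factorization_im.
rewrite (shiftD shift_im3) (fsign_relabel shB kI kI v EK regE Ff').
rewrite (fsign_relabel shB kI kI v EK regE Ff) bsign_shift !expr1n !mul1r mulrA.
rewrite -big_split big1 ?mul1r // => e _.
by rewrite /= flip_sqr_prod.
Qed.

Lemma Ssum_fixed (E : {set {set V}}) d (v : V) : E \subset complete V -> regular E d ->
  (forall u, im2 (sh u) E = E) ->
  (Ssum kap E)%:~R =
  \sum_(F | one_factorization E F && (im3 (sh 1) F == F)) (fsign kap F)%:~R :> K.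
Proof.
move=> EK regE stE; rewrite rmorph_sum /=.
pose A := [set F | one_factorization E F].
rewrite (eq_bigl (mem A)) => [|F]; last by rewrite /= inE.
rewrite (sum_fixed pP shift_im3).
- by apply: eq_bigl => F; rewrite inE.
- by move=> t F; rewrite !inE -{1}(stE t) one_factorization_im //; exact: shift_bij.
- by move=> t F; rewrite inE => Ff; rewrite (fsign_shift v t EK regE stE Ff).
Qed.

Variables (D : finType) (dk : D -> nat) (G : D -> D) (b : D -> V).
Hypotheses (dI : injective dk) (GK : involutive G) (G0 : forall x, G x != x).
Hypothesis bB : bijective b.

(** Translations have sign 1, so the [p] translates share a common sign, whose odd power is itself.
    Only the signs between the two ends of a block really vary with [t]. *)
Lemma fsign_orbit : injective (fun t => im2 (sh t) (im2 b (pairing G))) ->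
  fsign kap [set im2 (sh t) (im2 b (pairing G)) | t : K] =
  msign dk (pairing G) * bsign dk kap b *
  \prod_(e in pairing G) pp e (fun x y => sg dk x y * \prod_t sg kap (sh t (b x)) (sh t (b y))).
Proof.
move=> injt; rewrite /fsign big_imset /=; last by move=> t u _ _; exact: injt.
have power_odd (c : int) : c * c = 1 -> c ^+ #|K| = c.
  move=> c2; rewrite card_Fp // -(odd_double_half p) p_odd -mul2n exprS exprM expr2 c2.
  by rewrite expr1n mulr1.
have term t : msign kap (im2 (sh t) (im2 b (pairing G))) =
    (msign dk (pairing G) * bsign dk kap b) * \prod_(e in pairing G) pp e (flip dk kap (sh t \o b)).
  have stb : injective (sh t \o b) by apply: inj_comp; [exact: shift_inj|exact: bij_inj].
  have -> : im2 (sh t) (im2 b (pairing G)) = im2 (sh t \o b) (pairing G).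
    by rewrite /im2 -imset_comp; apply: eq_imset => e /=; rewrite -imset_comp.
  rewrite (msign_relabel dI kI stb (partition_pairing GK) (even_pairs_pairing G0)).
  rewrite (bsign_comp dk kI kI bB (@shift_inj _ _ _ shift t)) bsign_shift mulr1 //.
rewrite (eq_bigr _ (fun t _ => term t)) big_split /= prodr_const power_odd; last first.
  by rewrite mulrACA msign_sqr bsign_sqr.
congr (_ * _); rewrite exchange_big /=; apply: eq_bigr => e _.
rewrite /pairprod exchange_big /=; apply: eq_bigr => -[x y] _ /=.
by rewrite /flip big_split /= prodr_const power_odd ?sg_sqr.
Qed.

End ShiftSigns.

Lemma subset_matching (V : finType) (M N : {set {set V}}) : N \subset complete V ->
  partition M [set: V] -> partition N [set: V] -> M \subset N -> M = N.
Proof.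
move=> NK pM pN MN; apply/eqP; rewrite eqEcard MN /=.
have := card_perfect_matching (subset_trans MN NK) pM.
by rewrite (card_perfect_matching NK pN) => /eqP; rewrite eqn_pmul2r // => /eqP ->.
Qed.

Section Parametrization.
Variables (V D : finType) (G : D -> D) (b : D -> V) (M : {set {set V}}).
Hypotheses (GK : involutive G) (G0 : forall x, G x != x).
Hypotheses (MK : M \subset complete V) (pM : partition M [set: V]) (DV : #|D| = #|V|).
Hypothesis bM : forall x, [set b x; b (G x)] \in M.
Hypothesis b_sep : forall x y, [set b x; b (G x)] = [set b y; b (G y)] -> y = x \/ y = G x.

Lemma matching_blocks_eq (e f : {set V}) v : e \in M -> f \in M -> v \in e -> v \in f -> e = f.
Proof.
move=> eM fM ve vf; apply/eqP; apply: contraT => ne.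
have /and3P[_ /trivIsetP tM _] := pM.
by have /disjoint_setI0/setP/(_ v) := tM _ _ eM fM ne; rewrite !inE ve vf.
Qed.

(** Points with the same image lie over the same block of [M], hence are equal or exchanged by [G];
    the latter would make that block a single vertex. *)
Lemma block_bij : bijective b.
Proof.
apply: inj_card_bij; last by rewrite DV.
move=> x y bxy; have [|->//|yG] := b_sep (x := x) (y := y).
  by apply: (@matching_blocks_eq _ _ (b x)) => //; rewrite ?set21 // bxy set21.
have := subsetP MK _ (bM x); rewrite inE cards2 -yG.
by rewrite bxy eqxx.
Qed.

Lemma im2_blocks : im2 b (pairing G) = M.
Proof.
have im x : b @: [set x; G x] = [set b x; b (G x)] by rewrite imsetU1 imset_set1.
have sub : im2 b (pairing G) \subset M.
  by apply/subsetP => _ /imsetP[_ /imsetP[x _ ->] ->]; rewrite im.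
by apply: subset_matching => //; rewrite (partition_im2 block_bij) partition_pairing.
Qed.

End Parametrization.

Lemma card_regular (V : finType) (E : {set {set V}}) d : E \subset complete V ->
  regular E d -> (#|E| * 2 = #|V| * d)%N.
Proof.
move=> EK regE; case: d regE => [|d] regE; last exact: card_edges regE.
rewrite muln0; apply/eqP; rewrite muln_eq0 orbF cards_eq0; apply/eqP/setP => e; rewrite inE.
apply/negP => eE; have := subsetP EK _ eE; rewrite inE => /cards2P[x [y [_ exy]]].
have /eqP := regE x; rewrite cards_eq0 => /eqP/setP/(_ e).
by rewrite !inE eE exy set21.
Qed.

(** At most [d] matchings of [#|V| / 2] edges cover all [#|V| * d / 2] edges, so nothing is covered
    twice. *)
Lemma one_factorization_cover (V : finType) (E : {set {set V}}) (F : {set {set {set V}}}) d (v : V) :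
  E \subset complete V -> regular E d -> (#|F| <= d)%N ->
  {in F, forall M : {set {set V}}, M \subset E /\ partition M [set: V]} ->
  E \subset cover F -> one_factorization E F.
Proof.
move=> EK regE Fd FM EF; apply/one_factorizationP; split; last by move=> M /FM[].
have cF : cover F = E.
  by apply/eqP; rewrite eqEsubset EF andbT; apply/bigcupsP => M /FM[].
have F0 : set0 \notin F.
  apply/negP => /FM[_ /and3P[/eqP /setP/(_ v)]].
  by rewrite /cover big_set0 !inE.
apply/and3P; split=> //; first by rewrite cF.
have leq := leq_card_cover F; rewrite -leq.2 eqn_leq leq.1 /= cF.
rewrite -(leq_pmul2r (isT : 0 < 2)%N) (card_regular EK regE) big_distrl /=.
rewrite (eq_bigr (fun=> #|V|)) => [|M /FM[ME pM]]; last first.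
  by rewrite (card_perfect_matching (subset_trans ME EK) pM).
by rewrite sum_nat_const mulnC leq_mul2l Fd orbT.
Qed.

Section ShiftOrbit.
Variables (p : nat) (pP : prime p) (V : finType) (sh : 'F_p -> V -> V).
Hypothesis shift : is_shift sh.
Local Notation K := 'F_p.
Implicit Types (M : {set {set V}}) (F : {set {set {set V}}}).

Definition shift_orbit M := [set im2 (sh t) M | t : K].

Lemma shift_orbit_id M : M \in shift_orbit M.
Proof. by apply/imsetP; exists 0; rewrite // (shift0 (shift_im2 shift)). Qed.

Lemma im3_shift_orbit u M : im3 (sh u) (shift_orbit M) = shift_orbit M.
Proof.
apply/setP => N; apply/imsetP/imsetP => [[_ /imsetP[t _ ->] ->]|[t _ ->]].
  by exists (u + t); rewrite // (shiftD (shift_im2 shift)).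
exists (im2 (sh (t - u)) M); first by apply: imset_f.
by rewrite -(shiftD (shift_im2 shift)) addrC subrK.
Qed.

Lemma card_shift_orbit M : im2 (sh 1) M != M -> #|shift_orbit M| = p.
Proof.
move=> nfix; rewrite card_imset ?card_Fp //.
exact: (shift_free (shift_im2 shift)).
Qed.

Lemma shift_orbit_sub F M : im3 (sh 1) F = F -> M \in F -> shift_orbit M \subset F.
Proof.
move=> fF MF; apply/subsetP => _ /imsetP[t _ ->].
by rewrite -(shift_fix (shift_im3 shift) t (oner_neq0 _) fF) imset_f.
Qed.

Lemma im2_pair (b : V -> V) M x y : [set x; y] \in M -> [set b x; b y] \in im2 b M.
Proof. by move=> xyM; apply/imsetP; exists [set x; y]; rewrite // imsetU1 imset_set1. Qed.

End ShiftOrbit.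

Section Steps.
Variable h' : nat.
Local Notation h := h'.+1.
Local Notation p := (h.*2).+1.
Local Notation K := 'F_p.
Hypothesis pP : prime p.

Lemma step_neq0 (d : 'I_h) : (d.+1%:R : K) != 0.
Proof. by rewrite Fp_natr_eq0 // gtnNdvd //; have := ltn_ord d; lia. Qed.

Lemma step_add_neq0 (d e : 'I_h) : (d.+1%:R + e.+1%:R : K) != 0.
Proof.
by rewrite -natrD Fp_natr_eq0 // gtnNdvd //; have := ltn_ord d; have := ltn_ord e; lia.
Qed.

Lemma step_inj (d e : 'I_h) : d.+1%:R = e.+1%:R :> K -> d = e.
Proof.
move/(congr1 (@nat_of_ord _)); rewrite !val_Fp_nat // !modn_small; last 2 first.
- by have := ltn_ord e; lia.
- by have := ltn_ord d; lia.
by case=> /ord_inj.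
Qed.

(** Differences between 1 and [h] are not opposite modulo [p], so an unordered pair determines its
    difference and its starting point. *)
Lemma step_block (V : finType) (f : K -> V) u v (d e : 'I_h) : injective f ->
  [set f u; f (u + d.+1%:R)] = [set f v; f (v + e.+1%:R)] -> d = e /\ u = v.
Proof.
move=> fI /setP E; have := E (f u); have := E (f (u + d.+1%:R)).
rewrite !inE !eqxx !(inj_eq fI) orbT /=; case: (eqVneq u v) => [<- + _|uv].
  rewrite -[X in _ == X]addr0 (inj_eq (addrI u)) (negPf (step_neq0 d)) /=.
  by rewrite (inj_eq (addrI u)) => /esym/eqP/step_inj.
move=> + /esym/eqP uE; rewrite uE => /esym/orP[].
  by rewrite -addrA -[X in _ == X]addr0 (inj_eq (addrI v)) (negPf (step_add_neq0 e d)).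
by rewrite -[X in _ == X]addr0 (inj_eq (addrI _)) (negPf (step_neq0 d)).
Qed.

Lemma step_exists (u v : K) : u != v ->
  exists d : 'I_h, v = u + d.+1%:R \/ u = v + d.+1%:R.
Proof.
move=> uv; pose w : K := v - u; pose n := nat_of_ord w.
have n0 : (0 < n)%N.
  rewrite lt0n; apply: contra uv => /eqP n0; rewrite eq_sym -subr_eq0.
  by apply/eqP/ord_inj.
have np : (n < p)%N by rewrite -[X in (_ < X)%N](card_Fp pP) card_ord ltn_ord.
have nE : n%:R = v - u by rewrite natr_Zp.
case: (leqP n h) => nh.
  have dh : (n.-1 < h)%N by lia.
  by exists (Ordinal dh); left; rewrite /= prednK // nE addrC subrK.
have dh : ((p - n).-1 < h)%N by lia.
exists (Ordinal dh); right; rewrite /= prednK ?subn_gt0 // natrB ?(ltnW np) // nE.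
have -> : (p%:R : K) = 0 by apply/eqP; rewrite Fp_natr_eq0.
by rewrite sub0r opprB addrC subrK.
Qed.

End Steps.

(** * The complete graph on [p + 1] vertices *)

Definition okey (X : Type) (k : X -> nat) (o : option X) : nat :=
  if o is Some x then (k x).+1 else 0%N.

Lemma okey_inj (X : Type) (k : X -> nat) : injective k -> injective (okey k).
Proof. by move=> kI [x|] [y|] //= [/kI ->]. Qed.

Lemma omap_inj (X Y : Type) (b : X -> Y) : injective b -> injective (omap b).
Proof. by move=> bI [x|] [y|] //= [/bI ->]. Qed.

(** The added point precedes everything on both sides and creates no inversion. *)
Lemma bsign_omap (X Y : finType) (k : X -> nat) (k' : Y -> nat) (b : X -> Y) :
  injective k -> injective k' -> injective b ->
  bsign (okey k) (okey k') (omap b) = bsign k k' b.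
Proof.
move=> kI kI' bI; rewrite /bsign (pp_sub (D := Some @: [set: X])) ?subsetT //.
  rewrite pp_imset; last 2 first.
  - by move=> x y _ _ [].
  - by move=> x y _ _; apply: flipC; [exact: okey_inj|exact: okey_inj|exact: omap_inj].
  apply: eq_pairprod; first exact: rk_tournament.
  by move=> x y _ _ _; rewrite /flip /sg /= !ltnS.
have inS (x : X) : Some x \in Some @: [set: X] by rewrite imset_f.
by move=> [x|] [y|] //= _; rewrite ?inS // => _.
Qed.

Lemma card_eq_bij (V W : finType) : #|V| = #|W| -> exists b : V -> W, bijective b.
Proof.
move=> VW; exists (fun v => enum_val (cast_ord VW (enum_rank v))).
exists (fun w => enum_val (cast_ord (esym VW) (enum_rank w))) => x.
  by rewrite enum_valK cast_ordK enum_rankK.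
by rewrite enum_valK cast_ordKV enum_rankK.
Qed.

Section OnePoint.
Variable h' : nat.
Local Notation h := h'.+1.
Local Notation p := (h.*2).+1.
Local Notation K := 'F_p.
Local Notation fst_pos := (@fst_pos h').
Local Notation snd_pos := (@snd_pos h').
Local Notation pkey := (@nat_of_ord p).
Local Notation V := (option K).
Implicit Types a : {ffun 'I_h -> K}.

Definition osh (t : K) : V -> V := omap (+%R t).

Lemma osh_shift : is_shift osh.
Proof. by split=> [[x|]|t u [x|]] //=; rewrite ?add0r ?addrA. Qed.

(** The pattern of a base matching: the added point is matched with position 0, which [mirror]
    leaves alone. *)
Definition omirror (o : option 'I_p) : option 'I_p :=
  if o is Some i then if i == ord0 then None else Some (mirror i) else Some ord0.

Lemma omirror_fst d : omirror (Some (fst_pos d)) = Some (snd_pos d).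
Proof. by rewrite /= (negPf (fst_neq0 d)) mirror_fst. Qed.
Lemma omirror_snd d : omirror (Some (snd_pos d)) = Some (fst_pos d).
Proof. by rewrite /= (negPf (snd_neq0 d)) mirror_snd. Qed.

Lemma opos_ind (P : option 'I_p -> Prop) : P None -> P (Some ord0) ->
  (forall d, P (Some (fst_pos d))) -> (forall d, P (Some (snd_pos d))) -> forall o, P o.
Proof. by move=> PN P0 Pf Ps [i|//]; elim/pos_cases: i. Qed.

Lemma omirrorK : involutive omirror.
Proof. by apply: opos_ind => // d; rewrite ?omirror_fst ?omirror_snd ?omirror_fst. Qed.
Lemma omirror0 x : omirror x != x.
Proof.
elim/opos_ind: x => [//|//|d|d]; rewrite ?omirror_fst ?omirror_snd (inj_eq Some_inj).
  by rewrite eq_sym fst_neq_snd.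
by rewrite fst_neq_snd.
Qed.

Local Notation oword a := (omap (word a)).
Definition oblock a x : {set V} := [set oword a x; oword a (omirror x)].

Lemma oblock_cases a x :
  ((x = None \/ x = Some ord0) /\ oblock a x = [set None; Some 0]) \/
  exists d, (x = Some (fst_pos d) \/ x = Some (snd_pos d)) /\
    oblock a x = [set Some (a d); Some (a d + d.+1%:R)].
Proof.
elim/opos_ind: x => [||d|d]; rewrite /oblock.
- by left; split; [left|].
- by left; split; [right|rewrite setUC].
- by right; exists d; split; [left|rewrite omirror_fst /= word_fst word_snd].
- by right; exists d; split; [right|rewrite omirror_snd /= word_fst word_snd setUC].
Qed.

Hypothesis pP : prime p.

Lemma oblock_level_neq (u v : K) : [set Some u; Some v] <> [set None; Some 0] :> {set V}.
Proof. by move/setP/(_ None); rewrite !inE. Qed.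

Lemma oblock_sep a x y : oblock a x = oblock a y -> y = x \/ y = omirror x.
Proof.
case: (oblock_cases a x) => [[xE ->]|[d [xE ->]]];
  case: (oblock_cases a y) => [[yE ->]|[e [yE ->]]].
- by case: xE => ->; case: yE => ->; auto.
- by move/esym/oblock_level_neq.
- by move/oblock_level_neq.
case/(step_block pP (@Some_inj _)) => de _; move: yE; rewrite -de => yE.
by case: xE => ->; case: yE => ->; rewrite ?omirror_fst ?omirror_snd; auto.
Qed.

Lemma card_option_Fp : #|{: V}| = p.+1.
Proof. by rewrite card_option card_Fp. Qed.

Lemma regular_option : regular (complete V) p.
Proof. by have := @regular_complete V; rewrite card_option_Fp. Qed.

Lemma complete_pair (W : finType) (x y : W) : ([set x; y] \in complete W) = (x != y).
Proof. by rewrite inE cards2; case: (x != y). Qed.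

Lemma osh_spoke t u (M : {set {set V}}) : [set None; Some u] \in M ->
  [set None; Some (t + u)] \in im2 (osh t) M.
Proof. exact: (@im2_pair _ (osh t)). Qed.

Lemma osh_free (M : {set {set V}}) : partition M [set: V] -> [set None; Some 0] \in M ->
  im2 (osh 1) M != M.
Proof.
move=> pM NM; apply/eqP => fM; have := osh_spoke 1 NM; rewrite fM => N1M.
have := matching_blocks_eq pM NM N1M (set21 _ _) (set21 _ _).
move/setP/(_ (Some 0)); rewrite !inE eqxx /= (inj_eq Some_inj) addr0 => /esym.
by rewrite eq_sym oner_eq0.
Qed.

Definition ostart a : {set {set V}} := im2 (oword a) (pairing omirror).

Lemma ostartP a e : reflect (exists x, e = oblock a x) (e \in ostart a).
Proof.
have im x : oword a @: [set x; omirror x] = oblock a x by rewrite imsetU1 imset_set1.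
apply: (iffP imsetP) => [[_ /imsetP[x _ ->] ->]|[x ->]]; first by exists x.
by exists [set x; omirror x]; [exact: imset_f|].
Qed.

Lemma oword_bij a : injective (word a) -> bijective (oword a).
Proof.
move=> wI; apply: inj_card_bij; first exact: omap_inj.
by rewrite card_option_Fp card_option card_ord.
Qed.

Lemma partition_ostart a : injective (word a) -> partition (ostart a) [set: V].
Proof. by move/oword_bij => wB; rewrite (partition_im2 wB) partition_pairing //; exact: omirrorK. Qed.

Lemma ostart_hub a : [set None; Some 0] \in ostart a.
Proof. by apply/ostartP; exists None. Qed.

Lemma ostart_level a d : [set Some (a d); Some (a d + d.+1%:R)] \in ostart a.
Proof. by apply/ostartP; exists (Some (fst_pos d)); rewrite /oblock omirror_fst /= word_fst word_snd. Qed.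

Lemma ostart_complete a : injective (word a) -> ostart a \subset complete V.
Proof.
move=> wI; rewrite -(im2_complete (oword_bij wI)); apply: imsetS.
apply/subsetP => e /card_pairing; rewrite inE => -> //; exact: omirror0.
Qed.

Lemma one_factorization_ostart a : injective (word a) ->
  one_factorization (complete V) (shift_orbit osh (ostart a)).
Proof.
move=> wI; apply: (one_factorization_cover None (subxx _) regular_option).
- by apply: leq_trans (leq_imset_card _ _) _; rewrite card_Fp.
- move=> _ /imsetP[t _ ->]; have tB := shift_bij osh_shift t.
  by rewrite -[complete _](im2_complete tB) imsetS ?ostart_complete // (partition_im2 tB) partition_ostart.
have in_cover t e : e \in im2 (osh t) (ostart a) -> e \in cover (shift_orbit osh (ostart a)).
  by move=> et; apply/bigcupP; exists (im2 (osh t) (ostart a)) => //; apply: imset_f.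
have hub u : [set None; Some u] \in cover (shift_orbit osh (ostart a)).
  by apply: (in_cover u); rewrite -[u in Some u]addr0; apply: osh_spoke; exact: ostart_hub.
have level u (d : 'I_h) : [set Some u; Some (u + d.+1%:R)] \in cover (shift_orbit osh (ostart a)).
  apply: (in_cover (u - a d)); have := im2_pair (osh (u - a d)) (ostart_level a d).
  by rewrite /= addrA subrK.
apply/subsetP => e; rewrite inE => /cards2P[[x|] [[y|] [xy ->]]] //; last by rewrite setUC.
have {}xy : x != y by [].
by have [d [->|->]] := step_exists pP xy => //; rewrite setUC.
Qed.

(** The matching containing [{None, Some 0}] is moved by translation, so its [p] translates are all
    of [F]. Translating back, it contains one edge of each difference; these give the letters. *)
Lemma fixed_factorization_option F : one_factorization (complete V) F -> im3 (osh 1) F = F ->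
  exists2 a, injective (word a) & F = shift_orbit osh (ostart a).
Proof.
move=> Ff fF; have /one_factorizationP[pF pM] := Ff.
have covF e : e \in complete V -> exists2 M, M \in F & e \in M.
  by move=> eK; have /and3P[/eqP cF _ _] := pF; apply/bigcupP; rewrite -[\bigcup_(_ in _) _]/(cover F) cF.
have [M MF NM] := covF [set None; Some 0] (complete_pair None (Some 0)).
have pMM := pM _ MF.
have FE : F = shift_orbit osh M.
  apply/esym/eqP; rewrite eqEcard (shift_orbit_sub osh_shift fF MF).
  rewrite (card_shift_orbit pP osh_shift (osh_free pMM NM)).
  by rewrite (card_factorization None regular_option Ff) leqnn.
have ex (d : 'I_h) : exists u : K, [set Some u; Some (u + d.+1%:R)] \in M.
  have [|N NF eN] := covF [set Some 0; Some d.+1%:R].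
    by rewrite complete_pair (inj_eq Some_inj) eq_sym step_neq0.
  move: NF eN; rewrite FE => /imsetP[t _ ->] /(im2_pair (osh (- t))).
  rewrite -(shiftD (shift_im2 osh_shift)) addNr (shift0 (shift_im2 osh_shift)) /= addr0.
  by exists (- t).
have [f fP] := fin_all_exists ex; pose a := [ffun d => f d].
have bM x : oblock a x \in M.
  by have [[_ ->//]|[d [_ ->]]] := oblock_cases a x; rewrite ffunE.
have MK : M \subset complete V.
  by have /and3P[/eqP <- _ _] := pF; apply: bigcup_sup.
have cD : #|{: option 'I_p}| = #|{: V}| by rewrite card_option_Fp card_option card_ord.
have wB := block_bij MK pMM cD bM (@oblock_sep a).
exists a; first by move=> i j ij; apply: Some_inj; apply: (bij_inj wB) => /=; rewrite ij.
by rewrite FE /ostart (im2_blocks omirrorK MK pMM cD bM (@oblock_sep a)).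
Qed.

Lemma shift_orbit_ostart_inj a a' : injective (word a) -> injective (word a') ->
  shift_orbit osh (ostart a) = shift_orbit osh (ostart a') -> a = a'.
Proof.
move=> wI wI' E; have : ostart a \in shift_orbit osh (ostart a').
  by rewrite -E shift_orbit_id //; exact: osh_shift.
case/imsetP => t _ aE.
have := osh_spoke t (ostart_hub a'); rewrite -aE => tM.
have := matching_blocks_eq (partition_ostart wI) (ostart_hub a) tM (set21 _ _) (set21 _ _).
move/setP/(_ (Some 0)); rewrite !inE eqxx /= (inj_eq Some_inj) addr0 => /esym/eqP t0.
move: aE; rewrite -t0 (shift0 (shift_im2 osh_shift)) => aE.
apply/ffunP => d; have := ostart_level a d; rewrite aE => /ostartP[x].
have [[_ ->] /oblock_level_neq//|[e [_ ->]]] := oblock_cases a' x.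
by case/(step_block pP (@Some_inj _)) => ->.
Qed.

Definition ostep_sign (a : {ffun 'I_h -> K}) : int :=
  \prod_(e in pairing omirror) pp e (fun x y => sg (okey pkey) x y *
    \prod_t sg (okey (@kkey h')) (osh t (oword a x)) (osh t (oword a y))).

(** A block meets its sign at all translates, so its own starting letter disappears under
    reindexing. *)
Lemma ostep_sign_const a a' : ostep_sign a = ostep_sign a'.
Proof.
apply: eq_bigr => e /imsetP[x _ ->]; apply: eq_pairprod; first exact: rk_tournament.
have step b y : \prod_t sg (okey (@kkey h')) (osh t (oword b y)) (osh t (oword b (omirror y))) =
   \prod_t sg (okey (@kkey h')) (osh t (oword a' y)) (osh t (oword a' (omirror y))).
  elim/opos_ind: y => [||d|d]; rewrite ?omirror_fst ?omirror_snd /= ?word_fst ?word_snd //.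
    rewrite (reindex_inj (addIr (- b d))) [RHS](reindex_inj (addIr (- a' d))) /=.
    by apply: eq_bigr => t _; rewrite !addrA !subrK.
  rewrite (reindex_inj (addIr (- b d))) [RHS](reindex_inj (addIr (- a' d))) /=.
  by apply: eq_bigr => t _; rewrite !addrA !subrK.
move=> y z /set2P[]-> /set2P[]-> yz; first by rewrite eqxx in yz.
- by rewrite step.
- by have := step a (omirror x); rewrite omirrorK => ->.
- by rewrite eqxx in yz.
Qed.

Lemma ostep_sign_sqr a : ostep_sign a * ostep_sign a = 1.
Proof.
rewrite -big_split big1 // => e _; apply: pairprod_sqr1; first exact: rk_tournament.
move=> x y _ _ _; rewrite mulrACA sg_sqr mul1r -big_split big1 // => t _.
exact: sg_sqr.
Qed.

Lemma Ssum_option_Fp : Ssum (okey (@kkey h')) (complete V) != 0.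
Proof.
have p_odd : odd p by rewrite /= odd_double.
have kI : injective (okey (@kkey h')) := okey_inj (@kkey_inj h').
have dI : injective (okey pkey) := okey_inj (@ord_inj p).
pose c := msign (okey pkey) (pairing omirror) * ostep_sign 0.
have c2 : c * c = 1 by rewrite mulrACA msign_sqr ostep_sign_sqr.
have SE : (Ssum (okey (@kkey h')) (complete V))%:~R = c%:~R * starter_sum h' :> K.
  rewrite (Ssum_fixed pP p_odd kI osh_shift None (subxx _) regular_option); last first.
    by move=> u; apply: im2_complete; exact: (shift_bij osh_shift).
  rewrite (eq_bigl (mem [set shift_orbit osh (ostart a) | a in [set a | injectiveb (word a)]])); last first.
    move=> F; apply/andP/imsetP => [[Ff /eqP fF]|[a + ->]].
      have [a wI FE] := fixed_factorization_option Ff fF.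
      by exists a => //; rewrite inE; apply/injectiveP.
    rewrite inE => /injectiveP wI; rewrite one_factorization_ostart //.
    by rewrite (im3_shift_orbit osh_shift).
  rewrite big_imset /=; last first.
    by move=> a a'; rewrite !inE => /injectiveP wI /injectiveP wI'; exact: shift_orbit_ostart_inj.
  rewrite /starter_sum mulr_sumr; apply: eq_big => [a|a]; rewrite inE //.
  move=> /injectiveP wI; rewrite -intrM; congr (_%:~R).
  rewrite (fsign_orbit pP p_odd kI osh_shift dI omirrorK omirror0 (oword_bij wI)); last first.
    apply: (shift_free (shift_im2 osh_shift)).
    by apply: osh_free; [exact: partition_ostart|exact: ostart_hub].
  rewrite -/(ostep_sign a) (ostep_sign_const a 0) (bsign_omap (@ord_inj p) (@kkey_inj h') wI).
  by rewrite /c mulrAC.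
apply/eqP => S0; have := starter_sum_sqr pP.
have -> : starter_sum h' = 0.
  rewrite -[LHS]mul1r -[1]/(1%:~R) -c2 rmorphM /= -mulrA -SE S0.
  by rewrite mulr0.
by rewrite mul0r => /eqP; rewrite eq_sym oner_eq0.
Qed.

End OnePoint.

Lemma Ssum_complete_succ_prime (p : nat) (V : finType) (kap : V -> nat) :
  prime p -> odd p -> #|V| = p.+1 -> injective kap -> Ssum kap (complete V) != 0.
Proof.
move=> pP po cV kI; have p1 := prime_gt1 pP.
have [h' pE] : exists h', p = (h'.+1.*2).+1.
  exists (p./2).-1; have := odd_double_half p; rewrite po.
  by case: p./2 => [|j] E; [rewrite -E in p1 | rewrite -{1}E].
subst p.
have [b bB] : exists b : option 'F_(h'.+1.*2).+1 -> V, bijective b.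
  by apply: card_eq_bij; rewrite card_option_Fp.
rewrite (Ssum_complete bB (okey_inj (@kkey_inj h')) kI) ?card_option_Fp //.
  exact: Ssum_option_Fp.
by rewrite /= odd_double.
Qed.

(** * The complete graph on [2 p] vertices minus a matching *)

Definition lkey (X : Type) (m : nat) (k : X -> nat) (x : bool * X) : nat := (x.1 * m + k x.2)%N.

Section Levels.
Variables (X Y : finType) (m m' : nat) (k : X -> nat) (k' : Y -> nat) (b : bool -> X -> Y).
Hypotheses (kI : injective k) (kI' : injective k') (km : forall x, (k x < m)%N)
  (km' : forall y, (k' y < m')%N) (bI : forall l, injective (b l)).

Lemma lkey_inj : injective (lkey m k).
Proof.
move=> [[] x] [[] y]; rewrite /lkey /= ?mul1n ?mul0n ?add0n.
- by move/addnI/kI ->.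
- by move=> E; have := km y; rewrite -E ltnNge leq_addr.
- by move=> E; have := km x; rewrite E ltnNge leq_addr.
- by move/kI ->.
Qed.

Lemma sg_lkey_same l x y : sg (lkey m k) (l, x) (l, y) = sg k x y.
Proof. by rewrite /sg /lkey /= ltn_add2l. Qed.

Lemma sg_lkey_cross x y : sg (lkey m k) (false, x) (true, y) = 1.
Proof. by rewrite /sg /lkey /= mul0n add0n mul1n (leq_trans (km x) (leq_addr _ _)). Qed.

End Levels.

(** Pairs on different levels are never inverted, so the sign is computed level by level. *)
Lemma bsign_levels (X Y : finType) (m m' : nat) (k : X -> nat) (k' : Y -> nat) (b : bool -> X -> Y) :
  injective k -> injective k' -> (forall x, k x < m)%N -> (forall y, k' y < m')%N ->
  (forall l, injective (b l)) ->
  bsign (lkey m k) (lkey m' k') (fun x => (x.1, b x.1 x.2)) = bsign k k' (b false) * bsign k k' (b true).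
Proof.
move=> kI kI' km km' bI; set B := fun x => _.
have BI : injective B by move=> [l x] [l' y] [<- /bI ->].
have lI := lkey_inj kI km; have lI' := lkey_inj kI' km'.
have cross x y : flip (lkey m k) (lkey m' k') B (false, x) (true, y) = 1.
  by rewrite /flip !sg_lkey_cross.
rewrite /bsign (pp_fib fst) => [|x y _ _]; last exact: flipC.
rewrite [X in _ * X]pairprod1 ?mulr1 => [||l l' _ _ ll']; last 2 first.
- exact: rk_tournament.
- rewrite big1 // => -[l1 x] /andP[_ /= /eqP E1]; rewrite big1 // => -[l2 y] /andP[_ /= /eqP E2].
  by move: ll'; rewrite -E1 -E2; case: l1 {E1} => //; case: l2 {E2} => // _; rewrite flipC.
have level l : pp [set x in setT | x.1 == l] (flip (lkey m k) (lkey m' k') B) = bsign k k' (b l).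
  have -> : [set x in setT | x.1 == l] = (pair l) @: [set: X].
    apply/setP => -[l' x]; rewrite !inE /=; apply/eqP/imsetP => [->|[y _ [-> _]] //]; by exists x.
  rewrite pp_imset; last 2 first.
  - by move=> x y _ _ [].
  - by move=> x y _ _; exact: flipC.
  apply: eq_pairprod; first exact: rk_tournament.
  by move=> x y _ _ _; rewrite /flip /= !sg_lkey_same.
by rewrite big_bool /= !level mulrC.
Qed.

Section TwoLevels.
Variable h' : nat.
Local Notation h := h'.+1.
Local Notation p := (h.*2).+1.
Local Notation K := 'F_p.
Local Notation fst_pos := (@fst_pos h').
Local Notation snd_pos := (@snd_pos h').
Local Notation pkey := (@nat_of_ord p).
Local Notation V := (bool * K)%type.
Local Notation A := {ffun 'I_h -> K}.
Local Notation vkey := (lkey p (@kkey h')).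
Local Notation dkey := (lkey p pkey).

Definition lsh (t : K) (x : V) : V := (x.1, t + x.2).

Lemma lsh_shift : is_shift lsh.
Proof. by split=> [[l x]|t u [l x]]; rewrite /lsh /= ?add0r ?addrA. Qed.

(** These turn out to be the translation-invariant perfect matchings; [cross 0] plays the part of
    the removed matching. *)
Definition cross (j : K) : {set {set V}} := [set [set (false, x); (true, j + x)] | x : K].

Definition lmirror (x : bool * 'I_p) : bool * 'I_p :=
  if x.2 == ord0 then (~~ x.1, ord0) else (x.1, mirror x.2).

Lemma lmirror0 l : lmirror (l, ord0) = (~~ l, ord0). Proof. by []. Qed.
Lemma lmirror_fst l d : lmirror (l, fst_pos d) = (l, snd_pos d).
Proof. by rewrite /lmirror /= (negPf (fst_neq0 d)) mirror_fst. Qed.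
Lemma lmirror_snd l d : lmirror (l, snd_pos d) = (l, fst_pos d).
Proof. by rewrite /lmirror /= (negPf (snd_neq0 d)) mirror_snd. Qed.

Lemma lpos_ind (P : bool * 'I_p -> Prop) : (forall l, P (l, ord0)) ->
  (forall l d, P (l, fst_pos d)) -> (forall l d, P (l, snd_pos d)) -> forall x, P x.
Proof. by move=> P0 Pf Ps [l i]; elim/pos_cases: i. Qed.

Lemma lmirrorK : involutive lmirror.
Proof.
by apply: lpos_ind => [l|l d|l d];
  rewrite ?lmirror_fst ?lmirror_snd ?lmirror_fst // !lmirror0 negbK.
Qed.
Lemma lmirror_neq x : lmirror x != x.
Proof.
elim/lpos_ind: x => [l|l d|l d]; rewrite ?lmirror0 ?lmirror_fst ?lmirror_snd xpair_eqE ?eqxx /=.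
- by case: l.
- by rewrite eq_sym fst_neq_snd.
- by rewrite fst_neq_snd.
Qed.

(** The parameter [u] holds the difference [u.1] of the one edge of the base matching between the
    copies, then a word for each copy. The upper word is translated by [u.1] so that this edge joins
    the two initial letters. *)
Definition offset (u : K * (A * A)) (l : bool) : K := if l then u.1 else 0.
Definition letters (u : K * (A * A)) (l : bool) : A := if l then u.2.2 else u.2.1.
Definition lword u (x : bool * 'I_p) : V := (x.1, offset u x.1 + word (letters u x.1) x.2).
Definition lblock u x : {set V} := [set lword u x; lword u (lmirror x)].
Definition rung u d l : {set V} :=
  [set (l, offset u l + letters u l d); (l, offset u l + letters u l d + d.+1%:R)].
Definition hub (k : K) : {set V} := [set (false, 0); (true, k)].

Lemma lblock0 u l : lblock u (l, ord0) = hub u.1.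
Proof.
rewrite /lblock /hub /lword lmirror0 /= !addr0.
by case: l; rewrite /offset /= // setUC.
Qed.
Lemma lblock_fst u l d : lblock u (l, fst_pos d) = rung u d l.
Proof. by rewrite /lblock /lword lmirror_fst /= word_fst word_snd addrA. Qed.
Lemma lblock_snd u l d : lblock u (l, snd_pos d) = rung u d l.
Proof. by rewrite /lblock /lword lmirror_snd /= word_fst word_snd addrA setUC. Qed.

Lemma level_cross_neq (l : bool) (x y z t : K) :
  [set (l, x); (l, y)] <> [set (false, z); (true, t)] :> {set V}.
Proof.
move/setP => E; have := E (false, z); have := E (true, t).
by rewrite !inE !xpair_eqE !eqxx orbT /=; case: l {E}.
Qed.

Lemma level_level (l m : bool) (x y z t : K) :
  [set (l, x); (l, y)] = [set (m, z); (m, t)] :> {set V} -> l = m.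
Proof. by move/setP/(_ (l, x)); rewrite !inE !xpair_eqE !eqxx /= => /esym/orP[] /andP[/eqP]. Qed.

Hypothesis pP : prime p.

Lemma rung_eq u v d e l m : rung u d l = rung v e m ->
  [/\ l = m, d = e & offset u l + letters u l d = offset v l + letters v l d].
Proof.
move=> E; have lm := level_level E; move: E; rewrite -lm {lm}.
have pairI : injective (pair l : K -> V) by move=> x y [].
by case/(@step_block h' pP _ _ _ _ _ _ pairI) => <- ->.
Qed.

Lemma lblock_sep u x y : lblock u x = lblock u y -> y = x \/ y = lmirror x.
Proof.
elim/lpos_ind: x => [l|l d|l d]; elim/lpos_ind: y => [m|m e|m e];
  rewrite ?lblock0 ?lblock_fst ?lblock_snd => E.
- by rewrite lmirror0; case: l {E}; case: m; auto.
- by case: (level_cross_neq (esym E)).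
- by case: (level_cross_neq (esym E)).
- by case: (level_cross_neq E).
- by case: (rung_eq E) => -> ->; auto.
- by case: (rung_eq E) => -> ->; rewrite lmirror_fst; auto.
- by case: (level_cross_neq E).
- by case: (rung_eq E) => -> ->; rewrite lmirror_snd; auto.
- by case: (rung_eq E) => -> ->; auto.
Qed.

Lemma card_levels : #|{: V}| = p.*2.
Proof. by rewrite card_prod card_bool card_Fp // mul2n. Qed.

Lemma mem_cross j x y : ([set (false, x); (true, y)] \in cross j) = (y == j + x).
Proof.
apply/imsetP/eqP => [[z _ /setP E]|->]; last by exists x.
have := E (false, x); have := E (true, y); rewrite !inE !xpair_eqE !eqxx /= orbF.
by move=> /esym/eqP -> /esym/eqP ->.
Qed.

Lemma level_cross j l x y : [set (l, x); (l, y)] \notin cross j.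
Proof. by apply/imsetP => -[z _ /level_cross_neq]. Qed.

Lemma cross_complete j : cross j \subset complete V.
Proof. by apply/subsetP => _ /imsetP[x _ ->]; rewrite complete_pair. Qed.

Definition twist (j : K) (x : V) : V := (x.1, (if x.1 then j + x.2 else x.2)).

Lemma twist_inj j : injective (twist j).
Proof.
move=> [l x] [m y] E; have lm : l = m := congr1 fst E; have := congr1 snd E.
by rewrite /= lm; case: m {lm E} => [/addrI|] ->.
Qed.

Lemma im2_twist j : im2 (twist j) (cross 0) = cross j.
Proof.
rewrite /im2 /cross -imset_comp; apply: eq_imset => x /=.
by rewrite imsetU1 imset_set1 /twist /= add0r.
Qed.

Lemma partition_cross0 : partition (cross 0) [set: V].
Proof.
pose G (x : V) : V := (~~ x.1, x.2).
have GK : involutive G by move=> [l x]; rewrite /G negbK.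
have -> : cross 0 = pairing G; last exact: partition_pairing.
apply/setP => e; apply/imsetP/imsetP => [[x _ ->]|[[l x] _ ->]].
  by exists (false, x); rewrite // add0r.
by exists x; rewrite // add0r /G /=; case: l; rewrite //= setUC.
Qed.

Lemma partition_cross j : partition (cross j) [set: V].
Proof. by rewrite -im2_twist (partition_im2 (injF_bij (@twist_inj j))) partition_cross0. Qed.

Lemma im2_lsh_cross t j : im2 (lsh t) (cross j) = cross j.
Proof.
apply: subset_matching (cross_complete j) _ (partition_cross j) _.
  by rewrite (partition_im2 (shift_bij lsh_shift t)) partition_cross.
apply/subsetP => _ /imsetP[_ /imsetP[x _ ->] ->].
by rewrite imsetU1 imset_set1 /lsh /= mem_cross addrCA.
Qed.

Lemma cross_inj : injective cross.
Proof.
move=> i j E; have := mem_cross i 0 i; rewrite E mem_cross !addr0 eqxx => /eqP.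
by move=> ->.
Qed.

Local Notation E := (complete V :\: cross 0).

Lemma regular_levels : regular E (p.*2).-2.
Proof. by have := regularD (cross_complete 0) (partition_cross 0) (@regular_complete V); rewrite card_levels. Qed.

Lemma im2_lsh_E t : im2 (lsh t) E = E.
Proof.
have tB := shift_bij lsh_shift t.
by rewrite (im2D tB) (im2_complete tB) im2_lsh_cross.
Qed.

Lemma level_E l x y : ([set (l, x); (l, y)] \in E) = (x != y).
Proof. by rewrite inE level_cross complete_pair xpair_eqE eqxx. Qed.

Lemma crosspair_E x y : ([set (false, x); (true, y)] \in E) = (x != y).
Proof. by rewrite inE mem_cross complete_pair xpair_eqE andbT add0r eq_sym. Qed.

Lemma cross_E j : j != 0 -> cross j \subset E.
Proof.
move=> j0; apply/subsetP => _ /imsetP[x _ ->]; rewrite crosspair_E.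
by rewrite -{1}[x]add0r (inj_eq (addIr x)) eq_sym.
Qed.

Lemma lsh_pair t (M : {set {set V}}) l m x y : [set (l, x); (m, y)] \in M ->
  [set (l, t + x); (m, t + y)] \in im2 (lsh t) M.
Proof. exact: (@im2_pair _ (lsh t)). Qed.

(** Translated by its own difference, an edge inside a copy meets itself in exactly one vertex, so
    an invariant matching cannot contain it. *)
Lemma level_free (M : {set {set V}}) l x y : partition M [set: V] ->
  [set (l, x); (l, y)] \in M -> x != y -> im2 (lsh 1) M != M.
Proof.
move=> pM eM xy; apply/eqP => fM.
have fMt t : im2 (lsh t) M = M.
  by apply: (shift_fix (shift_im2 lsh_shift) t (oner_neq0 _) fM).
have main z (d : 'I_h) : [set (l, z); (l, z + d.+1%:R)] \notin M.
  apply/negP => zM; have := lsh_pair d.+1%:R zM; rewrite fMt addrC [_ + (_ + _)]addrC => zM'.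
  have pairI : injective (pair l : K -> V) by move=> ? ? /(congr1 snd).
  have := matching_blocks_eq pM zM zM' (set22 _ _) (set21 _ _).
  case/(@step_block h' pP _ _ _ _ _ _ pairI) => _ /eqP.
  by rewrite -{1}[z]addr0 (inj_eq (addrI z)) eq_sym (negPf (step_neq0 pP d)).
have [d [yE|xE]] := step_exists pP xy.
  by move: eM; rewrite yE (negPf (main _ _)).
by move: eM; rewrite setUC xE (negPf (main _ _)).
Qed.

Lemma cross_of_fixed (M : {set {set V}}) : M \subset E -> partition M [set: V] ->
  im2 (lsh 1) M = M -> exists2 j, j != 0 & M = cross j.
Proof.
move=> ME pM fM; have /and3P[/eqP cM _ _] := pM.
have /bigcupP[e eM ve] : (false, 0) \in cover M by rewrite cM inE.
have MK := subset_trans ME (subsetDl _ _).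
have [[m y] xy eE] : exists2 w : V, (false, 0) != w & e = [set (false, 0); w].
  have := subsetP MK _ eM; rewrite inE => /cards2P[a [b [ab eE]]].
  move: ve; rewrite eE => /set2P[] ->; first by exists b.
  by exists a; rewrite 1?eq_sym // setUC.
case: m => [|] in xy eE; last first.
  have := level_free pM (l := false) (x := 0) (y := y).
  by rewrite -eE fM eqxx => /(_ eM); move: xy; rewrite xpair_eqE /= => -> /(_ isT).
rewrite {}eE in eM; exists y.
  by have := subsetP ME _ eM; rewrite crosspair_E eq_sym.
apply/esym; apply: (subset_matching MK (partition_cross y) pM).
apply/subsetP => _ /imsetP[x _ ->].
rewrite -(shift_fix (shift_im2 lsh_shift) x (oner_neq0 _) fM).
by have := lsh_pair x eM; rewrite addr0 addrC.
Qed.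

Definition lstart u : {set {set V}} := im2 (lword u) (pairing lmirror).
Definition valid (u : K * (A * A)) :=
  [&& u.1 != 0, injectiveb (word u.2.1) & injectiveb (word u.2.2)].
(** The [p] translates of the base matching use up all edges inside the copies and the cross edges
    of difference [u.1]. The other [p - 2] nonzero differences each give one invariant matching, in
    total [2 p - 2]. *)
Definition lfact u : {set {set {set V}}} :=
  shift_orbit lsh (lstart u) :|: [set cross j | j in ~: [set 0; u.1]].

Lemma lstartP u e : reflect (exists x, e = lblock u x) (e \in lstart u).
Proof.
have im x : lword u @: [set x; lmirror x] = lblock u x by rewrite imsetU1 imset_set1.
apply: (iffP imsetP) => [[_ /imsetP[x _ ->] ->]|[x ->]]; first by exists x.
by exists [set x; lmirror x]; [exact: imset_f|].
Qed.

Lemma hub_start u : hub u.1 \in lstart u.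
Proof. by apply/lstartP; exists (false, ord0); rewrite lblock0. Qed.
Lemma rung_start u d l : rung u d l \in lstart u.
Proof. by apply/lstartP; exists (l, fst_pos d); rewrite lblock_fst. Qed.

Lemma lstart_cases u e : e \in lstart u -> e = hub u.1 \/ exists d l, e = rung u d l.
Proof.
case/lstartP => x ->; elim/lpos_ind: x => [l|l d|l d]; first by left; rewrite lblock0.
  by right; exists d, l; rewrite lblock_fst.
by right; exists d, l; rewrite lblock_snd.
Qed.

Lemma valid_word u l : valid u -> injective (word (letters u l)).
Proof. by case/and3P => _ /injectiveP i0 /injectiveP i1; case: l. Qed.

Lemma lword_inj u : (forall l, injective (word (letters u l))) -> injective (lword u).
Proof.
move=> wI [l i] [m j] E; have lm : l = m := congr1 fst E; have := congr1 snd E.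
by rewrite /= lm => /addrI/wI ->.
Qed.

Lemma lword_bij u : valid u -> bijective (lword u).
Proof.
move=> vu; apply: inj_card_bij; first by apply: lword_inj => l; exact: valid_word.
by rewrite card_levels card_prod card_bool card_ord mul2n.
Qed.

Lemma partition_lstart u : valid u -> partition (lstart u) [set: V].
Proof. by move/lword_bij => wB; rewrite (partition_im2 wB) partition_pairing //; exact: lmirrorK. Qed.

Lemma rung_lt u d l : offset u l + letters u l d != offset u l + letters u l d + d.+1%:R.
Proof. by rewrite -{1}[_ + _]addr0 (inj_eq (addrI _)) eq_sym step_neq0. Qed.

Lemma lstart_E u : valid u -> lstart u \subset E.
Proof.
case/and3P => u0 _ _; apply/subsetP => e /lstart_cases[->|[d [l ->]]].
  by rewrite crosspair_E eq_sym.
by rewrite level_E rung_lt.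
Qed.

Lemma lstart_free u : valid u -> im2 (lsh 1) (lstart u) != lstart u.
Proof.
move=> vu; have d0 : 'I_h := ord0.
exact: level_free (partition_lstart vu) (rung_start u d0 false) (rung_lt _ _ _).
Qed.

Lemma orbit_free u M : valid u -> M \in shift_orbit lsh (lstart u) -> im2 (lsh 1) M != M.
Proof.
move=> vu /imsetP[t _ ->]; rewrite -!(shiftD (shift_im2 lsh_shift)) addrC.
rewrite (shiftD (shift_im2 lsh_shift)) (inj_eq (@shift_inj _ _ _ (shift_im2 lsh_shift) t)).
exact: lstart_free.
Qed.

Lemma orbit_cross u j : valid u -> cross j \notin shift_orbit lsh (lstart u).
Proof. by move=> vu; apply/negP => /(orbit_free vu); rewrite im2_lsh_cross eqxx. Qed.

Lemma card_other (k : K) : k != 0 -> #|~: [set 0; k]| = p.-2.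
Proof. by move=> k0; rewrite cardsCs setCK cards2 eq_sym k0 card_Fp. Qed.

Lemma one_factorization_lfact u : valid u -> one_factorization E (lfact u).
Proof.
move=> vu; have u0 : u.1 != 0 by case/and3P: vu.
apply: (one_factorization_cover (false, 0) (subsetDl _ _) regular_levels).
- apply: leq_trans (leq_card_setU _ _) _; rewrite card_shift_orbit //; last 2 first.
  + exact: lsh_shift.
  + exact: lstart_free.
  apply: leq_trans (leq_add (leqnn _) (leq_imset_card _ _)) _.
  by rewrite card_other //= -addnn; lia.
- move=> M /setUP[/imsetP[t _ ->]|/imsetP[j + ->]]; last first.
    by rewrite !inE negb_or => /andP[j0 _]; rewrite cross_E ?partition_cross.
  split; first by rewrite -(im2_lsh_E t) imsetS ?lstart_E.
  by rewrite (partition_im2 (shift_bij lsh_shift t)) partition_lstart.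
have in_orbit t e : e \in im2 (lsh t) (lstart u) -> e \in cover (lfact u).
  move=> et; apply/bigcupP; exists (im2 (lsh t) (lstart u)) => //.
  by apply/setUP; left; apply: imset_f.
have level l x (d : 'I_h) : [set (l, x); (l, x + d.+1%:R)] \in cover (lfact u).
  apply: (in_orbit (x - (offset u l + letters u l d))).
  have := rung_start u d l; rewrite /rung; move: (offset _ _ + _) => z /(lsh_pair (x - z)).
  by rewrite addrA subrK.
have crossp x y : x != y -> [set (false, x); (true, y)] \in cover (lfact u).
  move=> xy; case: (eqVneq (y - x) u.1) => [yx|yx].
    apply: (in_orbit x); have := lsh_pair x (hub_start u).
    by rewrite addr0 -yx addrC subrK.
  apply/bigcupP; exists (cross (y - x)); last by rewrite mem_cross subrK.
  apply/setUP; right; apply: imset_f.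
  by rewrite !inE negb_or yx subr_eq0 eq_sym xy.
apply/subsetP => e eE; have := subsetP (subsetDl _ _) _ eE.
rewrite inE => /cards2P[[l x] [[m y] [xy eE']]]; rewrite {}eE' in eE *.
case: (eqVneq l m) => [lm|]; last first.
  case: l m {xy} eE => [] [] // eE _; last by apply: crossp; rewrite -crosspair_E.
  by rewrite setUC; apply: crossp; rewrite -crosspair_E setUC.
rewrite -lm {m lm xy} in eE *; move: eE; rewrite level_E => xy.
by have [d [->|->]] := step_exists pP xy => //; rewrite setUC.
Qed.

Lemma im3_lfact u : im3 (lsh 1) (lfact u) = lfact u.
Proof.
rewrite /im3 /lfact imsetU; congr (_ :|: _); first exact: (im3_shift_orbit lsh_shift).
by rewrite -imset_comp; apply: eq_imset => j; exact: im2_lsh_cross.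
Qed.

(** * The translation-invariant factorizations on two copies *)

Section Classification.
Variable F : {set {set {set V}}}.
Hypotheses (Ff : one_factorization E F) (fF : im3 (lsh 1) F = F).

Lemma member_partition M : M \in F -> partition M [set: V].
Proof. by have /one_factorizationP[_ pM] := Ff; exact: pM. Qed.

Lemma member_sub M : M \in F -> M \subset E.
Proof. by have /one_factorizationP[/and3P[/eqP <- _ _] _] := Ff; exact: bigcup_sup. Qed.

Lemma member_exists e : e \in E -> exists2 M, M \in F & e \in M.
Proof. by have /one_factorizationP[/and3P[/eqP <- _ _] _] := Ff; move/bigcupP. Qed.

Lemma card_members : #|F| = (p.*2).-2.
Proof. exact: card_factorization (false, 0) regular_levels Ff. Qed.

Lemma orbit_unfixed M N : im2 (lsh 1) M != M -> N \in shift_orbit lsh M -> im2 (lsh 1) N != N.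
Proof.
move=> nM /imsetP[t _ ->]; rewrite -!(shiftD (shift_im2 lsh_shift)) addrC.
by rewrite (shiftD (shift_im2 lsh_shift)) (inj_eq (@shift_inj _ _ _ (shift_im2 lsh_shift) t)).
Qed.

(** Two disjoint orbits of size [p] do not fit into [2 p - 2] matchings. *)
Lemma one_unfixed_orbit M N : M \in F -> N \in F -> im2 (lsh 1) M != M ->
  im2 (lsh 1) N != N -> N \in shift_orbit lsh M.
Proof.
move=> MF NF nM nN; apply: contraT => NM.
have dis : [disjoint shift_orbit lsh M & shift_orbit lsh N].
  apply/pred0P => X; apply/negP => /andP[/= /imsetP[t _ Mt] /imsetP[u _ Nu]].
  case/negP: NM; apply/imsetP; exists (t - u) => //.
  apply: (@shift_inj _ _ _ (shift_im2 lsh_shift) u).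
  by rewrite -Nu Mt -(shiftD (shift_im2 lsh_shift)) addrC subrK.
have : (#|shift_orbit lsh M :|: shift_orbit lsh N| <= #|F|)%N.
  by apply: subset_leq_card; rewrite subUset !(shift_orbit_sub lsh_shift fF).
rewrite cardsU (disjoint_setI0 dis) cards0 subn0 !(card_shift_orbit pP lsh_shift) //.
by rewrite card_members -addnn; lia.
Qed.

Lemma fixed_factorization_levels : exists2 u, valid u & F = lfact u.
Proof.
pose J := [set j | cross j \in F].
have J0 : 0 \notin J.
  rewrite inE; apply/negP => /member_sub/subsetP/(_ [set (false, 0); (true, 0)]).
  by rewrite mem_cross addr0 eqxx crosspair_E eqxx => /(_ isT).
have unfixed M : M \in F -> im2 (lsh 1) M != M -> [disjoint shift_orbit lsh M & cross @: J].
  move=> MF nM; apply/pred0P => X; apply/negP => /andP[/= /(orbit_unfixed nM) + /imsetP[j _ Xj]].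
  by rewrite Xj im2_lsh_cross eqxx.
have crossF : cross @: J \subset F by apply/subsetP => _ /imsetP[j + ->]; rewrite inE.
have cardJ M : M \in F -> im2 (lsh 1) M != M -> (p + #|J| <= (p.*2).-2)%N.
  move=> MF nM; have : (#|shift_orbit lsh M :|: cross @: J| <= #|F|)%N.
    by apply: subset_leq_card; rewrite subUset (shift_orbit_sub lsh_shift fF MF).
  rewrite cardsU (disjoint_setI0 (unfixed _ MF nM)) cards0 subn0 (card_shift_orbit pP lsh_shift nM).
  by rewrite card_members (card_imset _ cross_inj).
(* An edge inside a copy lies in a moved matching, whose orbit takes [p] of the [2 p - 2] places;
   the [p - 1] nonzero differences cannot all be in [J]. *)
have [k k0 kJ] : exists2 k, k != 0 & k \notin J.
  have [|M1 M1F e1] := @member_exists [set (false, 0); (false, 1)].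
    by rewrite level_E eq_sym oner_neq0.
  have nM1 : im2 (lsh 1) M1 != M1.
    by apply: level_free (member_partition M1F) e1 _; rewrite eq_sym oner_neq0.
  have /subsetPn[k] : ~~ ([set~ 0] \subset J).
    apply/negP => /subset_leq_card; rewrite cardsC1 card_Fp //= => le.
    by have := cardJ _ M1F nM1; move: #|J| le => n; rewrite -addnn; lia.
  by rewrite !inE => k0 kJ; exists k; rewrite ?inE.
have [|M MF hM] := @member_exists (hub k); first by rewrite crosspair_E eq_sym.
have nM : im2 (lsh 1) M != M.
  apply: contra kJ => /eqP/(cross_of_fixed (member_sub MF) (member_partition MF))[j _ Mj].
  by move: hM; rewrite Mj mem_cross addr0 inE => /eqP ->; rewrite -Mj.
have FE : F = shift_orbit lsh M :|: cross @: J.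
  apply/eqP; rewrite eqEsubset subUset crossF (shift_orbit_sub lsh_shift fF MF) !andbT.
  apply/subsetP => N NF; apply/setUP; case: (eqVneq (im2 (lsh 1) N) N) => fN; last first.
    by left; exact: one_unfixed_orbit.
  have [j _ Nj] := cross_of_fixed (member_sub NF) (member_partition NF) fN.
  by right; rewrite Nj; apply: imset_f; rewrite inE -Nj.
have JE : J = ~: [set 0; k].
  apply/eqP; rewrite eqEcard card_other //; apply/andP; split.
    apply/subsetP => j jJ; rewrite !inE negb_or; apply/andP; split.
      by apply: contraNneq J0 => <-.
    by apply: contraNneq kJ => <-.
  have : (#|F| <= p + #|J|)%N.
    rewrite FE (leq_trans (leq_card_setU _ _)) // (card_shift_orbit pP lsh_shift nM) leq_add2l.
    exact: leq_imset_card.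
  by rewrite card_members -addnn; lia.
have ex (ld : bool * 'I_h) : exists x, [set (ld.1, x); (ld.1, x + ld.2.+1%:R)] \in M.
  case: ld => l d; have [|N NF eN] := @member_exists [set (l, 0); (l, d.+1%:R)].
    by rewrite level_E eq_sym step_neq0.
  have nN : im2 (lsh 1) N != N.
    by apply: level_free (member_partition NF) eN _; rewrite eq_sym step_neq0.
  have /imsetP[t _ NE] := one_unfixed_orbit MF NF nM nN.
  exists (- t); have := lsh_pair (- t) eN.
  by rewrite NE -(shiftD (shift_im2 lsh_shift)) addNr (shift0 (shift_im2 lsh_shift)) addr0.
have [f fP] := fin_all_exists ex.
(* The upper letters are reduced by [k] because [offset] adds it back. *)
pose u : K * (A * A) := (k, ([ffun d => f (false, d)], [ffun d => f (true, d) - k])).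
have uE l d : offset u l + letters u l d = f (l, d).
  by case: l; rewrite /offset /= ffunE ?add0r // addrC subrK.
have bM x : lblock u x \in M.
  elim/lpos_ind: x => [l|l d|l d]; rewrite ?lblock0 ?lblock_fst ?lblock_snd //.
    by rewrite /rung uE; exact: (fP (l, d)).
  by rewrite /rung uE; exact: (fP (l, d)).
have MK : M \subset complete V := subset_trans (member_sub MF) (subsetDl _ _).
have cD : #|{: bool * 'I_p}| = #|{: V}|.
  by rewrite card_levels card_prod card_bool card_ord mul2n.
have pM := member_partition MF.
have wB := block_bij MK pM cD bM (@lblock_sep u).
have wI l : injective (word (letters u l)).
  move=> i j ij; apply: (congr1 snd (_ : (l, i) = (l, j))); apply: (bij_inj wB).
  by rewrite /lword /= ij.
exists u; last by rewrite /lfact /lstart (im2_blocks lmirrorK MK pM cD bM (@lblock_sep u)) -JE.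
by apply/and3P; split=> //; apply/injectiveP; [exact: (wI false)|exact: (wI true)].
Qed.

End Classification.

Lemma mem_cross_lfact u j : valid u -> (cross j \in lfact u) = (j \notin [set 0; u.1]).
Proof.
by move=> vu; rewrite in_setU (negPf (orbit_cross j vu)) (mem_imset _ _ cross_inj) in_setC.
Qed.

(** The difference [u.1] is the nonzero one whose [cross] matching is missing, and the base matching
    is the translate containing [hub u.1]; its edges give back the letters. *)
Lemma lfact_inj u v : valid u -> valid v -> lfact u = lfact v -> u = v.
Proof.
move=> vu vv uv; have v0 : v.1 != 0 by case/and3P: vv.
have uk : u.1 = v.1.
  have := mem_cross_lfact v.1 vv; rewrite -uv (mem_cross_lfact _ vu) !inE eqxx orbT.
  by rewrite (negPf v0) /= => /negbFE/eqP.
have : lstart u \in lfact v by rewrite -uv; apply/setUP; left; apply: (shift_orbit_id lsh_shift).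
case/setUP => [/imsetP[t _ ut]|/imsetP[j _ uj]]; last first.
  by have := lstart_free vu; rewrite uj im2_lsh_cross eqxx.
have := lsh_pair t (hub_start v); rewrite -ut => /lstart_cases[|[d [l]]]; last first.
  by move/esym/level_cross_neq.
move/setP/(_ (false, 0)); rewrite !inE !xpair_eqE !eqxx /= addr0 orbF eq_sym => /eqP t0.
have {ut t0} suv : lstart u = lstart v by rewrite ut t0 (shift0 (shift_im2 lsh_shift)).
have luv l d : letters u l d = letters v l d.
  have := rung_start u d l; rewrite suv => /lstart_cases[/level_cross_neq //|[e [m /rung_eq]]].
  by case=> _ _; rewrite /offset uk => /addrI.
case: u v uk luv {vu vv uv v0 suv} => [k [a0 a1]] [k' [b0 b1]] /= -> luv.
congr (_, (_, _)); apply/ffunP => d; [exact: (luv false)|exact: (luv true)].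
Qed.

(** * Signs of the invariant factorizations on two copies *)

Lemma lmirror_block e : e \in pairing lmirror ->
  e = [set (false, ord0); (true, ord0)] \/ exists l d, e = [set (l, fst_pos d); (l, snd_pos d)].
Proof.
case/imsetP => x _ ->; elim/lpos_ind: x => [l|l d|l d].
- by left; rewrite lmirror0; case: l; rewrite //= setUC.
- by right; exists l, d; rewrite lmirror_fst.
- by right; exists l, d; rewrite lmirror_snd setUC.
Qed.

Lemma position_key_inj : injective dkey.
Proof. exact: (lkey_inj (@ord_inj p) (@ltn_ord p)). Qed.

Lemma vkey_lt (x : K) : (kkey x < p)%N.
Proof. by rewrite -[X in (_ < X)%N](card_Fp pP) card_ord ltn_ord. Qed.

Lemma vkey_inj : injective vkey.
Proof. exact: (lkey_inj (@kkey_inj h') vkey_lt). Qed.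

Lemma sg_consecutive l d y : y \notin [set (l, fst_pos d); (l, snd_pos d)] ->
  sg dkey (l, fst_pos d) y = sg dkey (l, snd_pos d) y.
Proof.
rewrite !inE negb_or -!(inj_eq position_key_inj) /sg => /andP[]; set n := dkey y.
rewrite /lkey /= val_fst_pos val_snd_pos => n1 n2; congr (if _ then _ else _).
by move: n1 n2; set c := (l * _)%N; lia.
Qed.

Lemma chi_level l d (f : {set bool * 'I_p}) : [disjoint [set (l, fst_pos d); (l, snd_pos d)] & f] ->
  chi dkey [set (l, fst_pos d); (l, snd_pos d)] f = 1.
Proof.
move=> dis; rewrite /chi big_setU1 /=; last by rewrite inE xpair_eqE eqxx fst_neq_snd.
rewrite big_set1 -big_split big1 // => y yf /=; rewrite sg_consecutive ?sg_sqr //.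
by apply: contraTN yf => ye; rewrite (disjointFr dis ye).
Qed.

(** All blocks but one occupy two consecutive positions, and such a block crosses nothing. *)
Lemma msign_lmirror : msign dkey (pairing lmirror) = 1.
Proof.
have tP : trivIset (pairing lmirror) by case/and3P: (partition_pairing lmirrorK).
have chC := chiC_part position_key_inj tP (even_pairs_pairing lmirror_neq).
apply: pairprod1; first exact: rk_tournament.
move=> e f eG fG ef; have dis := trivIsetP tP _ _ eG fG ef.
have [eE|[l [d eE]]] := lmirror_block eG; last by rewrite eE chi_level // -eE.
have [fE|[l [d fE]]] := lmirror_block fG; first by rewrite eE fE eqxx in ef.
by rewrite chC // fE chi_level // -fE disjoint_sym.
Qed.

Lemma big_lmirror (g : {set bool * 'I_p} -> int) : \prod_(e in pairing lmirror) g e =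
  g [set (false, ord0); (true, ord0)] *
  \prod_d (g [set (false, fst_pos d); (false, snd_pos d)] * g [set (true, fst_pos d); (true, snd_pos d)]).
Proof.
pose blk (x : 'I_h * bool) : {set bool * 'I_p} := [set (x.2, fst_pos x.1); (x.2, snd_pos x.1)].
have -> : pairing lmirror = [set (false, ord0); (true, ord0)] |: [set blk x | x : 'I_h * bool].
  apply/setP => e; rewrite in_setU1; apply/idP/orP => [/lmirror_block[->|[l [d ->]]]|].
  - by left.
  - by right; apply/imsetP; exists (d, l).
  case=> [/eqP ->|/imsetP[[d l] _ ->]].
    by apply/imsetP; exists (false, ord0); rewrite // lmirror0.
  by apply/imsetP; exists (l, fst_pos d); rewrite // lmirror_fst.
rewrite big_setU1 /=; last first.
  apply/negP => /imsetP[[d l] _] /setP/(_ (l, fst_pos d)).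
  by rewrite !inE !xpair_eqE !eqxx (negPf (fst_neq0 d)) /= !andbF.
rewrite big_imset /=; last first.
  move=> [d l] [e m] _ _ /setP/(_ (l, fst_pos d)); rewrite !inE !xpair_eqE !eqxx /=.
  by rewrite (negPf (fst_neq_snd _ _)) andbF orbF => /esym/andP[/eqP-> /eqP/fst_pos_inj->].
congr (_ * _); rewrite -(pair_big xpredT xpredT (fun d l => g (blk (d, l)))) /=.
by apply: eq_bigr => d _; rewrite big_bool mulrC.
Qed.

Lemma p_odd : odd p. Proof. by rewrite /= odd_double. Qed.

Definition step_sign (d : 'I_h) : int := \prod_t sg (@kkey h') t (t + d.+1%:R).

Definition orbit_weight u (x y : bool * 'I_p) : int :=
  sg dkey x y * \prod_t sg vkey (lsh t (lword u x)) (lsh t (lword u y)).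

Lemma orbit_weightC u x y : valid u -> orbit_weight u x y = orbit_weight u y x.
Proof.
move=> vu; case: (eqVneq x y) => [->//|xy].
rewrite /orbit_weight (sgN position_key_inj xy) mulNr -mulrN; congr (_ * _).
rewrite [in RHS](eq_bigr (fun t => -1 * sg vkey (lsh t (lword u x)) (lsh t (lword u y)))) => [|t _].
  by rewrite big_split /= prodr_const card_Fp // -signr_odd p_odd mulN1r opprK.
rewrite mulN1r (sgN vkey_inj) // (inj_eq (@shift_inj _ _ _ lsh_shift t)).
by rewrite (inj_eq (bij_inj (lword_bij vu))).
Qed.

Lemma orbit_weight_hub u : orbit_weight u (false, ord0) (true, ord0) = 1.
Proof.
rewrite /orbit_weight sg_lkey_cross ?mul1r; last exact: ltn_ord.
by rewrite big1 // => t _; rewrite sg_lkey_cross //; exact: vkey_lt.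
Qed.

Lemma orbit_weight_rung u l d : orbit_weight u (l, fst_pos d) (l, snd_pos d) = step_sign d.
Proof.
rewrite /orbit_weight sg_lkey_same {1}/sg val_fst_pos val_snd_pos ltnSn mul1r.
rewrite /step_sign (reindex_inj (addIr (- (offset u l + letters u l d)))) /=.
apply: eq_bigr => t _; rewrite /lsh /lword /= sg_lkey_same word_fst word_snd [offset u l + (_ + _)]addrA.
by move: (_ + letters _ _ _) => z; rewrite addrA subrK.
Qed.

(** Each difference occurs once in either copy with the same [step_sign], so these signs cancel in
    pairs. *)
Lemma orbit_weight_prod u : valid u -> \prod_(e in pairing lmirror) pp e (orbit_weight u) = 1.
Proof.
move=> vu; rewrite big_lmirror pp_set2 //; last exact: orbit_weightC.
rewrite orbit_weight_hub mul1r big1 // => d _.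
rewrite !pp_set2 ?xpair_eqE ?fst_neq_snd ?andbF //; try exact: orbit_weightC.
by rewrite !orbit_weight_rung /step_sign -big_split big1 // => t _; exact: sg_sqr.
Qed.

Lemma bsign_lword u : valid u -> bsign dkey vkey (lword u) =
  bsign pkey (@kkey h') (word u.2.1) * bsign pkey (@kkey h') (word u.2.2).
Proof.
move=> vu; have wI l : injective (word (letters u l)) by exact: valid_word.
have addI l : injective (fun i => offset u l + word (letters u l) i) by move=> i j /addrI/wI.
rewrite (bsign_levels (@ord_inj p) (@kkey_inj h') (@ltn_ord p) vkey_lt addI).
congr (_ * _).
  by apply: eq_pairprod => [|i j _ _ _]; [exact: rk_tournament|rewrite /flip /offset !add0r].
have wB : bijective (word (letters u true)).
  by apply: inj_card_bij; [exact: wI|rewrite card_Fp // card_ord].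
have shiftK : @is_shift p K (fun t x => t + x) by split=> *; rewrite ?add0r ?addrA.
transitivity (bsign pkey (@kkey h') ((fun x => u.1 + x) \o word (letters u true))); first by [].
rewrite (bsign_comp pkey (@kkey_inj h') (@kkey_inj h') wB (@addrI _ u.1)).
by rewrite (bsign_shift pP p_odd (@kkey_inj h') shiftK) mulr1.
Qed.

(** [twist j] translates the upper copy only: it has sign 1 and keeps the order inside every
    block. *)
Lemma msign_cross j : msign vkey (cross j) = msign vkey (cross 0).
Proof.
have tI := @twist_inj j; have pc := partition_cross0.
have := msign_relabel vkey_inj vkey_inj tI pc (complete_even_pairs (subxx _) (cross_complete 0)).
rewrite -/(im2 _ _) im2_twist => ->; rewrite [X in _ * X]big1 ?mulr1; last first.
  move=> _ /imsetP[x _ ->]; rewrite pp_set2 //; last exact: (flipC vkey_inj vkey_inj tI).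
  by rewrite /flip !sg_lkey_cross //; exact: vkey_lt.
have addI (l : bool) : injective (fun x : K => (if l then j else 0) + x) by move=> x y /addrI.
have -> : bsign vkey vkey (twist j) =
    bsign vkey vkey (fun x => (x.1, (if x.1 then j else 0) + x.2)).
  apply: eq_pairprod => [|x y _ _ _]; first exact: rk_tournament.
  by case: x y => [[] x] [[] y]; rewrite /flip /twist /= ?add0r.
rewrite (bsign_levels (@kkey_inj h') (@kkey_inj h') vkey_lt vkey_lt addI).
have shiftK : @is_shift p K (fun t x => t + x) by split=> *; rewrite ?add0r ?addrA.
by rewrite !(bsign_shift pP p_odd (@kkey_inj h') shiftK) !mulr1.
Qed.

(** The [p - 2] invariant matchings and the removed one have equal signs, and [p - 1] is even, so
    only the orbit of the base matching counts. *)
Lemma fsign_lfact u : valid u -> msign vkey (cross 0) * fsign vkey (lfact u) =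
  bsign pkey (@kkey h') (word u.2.1) * bsign pkey (@kkey h') (word u.2.2).
Proof.
move=> vu; have u0 : u.1 != 0 by case/and3P: vu.
rewrite /fsign (eq_bigl [predU shift_orbit lsh (lstart u) & [set cross j | j in ~: [set 0; u.1]]]);
  last by move=> M; rewrite !inE.
rewrite bigU /=; last first.
  rewrite disjoint_sym; apply/pred0P => X; apply/negP => /andP[/= /imsetP[j _ ->]].
  by rewrite (negPf (orbit_cross j vu)).
rewrite [X in _ * (_ * X)]big_imset /=; last by move=> i j _ _; exact: cross_inj.
rewrite (eq_bigr _ (fun j _ => msign_cross j)) prodr_const card_other //.
have -> : \prod_(M in shift_orbit lsh (lstart u)) msign vkey M =
    bsign pkey (@kkey h') (word u.2.1) * bsign pkey (@kkey h') (word u.2.2).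
  rewrite -bsign_lword //.
  rewrite -/(fsign vkey _) (fsign_orbit pP p_odd vkey_inj lsh_shift position_key_inj lmirrorK lmirror_neq
     (lword_bij vu)); last exact: (shift_free (shift_im2 lsh_shift) (lstart_free vu)).
  by rewrite msign_lmirror mul1r -/(orbit_weight u) orbit_weight_prod // mulr1.
rewrite mulrCA -exprS -[RHS]mulr1; congr (_ * _).
have -> : (p.-2.+1 = 2 * h)%N by rewrite mul2n.
by rewrite exprM expr2 msign_sqr expr1n.
Qed.

(** For each of the [p - 1] nonzero values of [u.1] the two words are summed independently and
    contribute [T * T = 1]. *)
Lemma msign_Ssum_levels : (msign vkey (cross 0) * Ssum vkey E)%:~R = -1 :> K.
Proof.
rewrite intrM (Ssum_fixed pP p_odd vkey_inj lsh_shift (false, 0) (subsetDl _ _) regular_levels im2_lsh_E).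
rewrite (eq_bigl (mem [set lfact u | u in [set u | valid u]])); last first.
  move=> F; apply/andP/imsetP => [[Ff /eqP fF]|[u + ->]].
    by have [u vu ->] := fixed_factorization_levels Ff fF; exists u; rewrite ?inE.
  by rewrite inE => vu; rewrite one_factorization_lfact // im3_lfact.
rewrite big_imset /=; last by move=> u v; rewrite !inE; exact: lfact_inj.
rewrite mulr_sumr; transitivity (\sum_(k : K | k != 0) starter_sum h' * starter_sum h').
  rewrite /starter_sum big_distrlr /=; under [RHS]eq_bigr => k _ do rewrite pair_big /=.
  rewrite pair_big /=; apply: eq_big => [u|u]; first by rewrite inE.
  by rewrite inE => vu; rewrite -!intrM fsign_lfact.
rewrite (starter_sum_sqr pP) sumr_const.
have -> : #|[pred k : K | k != 0]| = p.-1 by rewrite cardC1 card_Fp.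
by apply/eqP; rewrite -addr_eq0 -mulrSr Fp_natr_eq0 //.
Qed.

End TwoLevels.

Lemma msign_Ssum_twice_prime (p : nat) (V : finType) (kap : V -> nat) (I : {set {set V}}) :
  prime p -> odd p -> #|V| = p.*2 -> injective kap -> I \subset complete V ->
  partition I [set: V] -> (msign kap I * Ssum kap (complete V :\: I))%:~R = -1 :> 'F_p.
Proof.
move=> pP po cV kI IK pI; have p1 := prime_gt1 pP.
have [h' pE] : exists h', p = (h'.+1.*2).+1.
  exists (p./2).-1; have := odd_double_half p; rewrite po.
  by case: p./2 => [|j] E; [rewrite -E in p1 | rewrite -{1}E].
subst p; rewrite -(msign_Ssum_levels pP); congr (_%:~R).
apply: msign_Ssum_const => //.
- exact: vkey_inj.
- exact: cross_complete.
- exact: partition_cross.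
- by rewrite card_levels // cV.
- by rewrite card_levels.
Qed.

Lemma Ssum_paintable_matching n d (I : {set {set 'I_n}}) : (0 < d)%N -> d = n.-2 ->
  perfect_matching (complete 'I_n) I -> Ssum (@nat_of_ord n) (complete 'I_n :\: I) != 0 ->
  is_edge_paintability_index (complete 'I_n :\: I) d /\ is_list_edge_index (complete 'I_n :\: I) d.
Proof.
move=> d0 dE; rewrite perfect_matchingE => /andP[IK pI] S0.
have n0 : (0 < n)%N by case: n dE d0 {I IK pI S0} => // ->.
apply: (Ssum_paintable (Ordinal n0) (@ord_inj n) (subsetDl _ _) _ d0 S0).
by have := regularD IK pI (@regular_complete _); rewrite card_ord dE.
Qed.

Local Close Scope ring_scope.

Theorem corollary6p4 (p : nat) (p_prime : prime p) (p_odd : odd p) :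
  (forall I : {set {set 'I_(p + 1)}}, perfect_matching (complete 'I_(p + 1)) I ->
     is_edge_paintability_index (complete 'I_(p + 1) :\: I) (p - 1) /\
     is_list_edge_index (complete 'I_(p + 1) :\: I) (p - 1)) /\
  (forall I : {set {set 'I_(2 * p)}}, perfect_matching (complete 'I_(2 * p)) I ->
     is_edge_paintability_index (complete 'I_(2 * p) :\: I) (2 * p - 2) /\
     is_list_edge_index (complete 'I_(2 * p) :\: I) (2 * p - 2)) /\
  (5 <= p ->
   forall I : {set {set 'I_(p - 1)}}, perfect_matching (complete 'I_(p - 1)) I ->
     is_edge_paintability_index (complete 'I_(p - 1) :\: I) (p - 3) /\
     is_list_edge_index (complete 'I_(p - 1) :\: I) (p - 3)) /\
  (forall I : {set {set 'I_(2 * p)}}, perfect_matching (complete 'I_(2 * p)) I ->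
     (matching_sign I * signed_factorizations (complete 'I_(2 * p) :\: I)
        = -1 %[mod p%:Z])%Z).
Proof.
have p2 : 2 < p.
  have := prime_gt1 p_prime; rewrite leq_eqVlt => /orP[/eqP E|//].
  by move: p_odd; rewrite -E.
have twice (I : {set {set 'I_(2 * p)}}) : perfect_matching (complete 'I_(2 * p)) I ->
    ((msign (@nat_of_ord _) I * Ssum (@nat_of_ord _) (complete 'I_(2 * p) :\: I))%:~R = -1 :> 'F_p)%R.
  rewrite perfect_matchingE => /andP[IK pI].
  apply: msign_Ssum_twice_prime => //; last exact: ord_inj.
  by rewrite card_ord mul2n.
split; [|split; [|split]].
- move=> I Ipm; have := Ipm; rewrite perfect_matchingE => /andP[IK pI].
  apply: Ssum_paintable_matching => //; [lia|lia|].
  apply: Ssum_complete_neq0 => //; [exact: ord_inj|rewrite card_ord; lia|].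
  apply: (Ssum_complete_succ_prime p_prime p_odd); last exact: ord_inj.
  by rewrite card_ord addn1.
- move=> I Ipm; apply: Ssum_paintable_matching => //; [lia|lia|].
  (* The sum cannot vanish, as its product with a sign is -1 modulo [p]. *)
  apply/eqP => S0; have := twice I Ipm; rewrite S0 mulr0 => /eqP.
  by rewrite eq_sym oppr_eq0 oner_eq0.
- move=> p5 I Ipm; have := Ipm; rewrite perfect_matchingE => /andP[IK pI].
  apply: Ssum_paintable_matching => //; [lia|lia|].
  apply: Ssum_complete_neq0 => //; [exact: ord_inj|rewrite card_ord; lia|].
  apply: (Ssum_complete_pred_prime p_prime p_odd); last exact: ord_inj.
    exact: leq_trans p5.
  by rewrite card_ord subn1.
move=> I Ipm; rewrite matching_sign_msign // signed_factorizationsE ?subsetDl //.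
apply/eqP; rewrite eqz_mod_dvd (dvdz_pcharf (pchar_Fp p_prime)) rmorphB /= twice //.
by rewrite rmorphN1 subrr.
Qed.
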